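(* The polygon $\mathcal{F}$ is a fundamental domain for the group $\Gamma$ acting on the unit disk $\mathbb{D}$.
   Context: Hyperbolic disk: $\mathbb{D}=\{z\in\mathbb{C}:|z|<1\}$ with metric $ds^2=4(dx^2+dy^2)/(1-x^2-y^2)^2$; its orientation-preserving isometry group is $\mathrm{PSU}(1,1)=\{\pm\begin{pmatrix}p&\bar q\\ q&\bar p\end{pmatrix}: p,q\in\mathbb{C},\ |p|^2-|q|^2=1\}$. The group $\Delta$: $\Delta=\langle s_1,s_2,s_3\mid s_1^2=s_2^2=s_3^2=(s_1s_2)^7=(s_2s_3)^3=(s_1s_3)^2=1\rangle$. It acts faithfully on $\mathbb{D}$ as follows. Let $P_0=0$, $P_1=r_0(\cos\frac{5\pi}{14},\sin\frac{5\pi}{14})$, $P_2=(0,y_0)$, where $r_0$ is the unique root in $(0,1)$ of $1-6x^2-97x^4-244x^6-97x^8-6x^{10}+x^{12}$ and $y_0$ is the unique root in $(0,1)$ of $1-6x^2-48x^4-83x^6-48x^8-6x^{10}+x^{12}$ (the hyperbolic triangle $P_0P_1P_2$ has angles $\pi/7,\pi/2,\pi/3$ at $P_0,P_1,P_2$). The generators $s_1,s_2,s_3$ act as the hyperbolic reflections in the geodesics through $P_0P_1$, $P_0P_2$, $P_1P_2$ respectively (products act as compositions, rightmost factor first). The elements $\gamma_i$: define $\gamma_1=s_2s_3s_2s_1s_2s_1s_3s_2s_1s_2s_1s_3s_2s_1s_2s_1s_2s_3s_2s_1s_2s_1s_2s_1s_3s_2s_1s_2s_1s_3s_2s_1s_2s_1s_3s_2s_1s_2$,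 $\gamma_2=s_1s_2s_3s_2s_1s_2s_1s_2s_1s_3s_2s_1s_2s_1s_3s_2s_1s_2s_1s_2s_3s_2s_1s_2s_1s_2s_1s_3s_2s_1s_2s_1s_3s_2s_1s_2$, $\gamma_3=(s_1s_2)^3(s_3s_2s_1s_2s_1)^3s_2s_3s_2s_1s_2s_1s_2s_1s_3s_2s_1s_2s_1s_2s_3s_2s_1s_2s_1s_3s_2s_1s_2$, $\gamma_4=(s_1s_2)^2s_3s_2s_1s_2s_1s_2s_3s_2s_1s_2s_1s_2s_1s_3s_2s_1s_2s_1s_3s_2s_1s_2s_1s_2s_3s_2s_1s_2s_1s_2s_3s_2(s_1s_2)^2$, $\gamma_5=s_1s_3s_2s_1s_2s_1s_3s_2s_1s_2s_1s_2s_3s_2s_1s_2s_1s_2s_1s_3s_2s_1s_2s_1s_3s_2s_1s_2s_1s_2s_3s_2s_1s_2s_1s_2$, $\gamma_6=s_2s_3s_2s_1s_2s_1s_2s_3s_2s_1s_2s_1s_2s_1s_3s_2s_1s_2s_1s_3s_2s_1s_2s_1s_2s_3s_2s_1s_2s_1s_2s_1s_3s_2s_1s_2s_1s_2$, and $\gamma_i=s_2s_1\gamma_{i-6}s_1s_2$ for $7\le i\le 42$. $\Gamma$ is the subgroup of $\Delta$ generated by $\gamma_1,\dots,\gamma_{42}$; via the action of $\Delta$ on $\mathbb{D}$ in which $s_1,s_2,s_3$ act as the hyperbolic reflections in the geodesics through $P_0P_1$, $P_0P_2$, $P_1P_2$ respectively, it is regarded as a subgroup of $\mathrm{PSU}(1,1)$.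 The polygon $\mathcal{F}$: for $g=\pm\begin{pmatrix}a&b\\c&d\end{pmatrix}\in\mathrm{PSU}(1,1)$ with $c\ne0$, the isometric circle is $I(g)=\{z\in\mathbb{C}:|cz+d|=1\}$ and its exterior is $\mathrm{ext}(I(g))=\{z\in\mathbb{D}:|cz+d|>1\}$. Then $\mathcal{F}$ is the closure of $\bigcap_{i=1}^{42}\mathrm{ext}(I(\gamma_i))$. It is a compact hyperbolic polygon in $\mathbb{D}$ with $42$ sides. A closed set $D\subseteq\mathbb{D}$ is a fundamental domain for a Fuchsian group $G$ if (1) no two distinct points of the interior of $D$ are equivalent under $G$, and (2) every point of $\mathbb{D}$ is equivalent under $G$ to some point of $D$. *)

(* Defs.v *)
From HB Require Import structures.
From mathcomp Require Import all_boot all_order all_algebra.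
From mathcomp Require Import all_classical all_reals all_analysis.
From mathcomp Require Import complex.

Set Implicit Arguments.
Unset Strict Implicit.
Unset Printing Implicit Defensive.

Import Order.TTheory GRing.Theory Num.Theory numFieldNormedType.Exports.

Local Open Scope classical_set_scope.

Definition i1 : 'I_3 := @Ordinal 3 0 isT.
Definition i2 : 'I_3 := @Ordinal 3 1 isT.
Definition i3 : 'I_3 := @Ordinal 3 2 isT.

(* Since the relators make every generator an involution, each element of     *)
(* Delta is a product of generators: formal inverses are not needed, and      *)
(* inversion is reversal of words.                                            *)
Definition word : Type := seq 'I_3.
HB.instance Definition _ := Choice.on word.

Definition relators : seq word :=
  [:: [:: i1; i1]; [:: i2; i2]; [:: i3; i3];
      flatten (nseq 7 [:: i1; i2]);
      flatten (nseq 3 [:: i2; i3]);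
      flatten (nseq 2 [:: i1; i3])].

Inductive Delta_eq : word -> word -> Prop :=
| Delta_eq_refl w : Delta_eq w w
| Delta_eq_sym w w' : Delta_eq w w' -> Delta_eq w' w
| Delta_eq_trans w w' w'' : Delta_eq w w' -> Delta_eq w' w'' -> Delta_eq w w''
| Delta_eq_relator u r v : r \in relators -> Delta_eq (u ++ r ++ v) (u ++ v).

Lemma Delta_eq_ctx x y u v :
  Delta_eq u v -> Delta_eq (x ++ u ++ y) (x ++ v ++ y).
Proof.
elim=> [w|w w' _|w w' w'' _ + _|a r b ar]; first exact: Delta_eq_refl.
- exact: Delta_eq_sym.
- exact: Delta_eq_trans.
- by rewrite -!catA !(catA x); apply: Delta_eq_relator.
Qed.

Lemma Delta_eq_cat u u' v v' :
  Delta_eq u u' -> Delta_eq v v' -> Delta_eq (u ++ v) (u' ++ v').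
Proof.
move=> uu' vv'; apply: (@Delta_eq_trans _ (u' ++ v)).
  exact: (@Delta_eq_ctx [::] v).
by have := @Delta_eq_ctx u' [::] _ _ vv'; rewrite !cats0.
Qed.

Lemma Delta_eq_nil r : r \in relators -> Delta_eq r [::].
Proof. by move=> /(@Delta_eq_relator [::] r [::]); rewrite /= cats0. Qed.

Lemma Delta_eq_double i : Delta_eq [:: i; i] [::].
Proof.
apply: Delta_eq_nil; rewrite !inE.
by case: i => [[|[|[|]]]] //= lti; rewrite -!(inj_eq val_inj).
Qed.

Lemma Delta_eq_mulrev w : Delta_eq (w ++ rev w) [::].
Proof.
elim: w => [|i w IHw]; first exact: Delta_eq_refl.
rewrite rev_cons -cats1 cat_cons catA -cat1s.
apply: Delta_eq_trans (Delta_eq_ctx [:: i] [:: i] IHw) _.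
exact: Delta_eq_double.
Qed.

Lemma Delta_eq_rev u v : Delta_eq u v -> Delta_eq (rev u) (rev v).
Proof.
move=> uv; apply: (@Delta_eq_trans _ (rev u ++ v ++ rev v)).
  rewrite -{1}[rev u]cats0; apply: Delta_eq_cat; first exact: Delta_eq_refl.
  exact/Delta_eq_sym/Delta_eq_mulrev.
apply: (@Delta_eq_trans _ (rev u ++ u ++ rev v)).
  exact/Delta_eq_ctx/Delta_eq_sym.
rewrite catA -{2}[rev v]cat0s; apply: Delta_eq_cat (Delta_eq_refl _).
by have := Delta_eq_mulrev (rev u); rewrite revK.
Qed.

Definition Delta_rel : rel word := fun u v => `[< Delta_eq u v >].

Lemma Delta_rel_refl : reflexive Delta_rel.
Proof. by move=> u; apply/asboolP/Delta_eq_refl. Qed.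

Lemma Delta_rel_sym : symmetric Delta_rel.
Proof. by move=> u v; apply/asboolP/asboolP => /Delta_eq_sym. Qed.

Lemma Delta_rel_trans : transitive Delta_rel.
Proof.
move=> v u w /asboolP uv /asboolP vw; apply/asboolP.
exact: Delta_eq_trans uv vw.
Qed.

Canonical Delta_equiv_rel :=
  EquivRel Delta_rel Delta_rel_refl Delta_rel_sym Delta_rel_trans.

(* The triangle group with the presentation                                   *)
(* <s1, s2, s3 | s1^2, s2^2, s3^2, (s1 s2)^7, (s2 s3)^3, (s1 s3)^2>.          *)
Definition Delta : Type := {eq_quot Delta_rel}%qT.
HB.instance Definition _ := Choice.on Delta.

Definition Delta_class (w : word) : Delta := (\pi_({eq_quot Delta_rel}) w)%qT.
Definition Delta_word (g : Delta) : word :=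
  repr (g : {eq_quot Delta_rel}%qT).

Lemma Delta_wordK g : Delta_class (Delta_word g) = g.
Proof. exact: reprK. Qed.

Lemma Delta_classP u v : Delta_class u = Delta_class v <-> Delta_eq u v.
Proof. by split=> [/eqmodP/asboolP|uv] //; apply/eqmodP/asboolP. Qed.

Lemma Delta_classK w : Delta_eq (Delta_word (Delta_class w)) w.
Proof. exact/Delta_classP/Delta_wordK. Qed.

Definition Delta_mul (g h : Delta) : Delta :=
  Delta_class (Delta_word g ++ Delta_word h).
Definition Delta_inv (g : Delta) : Delta := Delta_class (rev (Delta_word g)).

Lemma Delta_class_cat u v :
  Delta_class (u ++ v) = Delta_mul (Delta_class u) (Delta_class v).
Proof.
by apply/Delta_classP/Delta_eq_sym/Delta_eq_cat; exact: Delta_classK.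
Qed.

Lemma Delta_class_rev w :
  Delta_class (rev w) = Delta_inv (Delta_class w).
Proof. exact/Delta_classP/Delta_eq_sym/Delta_eq_rev/Delta_classK. Qed.

Lemma Delta_mulA : associative Delta_mul.
Proof.
move=> x y z; rewrite -(Delta_wordK x) -(Delta_wordK y) -(Delta_wordK z).
by rewrite -!Delta_class_cat catA.
Qed.

Lemma Delta_mul1 : left_id (Delta_class [::]) Delta_mul.
Proof. by move=> x; rewrite -(Delta_wordK x) -Delta_class_cat. Qed.

Lemma Delta_mulr1 : right_id (Delta_class [::]) Delta_mul.
Proof. by move=> x; rewrite -(Delta_wordK x) -Delta_class_cat cats0. Qed.

Lemma Delta_mulrV : right_inverse (Delta_class [::]) Delta_inv Delta_mul.
Proof.
move=> x; rewrite -(Delta_wordK x) -Delta_class_rev -Delta_class_cat.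
exact/Delta_classP/Delta_eq_mulrev.
Qed.

Lemma Delta_mulV : left_inverse (Delta_class [::]) Delta_inv Delta_mul.
Proof.
move=> x; rewrite -(Delta_wordK x) -Delta_class_rev -Delta_class_cat.
by apply/Delta_classP; rewrite -{2}[Delta_word x]revK; exact: Delta_eq_mulrev.
Qed.

HB.instance Definition _ := isGroup.Build Delta
  Delta_mulA Delta_mul1 Delta_mulr1 Delta_mulV Delta_mulrV.

Section GammaGroup.
Local Open Scope group_scope.

Definition s1 : Delta := Delta_class [:: i1].
Definition s2 : Delta := Delta_class [:: i2].
Definition s3 : Delta := Delta_class [:: i3].

Definition gamma1 : Delta :=
  s2 * s3 * s2 * s1 * s2 * s1 * s3 * s2 * s1 * s2 * s1 * s3 * s2 * s1 * s2 *
  s1 * s2 * s3 * s2 * s1 * s2 * s1 * s2 * s1 * s3 * s2 * s1 * s2 * s1 * s3 *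
  s2 * s1 * s2 * s1 * s3 * s2 * s1 * s2.

Definition gamma2 : Delta :=
  s1 * s2 * s3 * s2 * s1 * s2 * s1 * s2 * s1 * s3 * s2 * s1 * s2 * s1 * s3 *
  s2 * s1 * s2 * s1 * s2 * s3 * s2 * s1 * s2 * s1 * s2 * s1 * s3 * s2 * s1 *
  s2 * s1 * s3 * s2 * s1 * s2.

Definition gamma3 : Delta :=
  (s1 * s2) ^+ 3 * (s3 * s2 * s1 * s2 * s1) ^+ 3 * s2 * s3 * s2 * s1 * s2 *
  s1 * s2 * s1 * s3 * s2 * s1 * s2 * s1 * s2 * s3 * s2 * s1 * s2 * s1 * s3 *
  s2 * s1 * s2.

Definition gamma4 : Delta :=
  (s1 * s2) ^+ 2 * s3 * s2 * s1 * s2 * s1 * s2 * s3 * s2 * s1 * s2 * s1 * s2 *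
  s1 * s3 * s2 * s1 * s2 * s1 * s3 * s2 * s1 * s2 * s1 * s2 * s3 * s2 * s1 *
  s2 * s1 * s2 * s3 * s2 * (s1 * s2) ^+ 2.

Definition gamma5 : Delta :=
  s1 * s3 * s2 * s1 * s2 * s1 * s3 * s2 * s1 * s2 * s1 * s2 * s3 * s2 * s1 *
  s2 * s1 * s2 * s1 * s3 * s2 * s1 * s2 * s1 * s3 * s2 * s1 * s2 * s1 * s2 *
  s3 * s2 * s1 * s2 * s1 * s2.

Definition gamma6 : Delta :=
  s2 * s3 * s2 * s1 * s2 * s1 * s2 * s3 * s2 * s1 * s2 * s1 * s2 * s1 * s3 *
  s2 * s1 * s2 * s1 * s3 * s2 * s1 * s2 * s1 * s2 * s3 * s2 * s1 * s2 * s1 *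
  s2 * s1 * s3 * s2 * s1 * s2 * s1 * s2.

(* Only the values at 1 <= n <= 42 are used; gamma 0 is a dummy. *)
Fixpoint gamma (n : nat) : Delta :=
  match n with
  | 0 => 1
  | 1 => gamma1
  | 2 => gamma2
  | 3 => gamma3
  | 4 => gamma4
  | 5 => gamma5
  | 6 => gamma6
  | m.+4.+2 => s2 * s1 * gamma m * s1 * s2
  end.

Definition is_subgroup (H : set Delta) : Prop :=
  [/\ H 1, forall x y, H x -> H y -> H (x * y) & forall x, H x -> H x^-1].

Definition gammas : set Delta := [set gamma i | i in [set i | 1 <= i <= 42]%N].

Definition Gamma : set Delta := smallest is_subgroup gammas.

End GammaGroup.

Local Open Scope ring_scope.

(* The ascription gives complex R the topology of its norm. *)
Definition C (R : realType) : numClosedFieldType := complex R.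
Arguments C : simpl never.

Section Disk.
Variable R : realType.

Definition disk : set (C R) := [set z | `|z| < 1].

(* For p in the disk: the orientation-preserving isometry of the disk taking  *)
(* p to 0; its inverse is disk_shift (- p).                                   *)
Definition disk_shift (p z : C R) : C R := (z - p) / (1 - p^* * z).

(* For p <> q in the disk: disk_shift p takes the geodesic through p and q to *)
(* the diameter through u, and multiplying the conjugate by the unit complex  *)
(* number u / u^* is the reflection in that diameter.                         *)
Definition reflection (p q z : C R) : C R :=
  let u := disk_shift p q in
  disk_shift (- p) (u / u^* * (disk_shift p z)^*).

Definition r0 : R := xget 0 [set x | 0 < x < 1 /\
  1 - 6 * x ^+ 2 - 97 * x ^+ 4 - 244 * x ^+ 6 - 97 * x ^+ 8
    - 6 * x ^+ 10 + x ^+ 12 = 0].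

Definition y0 : R := xget 0 [set x | 0 < x < 1 /\
  1 - 6 * x ^+ 2 - 48 * x ^+ 4 - 83 * x ^+ 6 - 48 * x ^+ 8
    - 6 * x ^+ 10 + x ^+ 12 = 0].

Definition P0 : C R := 0.
Definition P1 : C R :=
  Complex (r0 * cos (5 * pi / 14)) (r0 * sin (5 * pi / 14)).
Definition P2 : C R := Complex 0 y0.

Definition generator_act (i : 'I_3) : C R -> C R :=
  if i == i1 then reflection P0 P1
  else if i == i2 then reflection P0 P2
  else reflection P1 P2.

Definition word_act (w : word) (z : C R) : C R := foldr generator_act z w.

(* On the disk this does not depend on the representative word, because the   *)
(* relators act trivially there.                                              *)
Definition act (g : Delta) (z : C R) : C R := word_act (Delta_word g) z.

Definition SU11 : set 'M[C R]_2 := [set M | exists p q : C R,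
  `|p| ^+ 2 - `|q| ^+ 2 = 1 /\
  [/\ M 0 0 = p, M 0 1 = q^*, M 1 0 = q & M 1 1 = p^*]].

Definition mobius (M : 'M[C R]_2) (z : C R) : C R :=
  (M 0 0 * z + M 0 1) / (M 1 0 * z + M 1 1).

(* M is one of the two matrices of g, seen as an element of PSU(1,1). *)
Definition represents (M : 'M[C R]_2) (g : Delta) : Prop :=
  SU11 M /\ forall z, disk z -> mobius M z = act g z.

(* A subgroup of PSU(1,1) is given by its preimage in SU(1,1). *)
Definition Gamma_PSU : set 'M[C R]_2 :=
  [set M | exists2 g, Gamma g & represents M g].

Definition ext_isometric_circle (M : 'M[C R]_2) : set (C R) :=
  [set z | disk z /\ 1 < `|M 1 0 * z + M 1 1|].

(* The choice of the matrix does not matter: it is determined up to sign. *)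
Definition ext_I (g : Delta) : set (C R) := [set z | exists M,
  [/\ represents M g, M 1 0 != 0 & ext_isometric_circle M z]].

Definition polygonF : set (C R) :=
  closure (\bigcap_(i in [set i | 1 <= i <= 42]%N) ext_I (gamma i)).

Definition equivalent (G : set 'M[C R]_2) (z w : C R) : Prop :=
  exists2 M, G M & mobius M z = w.

(* D is closed relative to the disk; since the disk is open, D° is also the  *)
(* interior of D relative to the disk.                                        *)
Definition fundamental_domain (G : set 'M[C R]_2) (D : set (C R)) : Prop :=
  [/\ D `<=` disk,
      closure D `&` disk `<=` D,
      forall z w : C R, D° z -> D° w -> z <> w -> ~ equivalent G z w &
      forall z, disk z -> exists2 w, D w & equivalent G z w].

End Disk.

(* Main.v *)
Require Import Defs.
From HB Require Import structures.
From Stdlib Require Import ZArith.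
From mathcomp Require Import all_boot all_order all_algebra.
From mathcomp Require Import all_classical all_reals all_analysis.
From mathcomp Require Import complex ssrZ ring lra zify.

Set Implicit Arguments.
Unset Strict Implicit.
Unset Printing Implicit Defensive.

Import Order.TTheory GRing.Theory Num.Theory numFieldNormedType.Exports.

Arguments Z.mul : simpl never.
Arguments Z.add : simpl never.
Arguments Z.sub : simpl never.
Arguments Z.opp : simpl never.

(** Put [zeta = exp(2 pi i / 7)], [x = 2 cos(2 pi / 7)] and [omega^2 = 1 - x].
The elements of Gamma have matrices with first column [(P, omega Q)], where
[P = 1 + 2 e + 2 y / (1 - zeta)] and [Q = 2 y / (1 - zeta)] with [e] and [y] in
[Z[zeta]]; such matrices of determinant 1 form a group.  At the two other real
places of [Z[x]] the determinant is a sum of positive terms, so the conjugates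
of [P] and [Q] are bounded there, and finitely many matrices remain once [P] and
[Q] are bounded.

The exterior of the isometric circle of [(p, q)] is the set of [z] such that
[|q|^2 (1 + |z|^2) + 2 Re (q p z) > 0], which is a half-plane in the Klein model.
Every element of the group has a half-plane containing F: when [|q|^2 >= 2800]
this follows from a bound on the circumradius of F, and the other elements are
enumerated, each inequality being a nonnegative combination of those of two
consecutive sides.  Hence an element other than [+-1] strictly increases [|z|] on
the interior of F, and two equivalent interior points would each be farther from
0 than the other.  Conversely the orbit point of [z] given by the element
minimising [|q z + p^*|] satisfies all 42 inequalities, by the cocycle relation. *)

(** * Exact arithmetic in Z[zeta] *)

(** No side pairing cycles or angle sums are examined, as in Poincaré's theorem; arithmetic replaces
    them. Disjointness is proved for the whole group of unit norm elements, into which Gamma is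
    merely embedded through its generators; covering uses the 42 generators and the discreteness
    inherited from that group. The shape of P and Q says that the quaternion P + J Q is 1 + 2 a,
    with a in the order spanned over Z[zeta] by 1 and (1 + J) / (1 - zeta), where J induces
    conjugation on Z[zeta] and J^2 = x - 1. Level 2 excludes the rotations about 0: the rotation by
    2 pi / 7, with P = zeta^4 and Q = 0, has norm 1 in the order itself. These rotations serve
    instead as symmetries of F, and reduce the enumeration to one seventh. The half-plane of (p, q)
    is bounded by a geodesic at distance d from 0 with sinh d = |q|. Hence the threshold 2800 has to
    bound sinh^2 of the circumradius of F, while a larger one lengthens the enumeration. *)

Section Encoding.
Local Open Scope Z_scope.

(* [Cyc a0 .. a6] is the sum of the [ai zeta^i]: Z[zeta] is the quotient of   *)
(* these vectors by the multiples of (1, .., 1), see [ceq].                   *)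
Inductive cyc : Type := Cyc of Z & Z & Z & Z & Z & Z & Z.

Definition cadd a b := let: Cyc a0 a1 a2 a3 a4 a5 a6 := a in
  let: Cyc b0 b1 b2 b3 b4 b5 b6 := b in
  Cyc (a0 + b0) (a1 + b1) (a2 + b2) (a3 + b3) (a4 + b4) (a5 + b5) (a6 + b6).

Definition cscale t a := let: Cyc a0 a1 a2 a3 a4 a5 a6 := a in
  Cyc (t * a0) (t * a1) (t * a2) (t * a3) (t * a4) (t * a5) (t * a6).

Definition crot a := let: Cyc a0 a1 a2 a3 a4 a5 a6 := a in
  Cyc a6 a0 a1 a2 a3 a4 a5.

Definition cbar a := let: Cyc a0 a1 a2 a3 a4 a5 a6 := a in
  Cyc a0 a6 a5 a4 a3 a2 a1.

Definition cint t := Cyc t 0 0 0 0 0 0.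

Definition dot a b := let: Cyc a0 a1 a2 a3 a4 a5 a6 := a in
  let: Cyc b0 b1 b2 b3 b4 b5 b6 := b in
  a0 * b0 + a1 * b1 + a2 * b2 + a3 * b3 + a4 * b4 + a5 * b5 + a6 * b6.

Definition csum a := let: Cyc a0 a1 a2 a3 a4 a5 a6 := a in
  a0 + a1 + a2 + a3 + a4 + a5 + a6.

Definition cmul a b := let: Cyc b0 b1 b2 b3 b4 b5 b6 := cbar b in
  let b := cbar b in let b1 := crot b in let b2 := crot b1 in
  let b3 := crot b2 in let b4 := crot b3 in let b5 := crot b4 in
  let b6 := crot b5 in
  Cyc (dot a b) (dot a b1) (dot a b2) (dot a b3) (dot a b4) (dot a b5)
    (dot a b6).

Definition ceq a b := let: Cyc a0 a1 a2 a3 a4 a5 a6 := a in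
  let: Cyc b0 b1 b2 b3 b4 b5 b6 := b in
  let t := a0 - b0 in
  [&& a1 - b1 =? t, a2 - b2 =? t, a3 - b3 =? t, a4 - b4 =? t, a5 - b5 =? t
    & a6 - b6 =? t].

(* [Kub a b c] is [a + b x + c (x^2 - 2)] with [x = 2 cos(2 pi / 7)].         *)
Inductive kub : Type := Kub of Z & Z & Z.

Definition kadd a b := let: Kub a0 a1 a2 := a in let: Kub b0 b1 b2 := b in
  Kub (a0 + b0) (a1 + b1) (a2 + b2).
Definition ksub a b := let: Kub a0 a1 a2 := a in let: Kub b0 b1 b2 := b in
  Kub (a0 - b0) (a1 - b1) (a2 - b2).
Definition kscale t a := let: Kub a0 a1 a2 := a in
  Kub (t * a0) (t * a1) (t * a2).
Definition kmul a b := let: Kub a0 a1 a2 := a in let: Kub b0 b1 b2 := b in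
  let c := a2 * b2 in let e := a1 * b2 + a2 * b1 in
  Kub (a0 * b0 + 2 * (a1 * b1) - e + c) (a0 * b1 + a1 * b0 - c)
    (a0 * b2 + a2 * b0 + a1 * b1 - e - c).
Definition keq a b := let: Kub a0 a1 a2 := a in let: Kub b0 b1 b2 := b in
  [&& a0 =? b0, a1 =? b1 & a2 =? b2].
Definition kgal a := let: Kub a0 a1 a2 := a in Kub (a0 - a2) (- a2) (a1 - a2).
Definition ktr a := let: Kub a0 a1 a2 := a in 3 * a0 - a1 - a2.

(* With a' the conjugate of a, [cnorm], [cdot] and [cross] give the           *)
(* coordinates of [a a'], [a b' + a' b] and [(a' b - a b') / (zeta - zeta')]. *)
Definition cnorm a :=
  let a1 := crot a in let a2 := crot a1 in let a3 := crot a2 in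
  let n3 := dot a a3 in
  Kub (dot a a - n3) (dot a a1 - n3) (dot a a2 - n3).

Definition cross a b :=
  let b1 := crot b in let b2 := crot b1 in let b3 := crot b2 in
  let a1 := crot a in let a2 := crot a1 in let a3 := crot a2 in
  let m3 := dot a3 b - dot a b3 in
  Kub (dot a1 b - dot a b1 + m3) (dot a2 b - dot a b2) m3.

Definition cdot a b :=
  let b1 := crot b in let b2 := crot b1 in let b3 := crot b2 in
  let a1 := crot a in let a2 := crot a1 in let a3 := crot a2 in
  let n3 := dot a3 b + dot a b3 in
  Kub (2 * dot a b - n3) (dot a1 b + dot a b1 - n3) (dot a2 b + dot a b2 - n3).

(* [num1 / den] and [num2 / den] are truncations of x and of x^2 - 2.         *)
Definition den := 10000000000000000000000000000000000000000.
Definition num1 := 12469796037174670610500097680084796212645.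
Definition num2 := -4450418679126288085778051289935895189329.

Definition klow a := let: Kub a0 a1 a2 := a in
  a0 * den + (if 0 <=? a1 then a1 * num1 else a1 * (num1 + 1))
  + (if 0 <=? a2 then a2 * num2 else a2 * (num2 + 4)).
Definition kpos a := 0 <? klow a.
(** Zero is tested apart because the truncated lower bound cannot certify it; it occurs in
    [dominates] when the half-plane is itself one of the two sides. *)
Definition knneg a := keq a (Kub 0 0 0) || kpos a.
Definition kneg a := kpos (kscale (-1) a).

Fixpoint enumv (cs : seq (seq Z)) (B : Z) : seq (seq Z) :=
  if cs is c :: cs' then
    flatten [seq [seq v :: r | r <- enumv cs' (B - v * v)] | v <- c & v * v <=? B]
  else [:: [::]].

Definition cyc_of s := if s is [:: a0; a1; a2; a3; a4; a5; a6]
  then Cyc a0 a1 a2 a3 a4 a5 a6 else Cyc 0 0 0 0 0 0 0.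
Definition seq_of a := let: Cyc a0 a1 a2 a3 a4 a5 a6 := a in
  [:: a0; a1; a2; a3; a4; a5; a6].

(** Subtracting a multiple of (1, .., 1) keeps the value in Z[zeta] and moves [csum] by a multiple
    of 7, so every class has such a representative. *)
Definition small a := Z.abs (csum a) <=? 3.
(** A normal form under multiplication by powers of zeta, which for y amounts to rotating the
    half-plane about 0. *)
Definition first_max a := let: Cyc a0 a1 a2 a3 a4 a5 a6 := a in
  [&& a1 <=? a0, a2 <=? a0, a3 <=? a0, a4 <=? a0, a5 <=? a0 & a6 <=? a0].

(* The value of [cnorm (epsx * qnum m)] when m has determinant 1 and          *)
(* [y = epsy * m.1]; see [cnorm_target].                                      *)
Definition target y := kadd (Kub 18 (-13) 4) (kmul (Kub 0 4 0) (cnorm y)).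
(* 88 is the bound of [ktr_bounds].                                           *)
Definition possible t :=
  [&& ktr t <=? 88, ~~ kneg (kgal t) & ~~ kneg (kgal (kgal t))].

(** A trace at most 20 and |csum| at most 3 give a sum of squares at most (2 * 20 + 9) / 7 = 7 by
    [ktr_cnorm], hence entries between -2 and 2. *)
Definition ysmall := [seq y <- map cyc_of (enumv (nseq 7 [:: -2; -1; 0; 1; 2]) 7)
  | [&& small y, first_max y & possible (target y)]].

Definition odds := [:: -5; -3; -1; 1; 3; 5].
Definition evens := [:: -4; -2; 0; 2; 4].
Definition theta := Cyc 1 (-1) 0 0 0 0 0.
(* [epsx] and [epsy] balance the three conjugates of the numerators of P and  *)
(* Q, which shortens the enumerations below.                                  *)
Definition epsx := Cyc (-1) 0 (-2) 0 0 (-2) 0.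
Definition epsy := Cyc (-2) 2 1 0 0 1 2.
Definition xpar := cmul epsx theta.
(** The numerator of P is [theta] modulo 2, so the parities of its product with [epsx] are those of
    [xpar]; normalising by an odd multiple of (1, .., 1) reverses them all. *)
Definition parlist b := [seq if Z.odd t (+) b then odds else evens | t <- seq_of xpar].
(** As for [ysmall]: a trace at most 88 gives a sum of squares at most (2 * 88 + 9) / 7 < 27. *)
Definition xall := [seq (x, cnorm x) | x <-
  map cyc_of (enumv (parlist true) 26 ++ enumv (parlist false) 26) & small x].

End Encoding.

Local Open Scope ring_scope.

(** Locked because the integers of [int] are unary: unfolding this at a constant such as [den] would
    never finish. *)
HB.lock Definition zr {T : pzRingType} (a : Z) : T := (int_of_Z a)%:~R.

Section ZR.
Variable T : pzRingType.
Lemma zrD (a b : Z) : zr (Z.add a b) = zr a + zr b :> T.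
Proof. by rewrite zr.unlock -intrD -rmorphD. Qed.
Lemma zrM (a b : Z) : zr (Z.mul a b) = zr a * zr b :> T.
Proof. by rewrite zr.unlock -intrM -rmorphM. Qed.
Lemma zrN (a : Z) : zr (Z.opp a) = - zr a :> T.
Proof. by rewrite zr.unlock -rmorphN -(rmorphN int_of_Z). Qed.
Lemma zrB (a b : Z) : zr (Z.sub a b) = zr a - zr b :> T.
Proof. by rewrite -zrN -zrD. Qed.
End ZR.

Lemma zr_le (T : numDomainType) (a b : Z) : (zr a <= zr b :> T) = Z.leb a b.
Proof. by rewrite zr.unlock ler_int; apply/idP/idP; lia. Qed.
Lemma zr_lt (T : numDomainType) (a b : Z) : (zr a < zr b :> T) = Z.ltb a b.
Proof. by rewrite zr.unlock ltr_int; apply/idP/idP; lia. Qed.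
Lemma zr0 (T : pzRingType) : zr Z0 = 0 :> T. Proof. by rewrite zr.unlock. Qed.
Lemma zr1 (T : pzRingType) : zr (Zpos 1) = 1 :> T.
Proof. by rewrite zr.unlock. Qed.
Lemma zrm1 (T : pzRingType) : zr (Zneg 1) = -1 :> T.
Proof. by rewrite zr.unlock. Qed.
Lemma zr2 (T : pzRingType) : zr (Zpos 2) = 2 :> T.
Proof. by rewrite zr.unlock. Qed.
Lemma zr3 (T : pzRingType) : zr (Zpos 3) = 3 :> T.
Proof. by rewrite zr.unlock. Qed.
Lemma zr4 (T : pzRingType) : zr (Zpos 4) = 4 :> T.
Proof. by rewrite zr.unlock. Qed.

(** * Evaluation at a seventh root of unity *)

Section Ev.
Variable T : comNzRingType.
Implicit Type z : T.

Definition ev z a := let: Cyc a0 a1 a2 a3 a4 a5 a6 := a in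
  zr a0 + zr a1 * z + zr a2 * z ^+ 2 + zr a3 * z ^+ 3 + zr a4 * z ^+ 4
  + zr a5 * z ^+ 5 + zr a6 * z ^+ 6.

Definition evk (x : T) k := let: Kub a b c := k in
  zr a + zr b * x + zr c * (x ^+ 2 - 2).

Definition zrE := (zrD, zrB, zrN, zrM).

Lemma evD z a b : ev z (cadd a b) = ev z a + ev z b.
Proof. by case: a b => ? ? ? ? ? ? ? [] *; rewrite /= !zrE; ring. Qed.
Lemma evZ z t a : ev z (cscale t a) = zr t * ev z a.
Proof. by case: a => * /=; rewrite !zrE; ring. Qed.
Lemma ev_int z t : ev z (cint t) = zr t.
Proof. by rewrite /= !zr0 !mul0r !addr0. Qed.

Lemma ev_bar6 z a : z ^+ 7 = 1 -> ev z (cbar a) = ev (z ^+ 6) a.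
Proof.
move=> z7; case: a => * /=; rewrite -!exprM.
rewrite -[(6 * 2)%N]/(7 + 5)%N -[(6 * 3)%N]/(7 * 2 + 4)%N.
rewrite -[(6 * 4)%N]/(7 * 3 + 3)%N -[(6 * 5)%N]/(7 * 4 + 2)%N.
rewrite -[(6 * 6)%N]/(7 * 5 + 1)%N !exprD !exprM z7 !expr1n; ring.
Qed.

Lemma ev_rot z a : z ^+ 7 = 1 -> ev z (crot a) = z * ev z a.
Proof.
move=> z7; case: a => a0 a1 a2 a3 a4 a5 a6 /=.
transitivity (zr a6 * z ^+ 7 + zr a0 * z + zr a1 * z ^+ 2 + zr a2 * z ^+ 3
  + zr a3 * z ^+ 4 + zr a4 * z ^+ 5 + zr a5 * z ^+ 6); last by ring.
by rewrite z7 mulr1.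
Qed.

Lemma evM z a b : z ^+ 7 = 1 -> ev z (cmul a b) = ev z a * ev z b.
Proof.
move=> z7; case: b => b0 b1 b2 b3 b4 b5 b6; set b := Cyc b0 b1 b2 b3 b4 b5 b6.
have -> : ev z a * ev z b = let: Cyc a0 a1 a2 a3 a4 a5 a6 := a in
    zr a0 * ev z b + zr a1 * ev z (crot b) + zr a2 * ev z (crot (crot b))
    + zr a3 * ev z (crot (crot (crot b)))
    + zr a4 * ev z (crot (crot (crot (crot b))))
    + zr a5 * ev z (crot (crot (crot (crot (crot b)))))
    + zr a6 * ev z (crot (crot (crot (crot (crot (crot b)))))).
  rewrite !ev_rot //; case: a => a0 a1 a2 a3 a4 a5 a6.
  move: (ev z b) => B /=; ring.
case: a => a0 a1 a2 a3 a4 a5 a6; rewrite /b /cmul /= !zrE; ring.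
Qed.

Lemma evkD x a b : evk x (kadd a b) = evk x a + evk x b.
Proof. by case: a b => ? ? ? [] *; rewrite /= !zrE; ring. Qed.
Lemma evkB x a b : evk x (ksub a b) = evk x a - evk x b.
Proof. by case: a b => ? ? ? [] *; rewrite /= !zrE; ring. Qed.
Lemma evkZ x t a : evk x (kscale t a) = zr t * evk x a.
Proof. by case: a => * /=; rewrite !zrE; ring. Qed.

Definition cubic (x : T) := x ^+ 3 + x ^+ 2 - 2 * x - 1 = 0.

Lemma evkM x a b : cubic x -> evk x (kmul a b) = evk x a * evk x b.
Proof.
rewrite /cubic => Hx; case: a b => a0 a1 a2 [b0 b1 b2].
(* The two sides differ by this multiple of the cubic, which is 0; the same device serves in the
   later proofs that use [cubic]. *)
apply/eqP; rewrite -subr_eq0 -[X in _ == X](mulr0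
  (- (zr a2 * zr b2 * (x - 1) + (zr a1 * zr b2 + zr a2 * zr b1)))) -Hx /= !zrE.
apply/eqP; rewrite ?zr2; ring.
Qed.

(** Angle doubling for 2 cos: it permutes the three roots of the cubic f cyclically. The cofactor in
    the proof is - f(-x). *)
Lemma cubic_gal x : cubic x -> cubic (x ^+ 2 - 2).
Proof.
rewrite /cubic => Hx; rewrite -[RHS](mulr0 (x ^+ 3 - x ^+ 2 - 2 * x + 1)) -Hx.
ring.
Qed.

Lemma evk_gal x k : cubic x -> evk (x ^+ 2 - 2) k = evk x (kgal k).
Proof.
rewrite /cubic => Hx; case: k => a b c /=; apply/eqP.
rewrite -subr_eq0 -[X in _ == X](mulr0 (zr c * (x - 1))) -Hx !zrE; apply/eqP.
ring.
Qed.

Lemma evk_tr x k : cubic x ->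
  evk x k + evk (x ^+ 2 - 2) k + evk ((x ^+ 2 - 2) ^+ 2 - 2) k = zr (ktr k).
Proof.
move=> Hx; have Hx' := cubic_gal Hx.
rewrite (evk_gal _ Hx') (evk_gal _ Hx) (evk_gal _ Hx).
case: k => a b c /=; rewrite !zrE.
rewrite zr3; ring.
Qed.

Section Root.
Variable z : T.
Hypothesis z7 : z ^+ 7 = 1.
Hypothesis zphi : 1 + z + z ^+ 2 + z ^+ 3 + z ^+ 4 + z ^+ 5 + z ^+ 6 = 0.

Lemma ev_ceq a b : ceq a b -> ev z a = ev z b.
Proof.
case: a b => a0 a1 a2 a3 a4 a5 a6 [b0 b1 b2 b3 b4 b5 b6].
rewrite /ceq; case/and5P => /eqP e1 /eqP e2 /eqP e3 /eqP e4 /andP[/eqP e5 /eqP e6].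
rewrite /= -[RHS]addr0 -(mulr0 (zr (Z.sub a0 b0))) -zphi.
rewrite -[zr a1](subrK (zr b1)) -[zr a2](subrK (zr b2)) -[zr a3](subrK (zr b3)).
rewrite -[zr a4](subrK (zr b4)) -[zr a5](subrK (zr b5)) -[zr a6](subrK (zr b6)).
rewrite -!zrB e1 e2 e3 e4 e5 e6 !zrB; ring.
Qed.

Lemma cubic_root : cubic (z + z ^+ 6).
Proof.
rewrite /cubic.
have -> : (z + z ^+ 6) ^+ 3 = z ^+ 3 + 3 * (z ^+ 7 * z) + 3 * (z ^+ 7 * z ^+ 6)
   + (z ^+ 7) ^+ 2 * z ^+ 4 by ring.
have -> : (z + z ^+ 6) ^+ 2 = z ^+ 2 + 2 * z ^+ 7 + z ^+ 7 * z ^+ 5 by ring.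
rewrite z7 -zphi; ring.
Qed.

Lemma evk_root k : evk (z + z ^+ 6) k = let: Kub a b c := k in
  zr a + zr b * (z + z ^+ 6) + zr c * (z ^+ 2 + z ^+ 5).
Proof.
case: k => a b c /=.
have -> : (z + z ^+ 6) ^+ 2 = z ^+ 2 + 2 * z ^+ 7 + z ^+ 7 * z ^+ 5 by ring.
rewrite z7; ring.
Qed.

Lemma ev_sym n0 n1 n2 n3 :
  ev z (Cyc n0 n1 n2 n3 n3 n2 n1) =
  evk (z + z ^+ 6) (Kub (Z.sub n0 n3) (Z.sub n1 n3) (Z.sub n2 n3)).
Proof.
rewrite evk_root /= !zrE -[LHS]subr0 -(mulr0 (zr n3)) -zphi; ring.
Qed.

Lemma cnormE a : ev z (cmul a (cbar a)) = evk (z + z ^+ 6) (cnorm a).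
Proof.
case: a => a0 a1 a2 a3 a4 a5 a6.
rewrite /cnorm -ev_sym /cmul /= !zrE; ring.
Qed.

Lemma cdotE a b : ev z (cadd (cmul a (cbar b)) (cmul b (cbar a))) =
  evk (z + z ^+ 6) (cdot a b).
Proof.
case: a b => a0 a1 a2 a3 a4 a5 a6 [b0 b1 b2 b3 b4 b5 b6].
rewrite /cdot -ev_sym /cmul /= !zrE; rewrite ?zr2; ring.
Qed.

Lemma crossE a b : ev z (cmul (cbar a) b) - ev z (cmul a (cbar b)) =
  (z - z ^+ 6) * evk (z + z ^+ 6) (cross a b).
Proof.
have -> k : (z - z ^+ 6) * evk (z + z ^+ 6) k =
    let: Kub m1 m2 m3 := k in zr (Z.sub m1 m3) * (z - z ^+ 6)
    + zr m2 * (z ^+ 2 - z ^+ 5) + zr m3 * (z ^+ 3 - z ^+ 4).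
  rewrite evk_root; case: k => m1 m2 m3.
  transitivity (zr m1 * (z - z ^+ 6) + zr m2 * (z ^+ 2 - z ^+ 7 * z ^+ 5)
      + zr m3 * (z ^+ 3 + z ^+ 6 - z ^+ 7 * (z + z ^+ 4))); first by ring.
  by rewrite z7 zrB; ring.
case: a b => a0 a1 a2 a3 a4 a5 a6 [b0 b1 b2 b3 b4 b5 b6].
rewrite /cross /cmul /= !zrE; ring.
Qed.

End Root.
End Ev.

(** * Certified signs in Z[x] *)

Section Order.
Variable R : realFieldType.
Implicit Type x : R.

Let zden := @zr R den.

Lemma zden_gt0 : 0 < zden.
Proof. by rewrite -(zr0 R) zr_lt. Qed.

(** The cubic at n / den, multiplied by den^3. *)
Definition gden (n : Z) := let d := den in
  Z.sub (Z.sub (Z.add (Z.mul n (Z.mul n n)) (Z.mul d (Z.mul n n)))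
    (Z.mul (Zpos 2) (Z.mul (Z.mul d d) n))) (Z.mul d (Z.mul d d)).

Lemma gden_root x n : cubic x -> 0 < x -> 0 < @zr R n ->
  exists2 e : R, 0 < e & zr (gden n) = (zr n - zden * x) * e.
Proof.
move=> Hx x0 n0; have d0 := zden_gt0.
(* The quotient of the cubic by its factor at x, with x^2 + x - 2 written as 1 / x so that
   positivity is visible; the sign of [gden n] then locates n / den with respect to x. *)
exists (zr n ^+ 2 + zr n * (zden * x) + zden * zr n + zden ^+ 2 / x).
  by rewrite !addr_gt0 ?mulr_gt0 ?exprn_gt0 ?invr_gt0.
have xV : zden ^+ 2 / x = (zden * x) ^+ 2 + zden * (zden * x) - 2 * zden ^+ 2.
  apply: (mulIf (lt0r_neq0 x0)); rewrite mulfVK ?lt0r_neq0 //.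
  apply/eqP; rewrite -subr_eq0 -[X in _ == X](mulr0 (- zden ^+ 2)) -Hx.
  by apply/eqP; ring.
rewrite xV /gden !zrE -/zden; rewrite zr2.
apply/eqP; rewrite -subr_eq0 -[X in _ == X](mulr0 (zden ^+ 3)) -Hx.
by apply/eqP; ring.
Qed.

Lemma gden_num1 : Z.ltb Z0 (gden num1) = false.
Proof. by vm_compute. Qed.
Lemma gden_num1S : Z.ltb (gden (Z.add num1 (Zpos 1))) Z0 = false.
Proof. by vm_compute. Qed.

Lemma root_bounds x : cubic x -> 0 < x ->
  zr num1 <= zden * x <= zr (Z.add num1 (Zpos 1)).
Proof.
move=> Hx x0; apply/andP; split; rewrite leNgt; apply/negP => lt_n.
  have [|e e0 E] := gden_root Hx x0 (n := num1).
    by rewrite -(zr0 R) zr_lt.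
  have : 0 < @zr R (gden num1) by rewrite E mulr_gt0 ?subr_gt0.
  by rewrite -(zr0 R) zr_lt gden_num1.
have [|e e0 E] := gden_root Hx x0 (n := Z.add num1 (Zpos 1)).
  by rewrite -(zr0 R) zr_lt.
have : @zr R (gden (Z.add num1 (Zpos 1))) < 0.
  by rewrite E pmulr_llt0 ?subr_lt0.
by rewrite -(zr0 R) zr_lt gden_num1S.
Qed.

Lemma root_bounds2 x : cubic x -> 0 < x ->
  zr num2 <= zden * (x ^+ 2 - 2) <= zr (Z.add num2 (Zpos 4)).
Proof.
move=> Hx x0; have /andP[lo hi] := root_bounds Hx x0.
have d0 := zden_gt0.
have n0 : 0 < @zr R num1 by rewrite -(zr0 R) zr_lt.
have E : zden * (zden * (x ^+ 2 - 2)) = (zden * x) ^+ 2 - 2 * zden ^+ 2 by ring.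
have lo2 : zr num1 ^+ 2 <= (zden * x) ^+ 2 by rewrite lerXn2r ?nnegrE ?(ltW n0) //
    (le_trans (ltW n0)).
have hi2 : (zden * x) ^+ 2 <= zr (Z.add num1 (Zpos 1)) ^+ 2.
  by rewrite lerXn2r ?nnegrE // (le_trans (ltW n0)) // (le_trans lo).
apply/andP; split; rewrite -(ler_pM2l d0) E.
  apply: le_trans (lerB lo2 (lexx _)).
  by rewrite -(zr2 R) !expr2 -!zrM -zrB zr_le; vm_compute.
(* Squaring widens the unit interval to about 2 num1 / den < 5/2; the increment 4 of [num2] leaves
   room for this and for rounding. *)
apply: le_trans (lerB hi2 (lexx _)) _.
by rewrite -(zr2 R) !expr2 -!zrM -zrB zr_le; vm_compute.
Qed.

Lemma klow_le x k : cubic x -> 0 < x -> zr (klow k) <= zden * evk x k.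
Proof.
move=> Hx x0; have /andP[lo hi] := root_bounds Hx x0.
have /andP[lo2 hi2] := root_bounds2 Hx x0.
case: k => a b c /=; rewrite !zrD zrM -/zden.
have aux (t : Z) (l h : Z) (y : R) : zr l <= y <= zr h ->
    zr (if Z.leb Z0 t then Z.mul t l else Z.mul t h) <= zr t * y.
  case/andP=> ly yh; case: ifP => t0; rewrite zrM.
    by rewrite ler_wpM2l // -(zr0 R) zr_le.
  by rewrite ler_wnM2l // -(zr0 R) zr_le; lia.
have := aux b _ _ _ (root_bounds Hx x0).
have := aux c _ _ _ (root_bounds2 Hx x0).
move=> h1 h2.
have -> : zden * (zr a + zr b * x + zr c * (x ^+ 2 - 2)) =
  zr a * zden + zr b * (zden * x) + zr c * (zden * (x ^+ 2 - 2)) by ring.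
by rewrite !lerD.
Qed.

Lemma kposP x k : cubic x -> 0 < x -> kpos k -> 0 < evk x k.
Proof.
move=> Hx x0 kp; rewrite -(pmulr_rgt0 _ zden_gt0).
by apply: lt_le_trans (klow_le k Hx x0); rewrite -(zr0 R) zr_lt.
Qed.

Lemma keqP a b : keq a b -> a = b.
Proof. by case: a b => a b c [a' b' c'] /and3P[/eqP-> /eqP-> /eqP->]. Qed.

Lemma knnegP x k : cubic x -> 0 < x -> knneg k -> 0 <= evk x k.
Proof.
move=> Hx x0 /orP[/keqP ->|/(kposP Hx x0)/ltW //].
by rewrite /= !zr0 !mul0r !addr0.
Qed.

Lemma knegP x k : cubic x -> 0 < x -> kneg k -> evk x k < 0.
Proof.
move=> Hx x0 /(kposP Hx x0); rewrite evkZ.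
by rewrite zrm1 mulN1r oppr_gt0.
Qed.

End Order.

Lemma mem_enumv cs B s : size s = size cs ->
  (forall i, (i < size cs)%N -> nth Z0 s i \in nth [::] cs i) ->
  Z.leb (foldr (fun v t => Z.add (Z.mul v v) t) Z0 s) B -> s \in enumv cs B.
Proof.
elim: cs B s => [|c cs IH] B [|v s] //= [sz] nths sB.
have sq0 (l : seq Z) : Z.leb Z0 (foldr (fun v t => Z.add (Z.mul v v) t) Z0 l).
  by elim: l => //= a l; nia.
apply/flattenP; exists [seq v :: r | r <- enumv cs (Z.sub B (Z.mul v v))].
  apply/mapP; exists v => //; rewrite mem_filter (nths 0%N isT) andbT.
  by have := sq0 s; lia.
apply/mapP; exists s => //; apply: IH => //; last lia.
by move=> i /(nths i.+1).
Qed.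

(** * Quaternions congruent to 1 modulo 2 *)

Section Integers.
Local Open Scope Z_scope.
(* The pair (y, e) stands for [P = 1 + 2 e + 2 y / (1 - zeta)],               *)
(* [Q = 2 y / (1 - zeta)].                                                    *)
Definition quat : Type := cyc * cyc.

(* These are [(a - a') / (1 - zeta)] and [(a - zeta a') / (1 - zeta)], where  *)
(* a' is the conjugate of a.                                                  *)
Definition sym_div a := let: Cyc _ a1 a2 a3 a4 a5 a6 := a in
  let m3 := a4 - a3 in let m2 := a5 - a2 + m3 in let m1 := a6 - a1 + m2 in
  Cyc m1 m2 m3 0 m3 m2 m1.
Definition rot_div a := let: Cyc a0 a1 a2 a3 a4 a5 a6 := a in
  let n3 := a5 - a3 in let n2 := a6 - a2 + n3 in let n1 := a0 - a1 + n2 in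
  Cyc n1 n2 n3 0 0 n3 n2.

Definition qone : quat := (cint 0, cint 0).
(** An element is 1 + 2 a, and (1 + 2 a) (1 + 2 b) = 1 + 2 (a + b + 2 a b). The terms under
    [cscale 2] are the coordinates of a b; [sym_div] and [rot_div] perform the divisions by 1 - zeta
    that turn out to be exact. *)
Definition qmul (m n : quat) : quat := let: (y1, e1) := m in let: (y2, e2) := n in
  (cadd (cadd y1 y2) (cscale 2 (cadd (cadd (cmul y1 e2) (cmul (cbar e1) y2))
      (cmul (rot_div y1) y2))),
   cadd (cadd e1 e2) (cscale 2 (cadd (cmul (sym_div e1) y2)
     (cadd (cmul e1 e2) (cscale (-1) (cmul (cbar y1) y2)))))).
Definition qinv (m : quat) : quat := let: (y, e) := m in
  (cscale (-1) y, cadd (cbar e) (rot_div y)).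
(** Conjugation by a rotation about 0 multiplies Q by zeta^6 and keeps P; e absorbs the change
    because y / (1 - zeta) - zeta^6 y / (1 - zeta) = - zeta^6 y. *)
Definition qrot (m : quat) : quat := let: (y, e) := m in
  let y' := crot (crot (crot (crot (crot (crot y))))) in
  (y', cadd e (cscale (-1) y')).
Definition qnum (m : quat) : cyc :=
  cadd (cmul theta (cadd (cint 1) (cscale 2 m.2))) (cscale 2 m.1).
End Integers.

Section Quat.
Variables (F : fieldType) (z : F).
Implicit Types (m n : quat).

Definition qP m := 1 + 2 * ev z m.2 + 2 * ev z m.1 / (1 - z).
Definition qQ m := 2 * ev z m.1 / (1 - z).
End Quat.

Section QuatTheory.
Variables (F : fieldType).
Implicit Types (m n : quat) (z : F).

Lemma root7_cyclotomic z : z ^+ 7 = 1 -> z != 1 ->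
  1 + z + z ^+ 2 + z ^+ 3 + z ^+ 4 + z ^+ 5 + z ^+ 6 = 0.
Proof.
move=> z7 z1; have t0 : 1 - z != 0 by rewrite subr_eq0 eq_sym.
apply: (mulfI t0); rewrite mulr0.
transitivity (1 - z ^+ 7); first by ring.
by rewrite z7 subrr.
Qed.

Section At.
Variable z : F.
Hypotheses (z7 : z ^+ 7 = 1) (z1 : z != 1).

Let t0 : 1 - z != 0. Proof. by rewrite subr_eq0 eq_sym. Qed.
Let z0 : z != 0.
Proof. by apply/eqP => E; move/eqP: z7; rewrite E expr0n eq_sym oner_eq0. Qed.
Let w1 : z ^+ 6 = z^-1.
Proof. by apply: (mulfI z0); rewrite divff // -exprS. Qed.
Let zphi := root7_cyclotomic z7 z1.

Lemma root7_conj : (z ^+ 6) ^+ 7 = 1 /\ z ^+ 6 != 1.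
Proof.
split; first by rewrite -exprM mulnC exprM z7 expr1n.
by rewrite w1 invr_eq1.
Qed.

Lemma root7_conj2 : (z ^+ 6) ^+ 6 = z.
Proof. by rewrite -exprM -[(6 * 6)%N]/(7 * 5 + 1)%N exprD exprM z7 expr1n mul1r. Qed.

Let z7' : z ^+ 7 - 1 = 0. Proof. by rewrite z7 subrr. Qed.

Lemma sym_divE a : ev z (sym_div a) = (ev z a - ev (z ^+ 6) a) / (1 - z).
Proof.
apply: (mulIf t0); rewrite mulfVK // -ev_bar6 //.
case: a => a0 a1 a2 a3 a4 a5 a6 /=; rewrite !zrE zr0 !mul0r !addr0.
apply/eqP; rewrite -subr_eq0 -[X in _ == X](mulr0
  (- (zr a6 - zr a1 + (zr a5 - zr a2 + (zr a4 - zr a3))))) -z7'.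
by apply/eqP; ring.
Qed.

Lemma rot_divE a : ev z (rot_div a) = (ev z a - z * ev (z ^+ 6) a) / (1 - z).
Proof.
apply: (mulIf t0); rewrite mulfVK // -ev_bar6 // -ev_rot //.
case: a => a0 a1 a2 a3 a4 a5 a6 /=; rewrite !zrE zr0 !mul0r !addr0.
apply/eqP; rewrite -subr_eq0 -[X in _ == X](mulr0
  (- (zr a6 - zr a2 + (zr a5 - zr a3)))) -z7'.
by apply/eqP; ring.
Qed.

Lemma qP_mul m n : qP z (qmul m n) =
  qP z m * qP z n + (z + z ^+ 6 - 1) * (qQ (z ^+ 6) m * qQ z n).
Proof.
case: m n => y1 e1 [y2 e2]; rewrite /qP /qQ /= !(evD, evZ) !evM // !ev_bar6 //.
rewrite sym_divE rot_divE zr2 zrm1 w1.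
by field; rewrite z0 t0 subr_eq0 z1.
Qed.

Lemma qQ_mul m n : qQ z (qmul m n) =
  qQ z m * qP z n + qP (z ^+ 6) m * qQ z n.
Proof.
case: m n => y1 e1 [y2 e2]; rewrite /qP /qQ /= !(evD, evZ) !evM // !ev_bar6 //.
rewrite rot_divE zr2 w1.
by field; rewrite z0 t0 subr_eq0 z1.
Qed.

Lemma qP_inv m : qP z (qinv m) = qP (z ^+ 6) m.
Proof.
case: m => y e; rewrite /qP /= !(evD, evZ) !ev_bar6 // rot_divE zrm1 w1.
by field; rewrite z0 t0 subr_eq0 z1.
Qed.

Lemma qQ_inv m : qQ z (qinv m) = - qQ z m.
Proof. by case: m => y e; rewrite /qQ /= !evZ zrm1; ring. Qed.

Lemma qP_one : qP z qone = 1.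
Proof. by rewrite /qP !ev_int zr0 mulr0 mul0r !addr0. Qed.
Lemma qQ_one : qQ z qone = 0.
Proof. by rewrite /qQ !ev_int zr0 mulr0 mul0r. Qed.

Lemma ev_rot6 a : ev z (crot (crot (crot (crot (crot (crot a)))))) = z ^+ 6 * ev z a.
Proof. by rewrite !ev_rot //; ring. Qed.

Lemma qP_rot m : qP z (qrot m) = qP z m.
Proof.
case: m => y e; rewrite /qP [qrot _]/= /fst /snd !(evD, evZ) ev_rot6 zrm1 w1.
by field; rewrite z0 t0.
Qed.

Lemma qQ_rot m : qQ z (qrot m) = z ^+ 6 * qQ z m.
Proof. by case: m => y e; rewrite /qQ [qrot _]/= /fst ev_rot6; ring. Qed.

Lemma qnumE m : ev z (qnum m) = (1 - z) * qP z m.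
Proof.
rewrite /qnum /qP evD evM // evZ evD evZ ev_int zr1 zr2.
rewrite [ev z theta]/= !zr0 zr1 zrm1.
by field.
Qed.

(** The reduced norm, with z^6 for the conjugate of z so that it makes sense in any field. *)
Definition nrd m := qP z m * qP (z ^+ 6) m - (z + z ^+ 6 - 1) * (qQ z m * qQ (z ^+ 6) m).

(** The factor is (1 - z) (1 - z^6), which clears the denominators of P and Q. *)
Lemma nrdE m : (2 - (z + z ^+ 6)) * nrd m =
  evk (z + z ^+ 6) (cnorm (qnum m))
  - 4 * (z + z ^+ 6 - 1) * evk (z + z ^+ 6) (cnorm m.1).
Proof.
rewrite -!cnormE // !evM // !ev_bar6 // qnumE.
have [w7 wn1] := root7_conj.
have -> : ev (z ^+ 6) (qnum m) = (1 - z ^+ 6) * qP (z ^+ 6) m.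
  by rewrite /qnum /qP evD evM // evZ evD evZ ev_int zr1 zr2 [ev _ theta]/= !zr0 zr1 zrm1;
     field; rewrite subr_eq0 eq_sym.
by rewrite /nrd /qQ w1; field; rewrite z0 t0 subr_eq0 z1.
Qed.
End At.

Lemma nrd_mul z m n : z ^+ 7 = 1 -> z != 1 -> nrd z (qmul m n) = nrd z m * nrd z n.
Proof.
move=> z7 z1; have [w7 w1] := root7_conj z7 z1.
rewrite /nrd !qP_mul // !qQ_mul // !root7_conj2 //; ring.
Qed.

Lemma nrd_inv z m : z ^+ 7 = 1 -> z != 1 -> nrd z (qinv m) = nrd z m.
Proof.
move=> z7 z1; have [w7 w1] := root7_conj z7 z1.
rewrite /nrd !qP_inv // !qQ_inv !root7_conj2 //; ring.
Qed.

Lemma nrd_rot z m : z ^+ 7 = 1 -> z != 1 -> nrd z (qrot m) = nrd z m.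
Proof.
move=> z7 z1; have [w7 w1] := root7_conj z7 z1.
rewrite /nrd !qP_rot // !qQ_rot // !root7_conj2 //.
transitivity (qP z m * qP (z ^+ 6) m - (z + z ^+ 6 - 1) * z ^+ 7 *
  (qQ z m * qQ (z ^+ 6) m)); first by ring.
by rewrite z7 mulr1.
Qed.

Lemma nrd_one z : nrd z qone = 1.
Proof. by rewrite /nrd !qP_one !qQ_one; ring. Qed.

End QuatTheory.

Lemma seq_ofK : cancel seq_of cyc_of. Proof. by case. Qed.
HB.instance Definition _ := Equality.copy cyc (can_type seq_ofK).
Definition triple_of a := let: Kub a b c := a in (a, b, c).
Definition kub_of (t : Z * Z * Z) := let: (a, b, c) := t in Kub a b c.
Lemma triple_ofK : cancel triple_of kub_of. Proof. by case. Qed.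
HB.instance Definition _ := Equality.copy kub (can_type triple_ofK).

(** * The finite computations *)

Section Integers.
Local Open Scope Z_scope.
Definition kbeta := Kub (-1) 1 0.
Definition knX := Eval vm_compute in cnorm epsx.
Definition knY := Eval vm_compute in cnorm epsy.
Definition bX2 := Eval vm_compute in kmul kbeta knX.
Definition k0 := Eval vm_compute in kmul kbeta (kmul knX knY).
(* Elements with [|q|^2 >= n0] are handled by the circumradius of F.          *)
Definition n0 := 2800.

(** For x = epsx (1 - zeta) P and epsy y as second entry, the coefficients of (2 - x) (epsx epsy)^2
    / 4 times the form of the overview, x being there 2 cos(2 pi / 7): first that of 1 + |z|^2, then
    the linear one without the common factor [kappa]. The scaling puts them in Z[x] and Z[zeta]. *)
Definition halfplane (xy : cyc * cyc) : kub * cyc :=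
  (kmul bX2 (cnorm xy.2), cmul xy.1 xy.2).
(* The numerators of [epsx P] and [epsy Q] for gamma_4, gamma_3, gamma_2,     *)
(* gamma_1, gamma_6, gamma_5, up to rotation: six consecutive sides of F.     *)
Definition base := [::
  (Cyc (-1) 1 0 (-2) 2 (-2) 0, Cyc (-1) 0 0 0 (-1) 0 0);
  (Cyc 2 0 (-1) 1 1 1 (-1), Cyc 0 1 0 0 1 0 1);
  (Cyc (-1) 1 0 0 0 0 0, Cyc 0 (-1) 1 0 0 (-1) 1);
  (Cyc 0 (-2) 1 (-1) (-1) (-1) 1, Cyc 0 (-1) 0 (-1) 0 0 (-1));
  (Cyc (-1) 1 0 2 (-2) 2 0, Cyc 1 0 0 1 0 0 0);
  (Cyc (-1) 1 0 0 0 0 0, Cyc 0 0 1 (-1) 0 1 (-1))].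
Definition sector : seq (kub * cyc) := Eval vm_compute in map halfplane base.
Definition turn (j : nat) (h : kub * cyc) := (h.1, iter j crot h.2).
Definition edge : Type := (kub * cyc) * (kub * cyc).
HB.instance Definition _ := Equality.on edge.
Definition sector0 := nth (Kub 0 0 0, cint 0) sector.
Definition edges6 : seq edge :=
  [:: (sector0 0, sector0 1); (sector0 1, sector0 2); (sector0 2, sector0 3);
      (sector0 3, sector0 4); (sector0 4, sector0 5); (sector0 5, turn 1 (sector0 0))].
Definition turn_edge j (e : edge) : edge := (turn j e.1, turn j e.2).
Definition edges : seq edge := [seq turn_edge j e | j <- iota 0 7, e <- edges6].

(* Approximations that only serve to discard most edges cheaply in            *)
(* [dominates]; nothing is proved about their accuracy.                       *)
Definition approx a :=
  (dot a (Cyc 10000 6235 (-2225) (-9010) (-9010) (-2225) 6235),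
   dot a (Cyc 0 7818 9749 4339 (-4339) (-9749) (-7818))).
Definition approx_cross (a b : Z * Z) := a.1 * b.2 - a.2 * b.1.
Definition edge_data (e : edge) :=
  (((approx e.1.2, approx e.2.2), cross e.1.2 e.2.2), e).
(* By Cramer's rule, h is a combination of the consecutive half-planes a and b *)
(* with coefficients [ca / c12] and [cb / c12] on the linear parts.           *)
Definition dominates (h : kub * cyc) v (d : (((Z * Z) * (Z * Z)) * kub) * edge) :=
  let: ((ab, c12), (a, b)) := d in
  if -1000000 <=? approx_cross v ab.2 then
  if -1000000 <=? approx_cross ab.1 v then
  let ca := cross h.2 b.2 in let cb := cross a.2 h.2 in
  if knneg ca then if knneg cb then
  knneg (ksub (kmul h.1 c12) (kadd (kmul a.1 ca) (kmul b.1 cb)))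
  else false else false else false else false.

(** A pair matters only if the norm of x is the target of y, so the list of x is first cut down to
    the norms in K. The congruence modulo 7 compares both numerators modulo 1 - zeta. Nested
    conditionals keep [vm_compute] from evaluating the costly tests eagerly. *)
Definition big_check : bool :=
  let T := [seq (y, target y) | y <- ysmall] in
  let K := foldr (fun yt l => if has (keq yt.2) l then l else yt.2 :: l) [::] T in
  let X := [seq xn <- xall | has (keq xn.2) K] in
  let D := map edge_data edges in
  all (fun xn => all (fun yt =>
    if keq xn.2 yt.2 then
    if (csum xn.1 - csum yt.1) mod 7 =? 0 then
    if ceq yt.1 (cint 0) then true else
    let h := halfplane (xn.1, yt.1) in has (dominates h (approx h.2)) D
    else true else true) T) X.

(* The last three tests say that a binary quadratic form is positive definite; *)
(* its positivity bounds the norm of the points of the cone on the edge.      *)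
Definition edge_ok (e : edge) := let: (a, b) := e in
  let f A B V := ksub (kscale n0 (kmul k0 V)) (kscale (4 * (n0 + 1)) (kmul A B)) in
  let d1 := f a.1 a.1 (cnorm a.2) in
  let d2 := f b.1 b.1 (cnorm b.2) in
  let h := f a.1 (kscale 2 b.1) (cdot a.2 b.2) in
  [&& kpos (cross a.2 b.2), kpos d1, kpos d2
    & kpos (ksub (kscale 4 (kmul d1 d2)) (kmul h h))].

(** The inverse of x - 1, which is a unit. *)
Definition kbetaV := Kub 2 2 1.
Definition kd := Kub 2 (-1) 0.
(** This is v = |epsy|^2 (2 - x) / (x - 1). If |q|^2 < n0 then 4 |epsy y|^2 is at most n0 v at the
    place of zeta; unit norm bounds it by - v at the two others, where x - 1 < 0. *)
Definition ybound := Eval vm_compute in kmul knY (kmul kd kbetaV).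
Definition xbound := Eval vm_compute in kmul knX kd.
End Integers.

Lemma edges6_ok : all edge_ok edges6.
Proof. by vm_compute. Qed.

Lemma big_checkT : big_check.
Proof. by vm_compute. Qed.

(** The third identity, x |epsy|^2 = (x - 1) |epsx|^2, is what makes [target] a function of |epsy
    y|^2. With conjugates v', v'' of v = [ybound], the fourth test says n0 v - v' - v'' = (n0 + 1) v
    - Tr v < 84 = 4 * 21; with w = [xbound], the last says (n0 + 1) w + w' + w'' = n0 w + Tr w < 89.
    The integral traces are thus at most 20 and 88. *)
Lemma small_checks : [/\ kmul kbeta kbetaV = Kub (Zpos 1) Z0 Z0,
  target (cint Z0) = kmul knX kd,
  kmul (Kub Z0 (Zpos 4) Z0) knY = kmul (Kub (Zneg 4) (Zpos 4) Z0) knX,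
  kpos (ksub (Kub (Zpos 84) Z0 Z0)
    (ksub (kscale (Z.add n0 (Zpos 1)) ybound) (Kub (ktr ybound) Z0 Z0))) &
  kpos (ksub (Kub (Zpos 89) Z0 Z0)
    (kadd (kscale n0 xbound) (Kub (ktr xbound) Z0 Z0)))].
Proof. by split; vm_compute. Qed.

(** * Representatives and traces in Z[zeta] *)

Section Integers.
Local Open Scope Z_scope.
Implicit Types a b : cyc.

Definition shift k a := let: Cyc a0 a1 a2 a3 a4 a5 a6 := a in
  Cyc (a0 - k) (a1 - k) (a2 - k) (a3 - k) (a4 - k) (a5 - k) (a6 - k).

Lemma ceq_shift k a : ceq a (shift k a).
Proof. by case: a => * /=; rewrite !andbA; do ?[apply/andP; split]; lia. Qed.

Lemma csum_shift k a : csum (shift k a) = csum a - 7 * k.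
Proof. by case: a => * /=; ring. Qed.

Lemma small_shift a : exists k, small (shift k a).
Proof.
exists ((csum a + 3) / 7); rewrite /small csum_shift.
have := Z.div_mod (csum a + 3) 7; have := Z.mod_pos_bound (csum a + 3) 7.
move: (_ / _) (_ mod _) => q r; lia.
Qed.

(** Parseval over the seven seventh roots of unity: the root 1 contributes the square of [csum], and
    the others come in three conjugate pairs. *)
Lemma ktr_cnorm a : 2 * ktr (cnorm a) = 7 * dot a a - csum a * csum a.
Proof. by case: a => * /=; ring. Qed.

Lemma dot_rot a b : dot (crot a) (crot b) = dot a b.
Proof. by case: a b => ? ? ? ? ? ? ? [] * /=; ring. Qed.
Lemma cnorm_rot a : cnorm (crot a) = cnorm a.
Proof. by rewrite /cnorm !dot_rot. Qed.
Lemma cross_rot a b : cross (crot a) (crot b) = cross a b.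
Proof. by rewrite /cross !dot_rot. Qed.
Lemma csum_rot a : csum (crot a) = csum a.
Proof. by case: a => * /=; ring. Qed.
Lemma small_rot j a : small (iter j crot a) = small a.
Proof. by elim: j => //= j <-; rewrite /small csum_rot. Qed.
Lemma cnorm_iter j a : cnorm (iter j crot a) = cnorm a.
Proof. by elim: j => //= j <-; rewrite cnorm_rot. Qed.
Lemma csum_iter j a : csum (iter j crot a) = csum a.
Proof. by elim: j => //= j <-; rewrite csum_rot. Qed.
Lemma cross_iter j a b : cross (iter j crot a) (iter j crot b) = cross a b.
Proof. by elim: j => //= j <-; rewrite cross_rot. Qed.

Lemma csumM a b : csum (cmul a b) = csum a * csum b.
Proof. by case: a b => ? ? ? ? ? ? ? [] *; rewrite /cmul /=; ring. Qed.

Lemma max_index (s : seq Z) : s != [::] ->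
  exists2 i, (i < size s)%N & forall k, (k < size s)%N -> nth 0 s k <= nth 0 s i.
Proof.
elim: s => // a [|b s] IH _; first by exists 0%N => // -[|k] //= _; lia.
have [//|i si Hi] := IH; have [ba|ab] := Z.le_ge_cases (nth 0 (b :: s) i) a.
  exists 0%N => // -[|k] /= sk; first lia.
  by have := Hi k sk; move: ba => /=; lia.
by exists i.+1 => // -[|k] /= sk; [exact: ab|exact: Hi].
Qed.

Lemma first_max_rot a : exists j, first_max (iter j crot a).
Proof.
case: a => a0 a1 a2 a3 a4 a5 a6.
have [//|i si Hi] := @max_index [:: a0; a1; a2; a3; a4; a5; a6].
have := (Hi 0%N isT, Hi 1%N isT, Hi 2%N isT, Hi 3%N isT, Hi 4%N isT, Hi 5%N isT, Hi 6%N isT).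
case: i si {Hi} => [|[|[|[|[|[|[|//]]]]]]] _ /= [[[[[[h0 h1] h2] h3] h4] h5] h6].
- by exists 0%N => /=; lia.
- by exists 6%N => /=; lia.
- by exists 5%N => /=; lia.
- by exists 4%N => /=; lia.
- by exists 3%N => /=; lia.
- by exists 2%N => /=; lia.
- by exists 1%N => /=; lia.
Qed.

Lemma mem_enum7 (f : seq (seq Z)) B a : size f = 7%N ->
  (forall i, (i < 7)%N -> nth 0 (seq_of a) i \in nth [::] f i) ->
  dot a a <= B -> a \in map cyc_of (enumv f B).
Proof.
move=> sf fa aB; apply/mapP; exists (seq_of a); last by rewrite seq_ofK.
apply: mem_enumv; [by rewrite sf; case: a {fa aB}|by rewrite sf|].
by move: aB; case: a {fa} => a0 a1 a2 a3 a4 a5 a6 /= aB; lia.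
Qed.

Lemma coord_bound a B i : dot a a <= B -> nth 0 (seq_of a) i * nth 0 (seq_of a) i <= B.
Proof.
case: a => a0 a1 a2 a3 a4 a5 a6 /=.
have := (Z.square_nonneg a0, Z.square_nonneg a1, Z.square_nonneg a2,
  Z.square_nonneg a3, Z.square_nonneg a4, Z.square_nonneg a5, Z.square_nonneg a6).
move=> [[[[[[h0 h1] h2] h3] h4] h5] h6] aB.
by case: i => [|[|[|[|[|[|[|i]]]]]]] /=; rewrite ?nth_nil; lia.
Qed.

Lemma ysmall_mem y : small y -> first_max y -> possible (target y) ->
  ktr (cnorm y) <= 20 -> y \in ysmall.
Proof.
move=> sy fy py ty; rewrite /ysmall mem_filter sy fy py !andTb.
have yy : dot y y <= 7.
  by have := ktr_cnorm y; move: sy; rewrite /small => sy; nia.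
apply: mem_enum7 => // i i7; have := @coord_bound _ _ i yy.
move: (nth 0 _ _) => v v7; rewrite nth_nseq i7 !inE.
have : v = -2 \/ v = -1 \/ v = 0 \/ v = 1 \/ v = 2 by nia.
by do ![case=> [->//|]] => ->.
Qed.

Lemma xall_mem x (b : bool) : small x -> ktr (cnorm x) <= 88 ->
  (forall i, (i < 7)%N ->
     Z.odd (nth 0 (seq_of x) i) = Z.odd (nth 0 (seq_of xpar) i) (+) b) ->
  (x, cnorm x) \in xall.
Proof.
move=> sx tx par; rewrite /xall; apply/mapP; exists x => //; rewrite mem_filter sx andTb.
have xx : dot x x <= 26.
  by have := ktr_cnorm x; move: sx; rewrite /small => sx; nia.
have : x \in map cyc_of (enumv (parlist b) 26).
  apply: mem_enum7 => // i i7; rewrite /parlist (nth_map 0) //.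
  have := @coord_bound _ _ i xx; have := par i i7; move: (nth 0 (seq_of x) _) => v <- vv.
  have : -5 <= v <= 5 by nia.
  case=> v1 v2; have : v = -5 \/ v = -4 \/ v = -3 \/ v = -2 \/ v = -1 \/ v = 0 \/
    v = 1 \/ v = 2 \/ v = 3 \/ v = 4 \/ v = 5 by lia.
  by do ![case=> [->//|]] => ->.
by rewrite map_cat mem_cat; case: b {par} => h; apply/orP; [left|right]; exact: h.
Qed.

(** The trace form of Z[x] is nondegenerate, with discriminant 49. *)
Lemma kub_eq0 k : ktr k = 0 -> ktr (kmul k (Kub 0 1 0)) = 0 ->
  ktr (kmul k (Kub 0 0 1)) = 0 -> k = Kub 0 0 0.
Proof. by case: k => a b c /= h1 h2 h3; congr Kub; lia. Qed.

End Integers.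

(** * Complex numbers *)

Section Complex.
Variable R : realType.
Implicit Types (z w p q : C R) (x y : R).

Definition re z : R := complex.Re z.
Definition im z : R := complex.Im z.
Definition ofR x : C R := Complex x 0.
Definition nsq z : R := re z ^+ 2 + im z ^+ 2.

Lemma ofRD x y : ofR (x + y) = ofR x + ofR y.
Proof. exact: (rmorphD (real_complex R)). Qed.
Lemma ofRM x y : ofR (x * y) = ofR x * ofR y.
Proof. exact: (rmorphM (real_complex R)). Qed.
Lemma ofRN x : ofR (- x) = - ofR x.
Proof. exact: (rmorphN (real_complex R)). Qed.
Lemma ofRB x y : ofR (x - y) = ofR x - ofR y.
Proof. exact: (rmorphB (real_complex R)). Qed.
Lemma ofRX x n : ofR (x ^+ n) = ofR x ^+ n.
Proof. exact: (rmorphXn (real_complex R)). Qed.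
Lemma ofR_nat n : ofR n%:R = n%:R.
Proof. exact: (rmorph_nat (real_complex R)). Qed.
Lemma ofR_int n : ofR n%:~R = n%:~R.
Proof. exact: (rmorph_int (real_complex R)). Qed.
Lemma ofR_zr n : ofR (zr n) = zr n.
Proof. by rewrite zr.unlock ofR_int. Qed.
Lemma ofR_inj : injective ofR. Proof. by move=> x y []. Qed.
Lemma ofR1 : ofR 1 = 1. Proof. exact: (ofR_nat 1). Qed.
Lemma ofR0 : ofR 0 = 0. Proof. by []. Qed.
Definition ofRE := (ofRD, ofRB, ofRN, ofRM, ofRX, ofR_nat, ofR_zr, ofR1, ofR0).

Lemma conjE z : z^* = Complex (re z) (- im z).
Proof. by case: z. Qed.
Lemma re_conj z : re z^* = re z. Proof. by rewrite conjE. Qed.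
Lemma im_conj z : im z^* = - im z. Proof. by rewrite conjE. Qed.
Lemma reM z w : re (z * w) = re z * re w - im z * im w.
Proof. by case: z => a b; case: w. Qed.
Lemma imM z w : im (z * w) = re z * im w + im z * re w.
Proof. by case: z => a b; case: w. Qed.
Lemma reD z w : re (z + w) = re z + re w.
Proof. by case: z => a b; case: w. Qed.
Lemma imD z w : im (z + w) = im z + im w.
Proof. by case: z => a b; case: w. Qed.
Lemma reN z : re (- z) = - re z. Proof. by case: z. Qed.
Lemma imN z : im (- z) = - im z. Proof. by case: z. Qed.
Lemma reR x : re (ofR x) = x. Proof. by []. Qed.
Lemma imR x : im (ofR x) = 0. Proof. by []. Qed.
Definition riE := (reM, imM, reD, imD, reN, imN, reR, imR, re_conj, im_conj).

Lemma CP z w : re z = re w -> im z = im w -> z = w.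
Proof. by case: z => a b; case: w => c d /= -> ->. Qed.

Lemma nsqM z w : nsq (z * w) = nsq z * nsq w.
Proof. rewrite /nsq !riE; ring. Qed.
Lemma nsq_conj z : nsq z^* = nsq z.
Proof. rewrite /nsq !riE; ring. Qed.
Lemma nsqN z : nsq (- z) = nsq z.
Proof. rewrite /nsq !riE; ring. Qed.
Lemma nsq_ge0 z : 0 <= nsq z.
Proof. by rewrite addr_ge0 ?sqr_ge0. Qed.
Lemma nsqR x : nsq (ofR x) = x ^+ 2.
Proof. by rewrite /nsq !riE expr0n addr0. Qed.
Lemma nsq_eq0 z : (nsq z == 0) = (z == 0).
Proof.
rewrite /nsq paddr_eq0 ?sqr_ge0 // !sqrf_eq0; apply/andP/eqP => [[/eqP a /eqP b]|->] //.
exact: CP.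
Qed.
Lemma mul_conj z : z * z^* = ofR (nsq z).
Proof. apply: CP; rewrite /nsq !riE; ring. Qed.
Lemma normE z : `|z| = ofR (Num.sqrt (nsq z)).
Proof. by rewrite [LHS]normc_def. Qed.
Lemma normX2 z : `|z| ^+ 2 = ofR (nsq z).
Proof. by rewrite normE -ofRX sqr_sqrtr ?nsq_ge0. Qed.
Lemma ofR_lt x y : (ofR x < ofR y) = (x < y).
Proof. exact: ltcR. Qed.
Lemma norm_lt1 z : (`|z| < 1) = (nsq z < 1).
Proof. by rewrite normE -ofR1 ofR_lt -[X in _ < X]sqrtr1 ltr_sqrt. Qed.
Lemma norm_gt1 z : (1 < `|z|) = (1 < nsq z).
Proof.
rewrite normE -ofR1 ofR_lt -[X in X < _]sqrtr1.
have [n0|n0] := ltP 0 (nsq z); first by rewrite ltr_sqrt.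
have -> : nsq z = 0 by apply/eqP; rewrite eq_le n0 nsq_ge0.
by rewrite sqrtr0 sqrtr1 ltr10.
Qed.
Lemma diskE z : disk z <-> nsq z < 1.
Proof. by rewrite /disk /= norm_lt1. Qed.

Lemma nsqD z w : nsq (z + w) = nsq z + nsq w + 2 * re (z * w^*).
Proof. rewrite /nsq !riE; ring. Qed.

Lemma nsqV z : nsq z^-1 = (nsq z)^-1.
Proof.
have [->|z0] := eqVneq z 0; first by rewrite invr0 -ofR0 nsqR expr0n invr0.
apply: (mulfI (_ : nsq z != 0)); first by rewrite nsq_eq0.
by rewrite -nsqM divff // divff ?nsq_eq0 // -ofR1 nsqR expr1n.
Qed.

Definition root7 z := z ^+ 7 = 1 /\ z != 1.

Lemma root7_conj_id z : root7 z -> z^* = z ^+ 6.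
Proof.
case=> z7 _; have z1 : `|z| = 1.
  have : `|z| ^+ 7 = 1 by rewrite -normrX z7 normr1.
  by move/eqP; rewrite pexpr_eq1 // => /eqP.
have zz : z * z^* = 1 by rewrite -normCK z1 expr1n.
by rewrite -[LHS]mul1r -z7 exprSr -mulrA zz mulr1.
Qed.

Lemma root7_pow z k : root7 z -> (0 < k < 7)%N -> root7 (z ^+ k).
Proof.
case=> z7 z1 /andP[k0 k7]; split; first by rewrite exprAC z7 expr1n.
apply/eqP => zk; move/eqP: z1; apply.
have k7' : coprime 7 k by rewrite prime_coprime // gtnNdvd.
case: (egcdnP k (isT : (0 < 7)%N)) => a b E _.
rewrite (eqP k7') in E.
by rewrite -[LHS]expr1 -[LHS]mul1r -{1}(expr1n _ b) -zk -exprM [(k * b)%N]mulnC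
  -exprD -E mulnC exprM z7 expr1n.
Qed.

Definition xr z : R := 2 * re z.

Lemma root7_xr z : root7 z -> z + z ^+ 6 = ofR (xr z).
Proof.
by move=> z7; rewrite -root7_conj_id //; apply: CP; rewrite /xr !riE; ring.
Qed.

Lemma evk_ofR x k : evk (ofR x) k = ofR (evk x k).
Proof. by case: k => a b c /=; rewrite !ofRE. Qed.

Lemma root7_phi z : root7 z -> 1 + z + z ^+ 2 + z ^+ 3 + z ^+ 4 + z ^+ 5 + z ^+ 6 = 0.
Proof. by case=> z7 z1; exact: root7_cyclotomic. Qed.

Lemma cubic_ofR x : cubic (ofR x) -> cubic x.
Proof. by move=> Hx; apply: ofR_inj; rewrite !ofRE. Qed.

Lemma xr_cubic z : root7 z -> cubic (xr z).
Proof.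
move=> z7; apply: cubic_ofR; rewrite -root7_xr //.
exact: cubic_root z7.1 (root7_phi z7).
Qed.

Lemma conj_zr n : (zr n : C R)^* = zr n.
Proof. by rewrite -ofR_zr; apply: CP; rewrite !riE ?oppr0. Qed.

Lemma ev_conj z a : root7 z -> (ev z a)^* = ev (z ^+ 6) a.
Proof.
move=> z7; rewrite -root7_conj_id //; case: a => * /=.
by rewrite !(rmorphD, rmorphM, rmorphXn) /= !conj_zr.
Qed.

Lemma ev_nsq z a : root7 z -> nsq (ev z a) = evk (xr z) (cnorm a).
Proof.
move=> z7; apply: ofR_inj; rewrite -mul_conj ev_conj //.
by rewrite -ev_bar6 ?z7.1 // -evM ?z7.1 // cnormE ?z7.1 ?root7_phi //
  root7_xr // evk_ofR.
Qed.

Lemma ev_cdot z a b : root7 z ->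
  2 * re (ev z a * (ev z b)^*) = evk (xr z) (cdot a b).
Proof.
move=> z7; apply: ofR_inj; rewrite -evk_ofR -root7_xr //.
rewrite -cdotE ?z7.1 ?root7_phi // evD !evM ?z7.1 // !ev_bar6 ?z7.1 //.
by rewrite -!ev_conj //; apply: CP; rewrite !riE; ring.
Qed.

Lemma ev_cross z a b : root7 z ->
  im ((ev z a)^* * ev z b) = im z * evk (xr z) (cross a b).
Proof.
move=> z7; have := crossE z7.1 a b.
rewrite root7_xr // evk_ofR -root7_conj_id // !evM ?z7.1 // !ev_bar6 ?z7.1 //.
rewrite -!ev_conj // => /(congr1 im); rewrite !riE => E.
by apply: (mulfI (_ : 2 != 0 :> R)); rewrite ?pnatr_eq0 //; lra.
Qed.

Lemma xr_pow2 z : root7 z -> xr (z ^+ 2) = xr z ^+ 2 - 2.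
Proof.
move=> z7; apply: ofR_inj; rewrite -root7_xr; last exact: root7_pow.
move: (xr z) (root7_xr z7) => x E; rewrite !ofRE -E.
have -> : (z + z ^+ 6) ^+ 2 = z ^+ 2 + 2 * z ^+ 7 + z ^+ 7 * z ^+ 5 by ring.
have -> : (z ^+ 2) ^+ 6 = z ^+ 7 * z ^+ 5 by ring.
by rewrite z7.1; ring.
Qed.

End Complex.

(** * The constants zeta, beta and omega, and Moebius maps of the disk *)

Section Zeta.
Variable R : realType.
Implicit Types (z w p q : C R) (x y : R).

Definition zeta : C R := Complex (cos (2 * pi / 7)) (sin (2 * pi / 7)).

Lemma expi_exp x n :
  (Complex (cos x) (sin x) : C R) ^+ n = Complex (cos (n%:R * x)) (sin (n%:R * x)).
Proof.
elim: n => [|n IH]; first by rewrite expr0 mul0r cos0 sin0.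
rewrite exprS IH -natr1 mulrDl mul1r cosD sinD.
by apply: CP; rewrite !riE /=; ring.
Qed.

Lemma sin_zeta_gt0 : 0 < im zeta.
Proof.
have := pi_gt0 R => pi0; rewrite /im /=; apply: sin_gt0_pi.
by apply/andP; split; lra.
Qed.

Lemma zeta_root7 : root7 zeta.
Proof.
split; last by apply/eqP => E; have := sin_zeta_gt0; rewrite E ltxx.
rewrite expi_exp; have -> : 7%:R * (2 * pi / 7) = pi *+ 2 :> R by field.
by rewrite cos2pi sin2pi.
Qed.

Definition c1 : R := xr zeta.

Lemma c1_gt0 : 0 < c1.
Proof.
have := pi_gt0 R => pi0; rewrite /c1 /xr mulr_gt0 //; apply: cos_gt0_pihalf.
by apply/andP; split; lra.
Qed.

Lemma c1_cubic : cubic c1. Proof. exact: xr_cubic zeta_root7. Qed.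

Lemma c1_bounds : 5 / 4 - 1 / 50 < c1 < 5 / 4.
Proof.
have := c1_cubic; have := c1_gt0; rewrite /cubic => c0 H.
by apply/andP; split; rewrite ltNge; apply/negP => h; nra.
Qed.

Definition beta : R := c1 - 1.
Lemma beta_bounds : 0 < beta < 1.
Proof. by have /andP[h1 h2] := c1_bounds; apply/andP; split; rewrite /beta; lra. Qed.
Lemma beta_gt0 : 0 < beta. Proof. by case/andP: beta_bounds. Qed.
Definition sbeta : R := Num.sqrt beta.
Lemma sbeta_gt0 : 0 < sbeta. Proof. by rewrite sqrtr_gt0 beta_gt0. Qed.
Lemma sbeta2 : sbeta ^+ 2 = beta. Proof. by rewrite sqr_sqrtr ?ltW ?beta_gt0. Qed.
Lemma beta_cubic : beta ^+ 3 + 4 * beta ^+ 2 + 3 * beta = 1.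
Proof. by have := c1_cubic; rewrite /cubic /beta => H; lra. Qed.
Definition omega : C R := Complex 0 sbeta.

Lemma omega_conj : omega^* = - omega.
Proof. by apply: CP; rewrite !riE /= ?oppr0. Qed.
Lemma omega_sq : omega ^+ 2 = - ofR beta.
Proof. by rewrite expr2 -sbeta2; apply: CP; rewrite !riE /=; ring. Qed.
Lemma nsq_omega : nsq omega = beta.
Proof. by rewrite /nsq /= expr0n add0r sbeta2. Qed.
Lemma omega_neq0 : omega != 0.
Proof. by rewrite -nsq_eq0 nsq_omega gt_eqF ?beta_gt0. Qed.

Definition mob p q z : C R := (p * z + q^*) / (q * z + p^*).

Lemma mob_den p q z : nsq q < nsq p -> nsq z < 1 -> q * z + p^* != 0.
Proof.
move=> qp z1; apply/eqP => /(canRL (addrK _)); rewrite add0r => E.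
have : nsq (q * z) = nsq p by rewrite E nsqN nsq_conj.
rewrite nsqM => E'; have := nsq_ge0 q; have := nsq_ge0 z; nra.
Qed.

(** This links isometric circles to distances from 0: for determinant 1, a point is moved away from
    0 exactly when |q z + p^*| > 1. *)
Lemma mob_nsq p q z : nsq q < nsq p -> nsq z < 1 ->
  nsq (q * z + p^*) * (1 - nsq (mob p q z)) = (nsq p - nsq q) * (1 - nsq z).
Proof.
move=> qp z1; have d0 := mob_den qp z1.
rewrite /mob nsqM nsqV mulrBr mulr1 mulrCA divff ?nsq_eq0 // mulr1.
rewrite /nsq !riE; ring.
Qed.

Lemma mob_disk p q z : nsq q < nsq p -> nsq z < 1 -> nsq (mob p q z) < 1.
Proof.
move=> qp z1; have d0 := mob_den qp z1.
have : 0 < nsq (q * z + p^*) by rewrite lt_def nsq_eq0 d0 nsq_ge0.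
by have := mob_nsq qp z1; nra.
Qed.

Definition pmul p1 q1 p2 q2 := p1 * p2 + q1^* * q2.
Definition qmulc p1 q1 p2 q2 := q1 * p2 + p1^* * q2.

Lemma mob_cocycle p1 q1 p2 q2 z : nsq q2 < nsq p2 -> nsq z < 1 ->
  (q1 * mob p2 q2 z + p1^*) * (q2 * z + p2^*) =
  qmulc p1 q1 p2 q2 * z + (pmul p1 q1 p2 q2)^*.
Proof.
move=> qp z1; have d0 := mob_den qp z1.
rewrite /mob /qmulc /pmul !(rmorphD, rmorphM) /= conjCK; by field.
Qed.

Lemma mob_comp p1 q1 p2 q2 z : nsq q2 < nsq p2 -> nsq q1 < nsq p1 -> nsq z < 1 ->
  mob p1 q1 (mob p2 q2 z) = mob (pmul p1 q1 p2 q2) (qmulc p1 q1 p2 q2) z.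
Proof.
move=> qp2 qp1 z1; have d0 := mob_den qp2 z1.
have EN : (p1 * mob p2 q2 z + q1^*) * (q2 * z + p2^*) =
    pmul p1 q1 p2 q2 * z + (qmulc p1 q1 p2 q2)^*.
  rewrite /mob /qmulc /pmul !(rmorphD, rmorphM) /= conjCK; by field.
by rewrite [RHS]/mob -mob_cocycle // -EN -mulf_div divff // mulr1.
Qed.

Lemma nsq_pmul p1 q1 p2 q2 :
  nsq (pmul p1 q1 p2 q2) - nsq (qmulc p1 q1 p2 q2) = (nsq p1 - nsq q1) * (nsq p2 - nsq q2).
Proof. rewrite /pmul /qmulc /nsq !riE; ring. Qed.

Lemma mob_refl p q z : - (mob p q z)^* = mob p^* (- q^*) (- z^*).
Proof.
rewrite /mob !(rmorphN, rmorphM, rmorphD, fmorphV) /= !conjCK.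
rewrite -mulNr; congr (_ / _); ring.
Qed.

(** The scalar is real because p and p^* must be multiplied by the same factor. *)
Lemma mob_real_scale (t : R) p q z : t != 0 -> mob (ofR t * p) (ofR t * q) z = mob p q z.
Proof.
move=> t0; have tC : (ofR t)^* = ofR t by apply: CP; rewrite !riE ?oppr0.
rewrite /mob !rmorphM /= tC -!mulrA -!mulrDr invfM mulrACA divff ?mul1r //.
by apply/eqP => /ofR_inj/eqP; apply/negP.
Qed.

End Zeta.

(** * The action of the generators *)

Section Generators.
Variable R : realType.
Implicit Types (z w p q : C R) (x y : R).
Let zeta := zeta R.
Let omega := omega R.
Let beta := beta R.

Let z7 : zeta ^+ 7 = 1. Proof. exact: (zeta_root7 R).1. Qed.
Let zc : zeta^* = zeta ^+ 6. Proof. exact: root7_conj_id (zeta_root7 R). Qed.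

Definition eta : C R := Complex (cos (5 * pi / 14)) (sin (5 * pi / 14)).

Let etaE : 5 * pi / 14 = pi / 2 - pi / 7 :> R. Proof. by field. Qed.

Lemma cos_eta_gt0 : 0 < cos (5 * pi / 14 : R).
Proof.
have := pi_gt0 R => pi0; apply: cos_gt0_pihalf.
by apply/andP; split; lra.
Qed.

Lemma sin_eta_gt0 : 0 < sin (5 * pi / 14 : R).
Proof. by have := pi_gt0 R => pi0; apply: sin_gt0_pi; apply/andP; split; lra. Qed.

Lemma sin_eta_sq : 4 * sin (5 * pi / 14 : R) ^+ 2 = 2 + c1 R.
Proof.
have -> : sin (5 * pi / 14 : R) = cos (pi / 7).
  by rewrite etaE sinB sin_pihalf cos_pihalf; ring.
rewrite /c1 /xr /re /=.
have -> : 2 * pi / 7 = pi / 7 + pi / 7 :> R by field.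
rewrite cosD; have := cos2Dsin2 (pi / 7 : R); rewrite !expr2 => H; nra.
Qed.

Lemma eta_sq : eta ^+ 2 = - zeta ^+ 6.
Proof.
rewrite expi_exp -zc.
have -> : 2%:R * (5 * pi / 14) = pi - 2 * pi / 7 :> R by field.
rewrite cosB sinB cospi sinpi.
by apply: CP; rewrite !riE /=; ring.
Qed.

Lemma zeta3_eta : zeta ^+ 3 = Complex 0 1 * eta.
Proof.
rewrite expi_exp.
have -> : 3%:R * (2 * pi / 7) = pi / 2 + 5 * pi / 14 :> R by field.
rewrite cosD sinD cos_pihalf sin_pihalf.
by apply: CP; rewrite !riE /=; ring.
Qed.

Lemma nsq_eta : nsq eta = 1.
Proof. by rewrite /nsq /= cos2Dsin2. Qed.

(** The centre of the Euclidean circle that carries the geodesic through [P1] and [P2]; it lies on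
    the ray from 0 through [P1] because the angle at [P1] is right. *)
Definition centre : C R := eta / ofR (sbeta R).

Lemma centre_zeta : centre = zeta ^+ 3 / omega.
Proof.
have s0 := sbeta_gt0 R.
have -> : omega = Complex 0 1 * ofR (sbeta R) by apply: CP; rewrite !riE /=; ring.
rewrite zeta3_eta invfM mulrACA divff ?mul1r //.
by apply/eqP => /(congr1 (@im R)) /= /eqP; rewrite oner_eq0.
Qed.

Lemma r0P : 0 < r0 R < 1 /\ (1 + r0 R ^+ 2) * sbeta R = 2 * r0 R.
Proof.
have ex : exists x, 0 < x < 1 /\ 1 - 6 * x ^+ 2 - 97 * x ^+ 4 - 244 * x ^+ 6 - 97 * x ^+ 8
    - 6 * x ^+ 10 + x ^+ 12 = 0 :> R.
  pose P : {poly R} := - (1 - 6 *: 'X^2 - 97 *: 'X^4 - 244 *: 'X^6 - 97 *: 'X^8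
    - 6 *: 'X^10 + 'X^12).
  have PE x : P.[x] = - (1 - 6 * x ^+ 2 - 97 * x ^+ 4 - 244 * x ^+ 6 - 97 * x ^+ 8
    - 6 * x ^+ 10 + x ^+ 12) by rewrite !hornerE.
  have [||x /andP[x0 x1] /eqP] := @poly_ivt R P 0 1; first by rewrite ler01.
    by rewrite !PE !expr0n !expr1n /=; apply/andP; split; lra.
  rewrite PE => /eqP; rewrite oppr_eq0 => /eqP Hx; exists x; split => //.
  rewrite !lt_neqAle x0 x1 !andbT eq_sym; apply/andP; split; apply/eqP => E.
    by move: Hx; rewrite E !expr0n /= => Hx; lra.
  by move: Hx; rewrite E !expr1n => Hx; lra.
have [/andP[x0 x1] Hx] := xgetPex 0 ex; rewrite -/(r0 R) in x0 x1 Hx.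
split; first by rewrite x0.
move: (r0 R) x0 x1 Hx => x x0 x1 Hx.
have b0 := beta_gt0 R; have s0 := sbeta_gt0 R.
set t := x ^+ 2; have t0 : 0 < t by rewrite exprn_gt0.
(* The polynomial defining [r0] is (1 + t)^6 (1 - 3 b - 4 b^2 - b^3), so b is a positive root of the
   cubic of [beta_cubic], which has only one. *)
pose b := 4 * t / (1 + t) ^+ 2.
have bp : 0 < b by rewrite divr_gt0 ?mulr_gt0 ?exprn_gt0 // addr_gt0.
have bc : b ^+ 3 + 4 * b ^+ 2 + 3 * b = 1.
  have t1 : 1 + t != 0 by rewrite lt0r_neq0 // addr_gt0.
  apply: (mulIf (expf_neq0 6 t1)); apply/eqP; rewrite -subr_eq0 -oppr0 -Hx; apply/eqP.
  by rewrite /b /t; field.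
have bE : b = beta.
  have E : (b - beta) * (b ^+ 2 + b * beta + beta ^+ 2 + 4 * (b + beta) + 3) = 0.
    transitivity ((b ^+ 3 + 4 * b ^+ 2 + 3 * b)
      - (beta ^+ 3 + 4 * beta ^+ 2 + 3 * beta)); first by ring.
    by rewrite bc [X in _ - X]beta_cubic subrr.
  move/eqP: E; rewrite mulf_eq0 => /orP[|/eqP E]; first by rewrite subr_eq0 => /eqP.
  have := mulr_gt0 bp b0; have := sqr_ge0 b; have := sqr_ge0 beta.
  by rewrite -/beta in b0 *; lra.
have : ((1 + t) * sbeta R) ^+ 2 = (2 * x) ^+ 2.
  rewrite exprMn sbeta2 -/beta -bE /b /t; field.
  by rewrite lt0r_neq0 // addr_gt0.
move/eqP; rewrite eqrXn2 => [/eqP -> //|//||]; first by rewrite mulr_ge0 ?ltW ?addr_gt0.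
by rewrite mulr_ge0 ?ltW.
Qed.

Lemma y0P : 0 < y0 R < 1 /\
  (1 + y0 R ^+ 2) * sbeta R = 2 * y0 R * sin (5 * pi / 14).
Proof.
have ex : exists x, 0 < x < 1 /\ 1 - 6 * x ^+ 2 - 48 * x ^+ 4 - 83 * x ^+ 6 - 48 * x ^+ 8
    - 6 * x ^+ 10 + x ^+ 12 = 0 :> R.
  pose P : {poly R} := - (1 - 6 *: 'X^2 - 48 *: 'X^4 - 83 *: 'X^6 - 48 *: 'X^8
    - 6 *: 'X^10 + 'X^12).
  have PE x : P.[x] = - (1 - 6 * x ^+ 2 - 48 * x ^+ 4 - 83 * x ^+ 6 - 48 * x ^+ 8
    - 6 * x ^+ 10 + x ^+ 12) by rewrite !hornerE.
  have [||x /andP[x0 x1] /eqP] := @poly_ivt R P 0 1; first by rewrite ler01.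
    by rewrite !PE !expr0n !expr1n /=; apply/andP; split; lra.
  rewrite PE => /eqP; rewrite oppr_eq0 => /eqP Hx; exists x; split => //.
  rewrite !lt_neqAle x0 x1 !andbT eq_sym; apply/andP; split; apply/eqP => E.
    by move: Hx; rewrite E !expr0n /= => Hx; lra.
  by move: Hx; rewrite E !expr1n => Hx; lra.
have [/andP[x0 x1] Hx] := xgetPex 0 ex; rewrite -/(y0 R) in x0 x1 Hx.
split; first by rewrite x0.
move: (y0 R) x0 x1 Hx => x x0 x1 Hx.
have b0 := beta_gt0 R; have s0 := sbeta_gt0 R.
set t := x ^+ 2; have t0 : 0 < t by rewrite exprn_gt0.
have t1 : 0 < 1 + t + t ^+ 2 by rewrite !addr_gt0 // exprn_gt0.
(* Likewise, the polynomial defining [y0] is (1 + t + t^2)^3 (1 - 3 b - 4 b^2 - b^3). *)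
pose b := 3 * t / (1 + t + t ^+ 2).
have bp : 0 < b by rewrite divr_gt0 ?mulr_gt0.
have bc : b ^+ 3 + 4 * b ^+ 2 + 3 * b = 1.
  have t1' := lt0r_neq0 t1.
  apply: (mulIf (expf_neq0 3 t1')); apply/eqP; rewrite -subr_eq0 -oppr0 -Hx; apply/eqP.
  by rewrite /b /t; field.
have bE : b = beta.
  have E : (b - beta) * (b ^+ 2 + b * beta + beta ^+ 2 + 4 * (b + beta) + 3) = 0.
    transitivity ((b ^+ 3 + 4 * b ^+ 2 + 3 * b)
      - (beta ^+ 3 + 4 * beta ^+ 2 + 3 * beta)); first by ring.
    by rewrite bc [X in _ - X]beta_cubic subrr.
  move/eqP: E; rewrite mulf_eq0 => /orP[|/eqP E]; first by rewrite subr_eq0 => /eqP.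
  have := mulr_gt0 bp b0; have := sqr_ge0 b; have := sqr_ge0 beta.
  by rewrite -/beta in b0 *; lra.
have bt : beta * (1 + t + t ^+ 2) = 3 * t by rewrite -bE /b mulfVK ?lt0r_neq0.
have sn := sin_eta_sq.
have : ((1 + t) * sbeta R) ^+ 2 = (2 * x * sin (5 * pi / 14)) ^+ 2.
  rewrite exprMn sbeta2 -/beta !exprMn -/t.
  have -> : 2 ^+ 2 * t * sin (5 * pi / 14) ^+ 2 = t * (3 + beta).
    have -> : beta = c1 R - 1 by []; rewrite mulrAC -natrX sn; ring.
  by transitivity (beta * (1 + t + t ^+ 2) + beta * t); [ring|rewrite bt; ring].
have sp := sin_eta_gt0.
move/eqP; rewrite eqrXn2 => [/eqP -> //|//||]; first by rewrite mulr_ge0 ?ltW ?addr_gt0.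
by rewrite !mulr_ge0 ?ltW.
Qed.

(* The first two hypotheses put a and b on the circle with centre c that is   *)
(* orthogonal to the unit circle; A, B, D, w are the conjugates of a, b, c, z. *)
Lemma reflection_inversion (F : fieldType) (a A b B c D w : F) :
  1 + a * A = D * a + c * A -> 1 + b * B = D * b + c * B ->
  1 - a * w != 0 -> 1 - A * b != 0 -> 1 - a * B != 0 -> B - A != 0 ->
  A - D != 0 -> 1 - a * A != 0 -> w - D != 0 ->
  let k := (b - a) / (1 - A * b) / ((B - A) / (1 - a * B)) in
  let T := k * ((w - A) / (1 - a * w)) in
  (T + a) / (1 + A * T) = (c * w - 1) / (w - D).
Proof.
move=> /eqP; rewrite -subr_eq0 => /eqP Ea /eqP; rewrite -subr_eq0 => /eqP Eb.
move=> aw Ab aB BA AD aA wD k T.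
(* The geodesic is orthogonal to the radius a - c at a, so its direction there, and with it k,
   depends on a and c alone. *)
have kE : k = - (a - c) / (A - D).
  rewrite /k; have E : (b - a) * (1 - a * B) * (A - D) + (B - A) * (1 - A * b) * (a - c) = 0.
    transitivity ((a * B + A * b - (1 + b * B)) * (1 + a * A - (D * a + c * A))
      + (1 - a * A) * (1 + b * B - (D * b + c * B))); first by ring.
    by rewrite Ea Eb !mulr0 addr0.
  have -> : (b - a) / (1 - A * b) / ((B - A) / (1 - a * B)) =
     ((b - a) * (1 - a * B) * (A - D)) / ((1 - A * b) * (B - A) * (A - D)).
    by field; rewrite AD BA Ab aB.
  move/eqP: E; rewrite addr_eq0 => /eqP ->.
  by field; rewrite AD BA Ab.
have TE : T = - (a - c) * (w - A) / ((A - D) * (1 - a * w)).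
  by rewrite /T kE; field; rewrite AD aw.
have N : - (a - c) * (w - A) + a * ((A - D) * (1 - a * w)) = (c * w - 1) * (1 - a * A).
  rewrite -[RHS]addr0 -(mulr0 (1 - a * w)) -Ea; ring.
have M : (A - D) * (1 - a * w) + A * (- (a - c) * (w - A)) = (w - D) * (1 - a * A).
  rewrite -[RHS]addr0 -(mulr0 (A - w)) -Ea; ring.
have ADw : (A - D) * (1 - a * w) != 0 by rewrite mulf_neq0.
have -> : T + a = (c * w - 1) * (1 - a * A) / ((A - D) * (1 - a * w)).
  by rewrite -N TE; field; rewrite AD aw.
have -> : 1 + A * T = (w - D) * (1 - a * A) / ((A - D) * (1 - a * w)).
  by rewrite -M TE; field; rewrite AD aw.
by field; rewrite AD aw aA wD.
Qed.

End Generators.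

Section GeneratorAct.
Variable R : realType.
Implicit Types (z w p q : C R) (x y : R).
Let zeta := zeta R.
Let omega := omega R.
Let beta := beta R.
Let eta := eta R.

Let z7 : zeta ^+ 7 = 1. Proof. exact: (zeta_root7 R).1. Qed.
Let zc : zeta^* = zeta ^+ 6. Proof. exact: root7_conj_id (zeta_root7 R). Qed.

Lemma P1E : P1 R = ofR (r0 R) * eta.
Proof. by apply: CP; rewrite !riE /=; ring. Qed.
Lemma P2E : P2 R = Complex 0 1 * ofR (y0 R).
Proof. by apply: CP; rewrite !riE /=; ring. Qed.

Lemma reflection0 p z : p != 0 -> reflection (P0 R) p z = p ^+ 2 / ofR (nsq p) * z^*.
Proof.
move=> p0; rewrite /reflection /disk_shift /P0 oppr0 conjC0 !mul0r !subr0 !divr1.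
rewrite -mul_conj; field; by rewrite conjC_eq0 p0.
Qed.

Lemma nsq_P1 : nsq (P1 R) = r0 R ^+ 2.
Proof. by rewrite P1E nsqM nsqR nsq_eta mulr1. Qed.
Lemma nsq_P2 : nsq (P2 R) = y0 R ^+ 2.
Proof. by rewrite /nsq /= expr0n add0r. Qed.

Lemma reflection01 z : reflection (P0 R) (P1 R) z = mob (zeta ^+ 3) 0 (- z^*).
Proof.
have [/andP[r0p _] _] := r0P R.
have P10 : P1 R != 0 by rewrite -nsq_eq0 nsq_P1 expf_neq0 ?gt_eqF.
have rC : ofR (r0 R) != 0 by apply/eqP => /ofR_inj/eqP; rewrite gt_eqF.
have z0 : zeta != 0.
  by apply/eqP => E; move/eqP: z7; rewrite E expr0n eq_sym oner_eq0.
rewrite reflection0 // nsq_P1 P1E exprMn eta_sq -/zeta /mob conjC0 mul0r addr0 add0r.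
have -> : (zeta ^+ 3)^* = zeta ^+ 4.
  by rewrite rmorphXn /= zc -exprM -[(6 * 3)%N]/(7 + 7 + 4)%N !exprD z7 !mul1r.
rewrite ofRX.
have -> : zeta ^+ 6 = zeta^-1 by apply: (mulfI z0); rewrite divff // -exprS.
by field; rewrite z0 rC.
Qed.

Lemma reflection02 z : reflection (P0 R) (P2 R) z = mob 1 0 (- z^*).
Proof.
have [/andP[y0p _] _] := y0P R.
have P20 : P2 R != 0 by rewrite -nsq_eq0 nsq_P2 expf_neq0 ?gt_eqF.
have yC : ofR (y0 R) != 0 by apply/eqP => /ofR_inj/eqP; rewrite gt_eqF.
rewrite reflection0 // nsq_P2 P2E exprMn /mob conjC0 conjC1 mul0r addr0 add0r ofRX.
have -> : (Complex 0 1 : C R) ^+ 2 = -1 by rewrite expr2; apply: CP; rewrite !riE /=; ring.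
by field.
Qed.

Definition th : C R := 1 - zeta.
Lemma th_conj : th = - zeta * th^*.
Proof.
rewrite /th rmorphB rmorph1 /= zc mulrBr mulr1 mulNr -exprS z7; ring.
Qed.
Lemma th_neq0 : th != 0.
Proof. by rewrite subr_eq0 eq_sym (zeta_root7 R).2. Qed.

Lemma nsq_centre : beta * nsq (centre R) = 1.
Proof.
rewrite /centre nsqM nsqV nsqR nsq_eta sbeta2 mul1r divff // gt_eqF //.
exact: beta_gt0.
Qed.

Lemma re1 : re (1 : C R) = 1. Proof. by []. Qed.
Lemma im1 : im (1 : C R) = 0. Proof. by []. Qed.
Lemma conjR x : (ofR x)^* = ofR x.
Proof. by apply: CP; rewrite !riE ?oppr0. Qed.
Lemma ofRV x : ofR x^-1 = (ofR x)^-1.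
Proof. exact: (fmorphV (real_complex R)). Qed.

Lemma sub1_neq0 z : nsq z < 1 -> 1 - z != 0.
Proof.
move=> z1; rewrite subr_eq0; apply/eqP => E; move: z1.
by rewrite -E -ofR1 nsqR expr1n ltxx.
Qed.

Lemma sub_neq0 z w : nsq z < nsq w -> z - w != 0.
Proof. by move=> zw; rewrite subr_eq0; apply/eqP => E; rewrite E ltxx in zw. Qed.

Lemma reflection12 z : nsq z < 1 -> reflection (P1 R) (P2 R) z =
  mob th^* (omega * zeta ^+ 4 * th^*) (- z^*).
Proof.
move=> z1.
have [/andP[r0p r01] rE] := r0P R; have [/andP[y0p y01] yE] := y0P R.
have cE := nsq_centre; have cz := centre_zeta R; have /andP[b0 b1] := beta_bounds R.
have s0 := sbeta_gt0 R.
have sV : sbeta R * (sbeta R)^-1 = 1 by rewrite divff ?gt_eqF.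
have P1n : nsq (P1 R) < 1 by rewrite nsq_P1; nra.
have P2n : nsq (P2 R) < 1 by rewrite nsq_P2; nra.
have centreE : centre R = ofR (sbeta R)^-1 * eta by rewrite ofRV mulrC.
have c1 : 1 < nsq (centre R) by rewrite -/beta in b0 b1; nra.
have ee : eta * eta^* = 1 by rewrite mul_conj nsq_eta ofR1.
have H1 : 1 + P1 R * (P1 R)^* = (centre R)^* * P1 R + centre R * (P1 R)^*.
  rewrite P1E centreE !rmorphM /= !conjR.
  transitivity (1 + ofR (r0 R) ^+ 2 * (eta * eta^*)); first by ring.
  transitivity (2 * ofR (r0 R) * ofR (sbeta R)^-1 * (eta * eta^*)); last by ring.
  rewrite ee !mulr1 -(ofR_nat R 2) -(ofR1 R) -ofRX -!ofRM -ofRD; congr ofR.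
  by rewrite -[LHS]mulr1 -[X in _ * X = _]sV mulrA rE.
have H2 : 1 + P2 R * (P2 R)^* = (centre R)^* * P2 R + centre R * (P2 R)^*.
  rewrite P2E centreE; apply: CP; rewrite !(riE, re1, im1) /=; last by ring.
  transitivity (1 + y0 R ^+ 2); first by ring.
  by rewrite -[LHS]mulr1 -[X in _ * X = _]sV mulrA yE; ring.
have n z' w' : nsq z' < 1 -> nsq w' < 1 -> nsq (z' * w') < 1.
  by move=> ? ?; rewrite nsqM; have := nsq_ge0 z'; have := nsq_ge0 w'; nra.
transitivity ((centre R * z^* - 1) / (z^* - (centre R)^*)).
  rewrite /reflection /disk_shift opprK !rmorphN /= mulNr opprK.
  rewrite !(fmorph_div, rmorphB, rmorphM, rmorph1) /= conjCK.
  rewrite (reflection_inversion H1 H2) ?sub1_neq0 ?n ?nsq_conj //.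
  - by rewrite [in LHS]/centre fmorph_div.
  - rewrite subr_eq0; apply/eqP => /(congr1 (@re R)) /eqP.
    rewrite !re_conj /re /= eq_sym mulf_eq0 gt_eqF //= gt_eqF //.
    exact: cos_eta_gt0.
  - by rewrite sub_neq0 ?nsq_conj // (lt_trans P1n).
  - by rewrite sub_neq0 ?nsq_conj // (lt_trans z1).
have [z0 t0 o0] : [/\ zeta != 0, th^* != 0 & omega != 0].
  rewrite conjC_eq0 th_neq0 omega_neq0; split => //.
  by apply/eqP => E; move/eqP: z7; rewrite E expr0n eq_sym oner_eq0.
have z4c : (zeta ^+ 4)^* = zeta ^+ 3.
  by rewrite rmorphXn /= zc -exprM -[(6 * 4)%N]/(7 + 7 + 7 + 3)%N !exprD z7 !mul1r.
have z3c : (zeta ^+ 3)^* = zeta ^+ 4 by rewrite -z4c conjCK.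
have oc : omega^* = - omega := omega_conj R.
have q_conj : (omega * zeta ^+ 4 * th^*)^* = omega * zeta ^+ 4 * th^*.
  rewrite 2!rmorphM /= z4c oc conjCK {1}th_conj; ring.
have cc : (centre R)^* = - (zeta ^+ 4 / omega).
  rewrite cz -/zeta -/omega rmorphM fmorphV /=. by rewrite z3c oc invrN mulrN.
have wD : z^* - (centre R)^* != 0 by rewrite sub_neq0 ?nsq_conj // (lt_trans z1).
rewrite cc opprK in wD.
have wD' : omega * z^* + zeta ^+ 4 != 0.
  by apply: contraNneq wD => E; apply/eqP/(mulfI o0); rewrite mulr0 -E; field.
rewrite /mob q_conj conjCK cc cz -/zeta -/omega.
have tE := th_conj; move: (th^*) t0 tE => t t0 ->.
have -> : omega * zeta ^+ 4 * t * - z^* + - zeta * t =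
    - (t * zeta ^+ 4) * (omega * z^* + zeta ^+ 4).
  rewrite -[X in - X * t]mul1r -z7; ring.
have -> : t * - z^* + omega * zeta ^+ 4 * t =
    - (t * zeta ^+ 4) * (zeta ^+ 3 * z^* - omega).
  rewrite -[X in X * - z^*]mul1r -z7; ring.
by field; rewrite z0 t0 o0 wD'.
Qed.

End GeneratorAct.

Definition betac := Cyc (Zneg 1) (Zpos 1) Z0 Z0 Z0 Z0 (Zpos 1).
Definition zpow3 := crot (crot (crot (cint (Zpos 1)))).
Definition fgen (i : 'I_3) : cyc * cyc :=
  if i == i1 then (zpow3, cint Z0) else
  if i == i2 then (cint (Zpos 1), cint Z0) else
  (cbar theta, cmul (crot zpow3) (cbar theta)).
Definition fmul (m n : cyc * cyc) :=
  (cadd (cmul m.1 n.1) (cmul betac (cmul (cbar m.2) n.2)),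
   cadd (cmul m.2 n.1) (cmul (cbar m.1) n.2)).
Definition fbar (m : cyc * cyc) := (cbar m.1, cbar m.2).
(* Every generator is a Moebius map composed with [z |-> - z^*], and [fbar]   *)
(* moves this reflection through a matrix.                                    *)
Definition fword (w : word) :=
  foldr (fun i m => fmul (fgen i) (fbar m)) (cint (Zpos 1), cint Z0) w.

Section WordAct.
Variable R : realType.
Implicit Types (z p q : C R) (x y : R).
Let zeta := zeta R.
Let omega := omega R.
Let z7 : zeta ^+ 7 = 1. Proof. exact: (zeta_root7 R).1. Qed.
Let zr7 : root7 zeta. Proof. exact: zeta_root7. Qed.
Let zc : zeta^* = zeta ^+ 6. Proof. exact: root7_conj_id (zeta_root7 R). Qed.

Definition fp (m : cyc * cyc) : C R := ev zeta m.1.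
Definition fq (m : cyc * cyc) : C R := omega * ev zeta m.2.

Lemma ev_bar a : ev zeta (cbar a) = (ev zeta a)^*.
Proof. by rewrite ev_conj // ev_bar6. Qed.

Lemma ev_betac : ev zeta betac = - omega ^+ 2.
Proof.
have -> : betac = cadd (cint (Zneg 1)) (cadd (crot (cint (Zpos 1)))
   (cbar (crot (cint (Zpos 1))))) by [].
rewrite !evD ev_bar ev_rot // !ev_int zrm1 zr1 mulr1 zc root7_xr //.
by rewrite omega_sq opprK /beta /c1 ofRB ofR1 addrC.
Qed.

Lemma fp_mul m n : fp (fmul m n) = pmul (fp m) (fq m) (fp n) (fq n).
Proof.
rewrite /fp /fq /pmul /= evD !evM // ev_betac ev_bar rmorphM /= omega_conj -/omega; ring.
Qed.
Lemma fq_mul m n : fq (fmul m n) = qmulc (fp m) (fq m) (fp n) (fq n).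
Proof. by rewrite /fp /fq /qmulc /= evD !evM // ev_bar; ring. Qed.
Lemma fp_bar m : fp (fbar m) = (fp m)^*.
Proof. by rewrite /fp ev_bar. Qed.
Lemma fq_bar m : fq (fbar m) = - (fq m)^*.
Proof. by rewrite /fq ev_bar rmorphM /= omega_conj -/omega; ring. Qed.

Lemma ev_zpow3 : ev zeta zpow3 = zeta ^+ 3.
Proof. by rewrite /zpow3 !ev_rot // ev_int zr1; ring. Qed.

Lemma ev_theta : ev zeta theta = th R.
Proof.
by rewrite /= !zr0 zr1 zrm1 /th -/zeta; ring.
Qed.

Lemma generator_actE i z : nsq z < 1 ->
  generator_act i z = mob (fp (fgen i)) (fq (fgen i)) (- z^*).
Proof.
move=> z1; rewrite /generator_act /fgen /fp /fq.
case: ifP => _; first by rewrite reflection01 ev_zpow3 ev_int zr0 mulr0.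
case: ifP => _; first by rewrite reflection02 !ev_int zr0 mulr0 zr1.
rewrite reflection12 // -[(cbar theta, _).1]/(cbar theta).
rewrite -[(cbar theta, _).2]/(cmul (crot zpow3) (cbar theta)) evM // ev_bar
  ev_theta ev_rot // ev_zpow3.
by rewrite -exprS !mulrA.
Qed.

(** The matrices of [fgen] are not normalised; a positive determinant is enough to preserve the
    disk. *)
Definition hyp (m : cyc * cyc) := nsq (fq m) < nsq (fp m).

Lemma hyp_gen i : hyp (fgen i).
Proof.
have zn : nsq zeta = 1.
  by apply: ofR_inj; rewrite -mul_conj zc -exprS z7 ofR1.
have zXn n : nsq (zeta ^+ n) = 1.
  by elim: n => [|n IH]; rewrite ?expr0 ?exprS ?nsqM ?zn ?IH ?mulr1 // -ofR1 nsqR expr1n.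
rewrite /hyp /fgen /fp /fq.
case: ifP => _; first by rewrite ev_zpow3 ev_int zr0 mulr0 zXn -ofR0 nsqR expr0n.
case: ifP => _.
  by rewrite !ev_int zr0 mulr0 zr1 -ofR0 -ofR1 !nsqR expr0n expr1n.
rewrite -[(cbar theta, _).1]/(cbar theta).
rewrite -[(cbar theta, _).2]/(cmul (crot zpow3) (cbar theta)) evM //.
rewrite ev_bar ev_theta ev_rot // ev_zpow3 -exprS 2!nsqM zXn nsq_omega nsq_conj.
have /andP[b0 b1] := beta_bounds R.
have : 0 < nsq (th R) by rewrite lt_def nsq_ge0 nsq_eq0 th_neq0.
by nra.
Qed.

Lemma hyp_mul m n : hyp m -> hyp n -> hyp (fmul m n).
Proof.
rewrite /hyp -subr_gt0 => hm; rewrite -subr_gt0 => hn.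
by rewrite -subr_gt0 fp_mul fq_mul nsq_pmul mulr_gt0.
Qed.

Lemma hyp_bar m : hyp m -> hyp (fbar m).
Proof. by rewrite /hyp fp_bar fq_bar nsqN !nsq_conj. Qed.

Lemma hyp_word w : hyp (fword w).
Proof.
elim: w => [|i w IH] /=; last by rewrite hyp_mul ?hyp_gen ?hyp_bar.
by rewrite /hyp /fp /fq !ev_int zr0 mulr0 zr1 -ofR0 -ofR1 !nsqR expr0n expr1n.
Qed.

Definition flip z := - z^*.
Lemma nsq_flip z : nsq (flip z) = nsq z. Proof. by rewrite nsqN nsq_conj. Qed.
Lemma flipK : involutive flip. Proof. by move=> z; rewrite /flip rmorphN /= conjCK opprK. Qed.
Lemma nsq_iter_flip n z : nsq (iter n flip z) = nsq z.
Proof. by elim: n => //= n <-; rewrite nsq_flip. Qed.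

Lemma word_actE w z : nsq z < 1 -> nsq (word_act w z) < 1 /\
  word_act w z = mob (fp (fword w)) (fq (fword w)) (iter (size w) flip z).
Proof.
move=> z1; elim: w => [|i w [IH1 IH2]] /=.
  split => //; rewrite /mob /fp /fq !ev_int zr0 mulr0 zr1 rmorph0 rmorph1.
  by rewrite mul1r mul0r !addr0 add0r divr1.
have E : generator_act i (word_act w z) =
   mob (fp (fgen i)) (fq (fgen i)) (flip (word_act w z)) by rewrite generator_actE.
split; first by rewrite E mob_disk ?nsq_flip //; exact: hyp_gen.
rewrite E IH2 {1}/flip mob_refl -fp_bar -fq_bar mob_comp.
- by rewrite -fp_mul -fq_mul.
- exact: hyp_bar (hyp_word w).
- exact: hyp_gen.
by rewrite nsq_flip nsq_iter_flip.
Qed.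

Lemma word_act_cat u v z : word_act (u ++ v) z = word_act u (word_act v z) :> C R.
Proof. exact: foldr_cat. Qed.

(** With q = 0 and p real the Moebius map is the identity, and an even length cancels the
    reflections z |-> - z^*. *)
Definition trivial_word (r : word) := [&& ~~ odd (size r), ceq (fword r).2 (cint Z0)
  & ceq (fword r).1 (cbar (fword r).1)].

Lemma iter_flip_even n z : ~~ odd n -> iter n flip z = z.
Proof.
move=> ev; rewrite -(odd_double_half n) (negbTE ev) add0n.
by elim: (n./2) => // k IH; rewrite doubleS !iterS flipK.
Qed.

Lemma trivial_wordP r z : trivial_word r -> nsq z < 1 -> word_act r z = z.
Proof.
case/and3P => ev r2 r1 z1; have [_ ->] := word_actE r z1.
rewrite iter_flip_even //.
have p0 : fq (fword r) = 0.
  by rewrite /fq (ev_ceq (root7_phi zr7) r2) ev_int zr0 mulr0.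
have pc : (fp (fword r))^* = fp (fword r).
  by rewrite -ev_bar -(ev_ceq (root7_phi zr7) r1).
have := hyp_word r; rewrite /hyp p0 -(ofR0 R) nsqR expr0n lt_def nsq_eq0 => /andP[h _].
by rewrite ofR0 /mob rmorph0 mul0r addr0 add0r pc mulrAC divff // mul1r.
Qed.

Lemma relators_trivial : all trivial_word relators.
Proof. by vm_compute. Qed.

Lemma Delta_eq_act u v : Delta_eq u v -> forall z, nsq z < 1 -> word_act u z = word_act v z.
Proof.
elim=> [//|a b _ IH|a b c _ IH1 _ IH2|a r b rr] z z1; first by rewrite IH.
  by rewrite IH1 // IH2.
have [b1 _] := word_actE b z1.
by rewrite !word_act_cat (@trivial_wordP r) //; have /allP/(_ r rr) := relators_trivial.
Qed.

Lemma act_class w z : nsq z < 1 -> act (Delta_class w) z = word_act w z.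
Proof. by move=> z1; apply: Delta_eq_act => //; exact: Delta_classK. Qed.

Lemma act_disk g z : nsq z < 1 -> nsq (act g z) < 1.
Proof. by move=> z1; have [] := word_actE (Delta_word g) z1. Qed.

Lemma act_mul g h z : nsq z < 1 -> act (g * h)%g z = act g (act h z).
Proof.
move=> z1; rewrite -(Delta_wordK g) -(Delta_wordK h).
rewrite -[(_ * _)%g]/(Delta_mul _ _) -Delta_class_cat.
rewrite act_class // word_act_cat (act_class (Delta_word h)) //.
by rewrite act_class //; have [] := word_actE (Delta_word h) z1.
Qed.

Lemma act1 z : nsq z < 1 -> act (1%g : Delta) z = z.
Proof. by move=> z1; rewrite -[1%g]/(Delta_class [::]) act_class. Qed.

End WordAct.

(** * Matrices of the side pairings *)

Definition word_of (s : seq nat) : word := [seq nth i1 [:: i1; i2; i3] n.-1 | n <- s].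
Definition word1 := word_of [:: 2; 3; 2; 1; 2; 1; 3; 2; 1; 2; 1; 3; 2; 1; 2; 1;
  2; 3; 2; 1; 2; 1; 2; 1; 3; 2; 1; 2; 1; 3; 2; 1; 2; 1; 3; 2; 1; 2].
Definition word2 := word_of [:: 1; 2; 3; 2; 1; 2; 1; 2; 1; 3; 2; 1; 2; 1; 3; 2;
  1; 2; 1; 2; 3; 2; 1; 2; 1; 2; 1; 3; 2; 1; 2; 1; 3; 2; 1; 2].
Definition word3 := word_of [:: 1; 2; 1; 2; 1; 2; 3; 2; 1; 2; 1; 3; 2; 1; 2; 1;
  3; 2; 1; 2; 1; 2; 3; 2; 1; 2; 1; 2; 1; 3; 2; 1; 2; 1; 2; 3; 2; 1; 2; 1; 3; 2;
  1; 2].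
Definition word4 := word_of [:: 1; 2; 1; 2; 3; 2; 1; 2; 1; 2; 3; 2; 1; 2; 1; 2;
  1; 3; 2; 1; 2; 1; 3; 2; 1; 2; 1; 2; 3; 2; 1; 2; 1; 2; 3; 2; 1; 2; 1; 2].
Definition word5 := word_of [:: 1; 3; 2; 1; 2; 1; 3; 2; 1; 2; 1; 2; 3; 2; 1; 2;
  1; 2; 1; 3; 2; 1; 2; 1; 3; 2; 1; 2; 1; 2; 3; 2; 1; 2; 1; 2].
Definition word6 := word_of [:: 2; 3; 2; 1; 2; 1; 2; 3; 2; 1; 2; 1; 2; 1; 3; 2;
  1; 2; 1; 3; 2; 1; 2; 1; 2; 3; 2; 1; 2; 1; 2; 1; 3; 2; 1; 2; 1; 2].
Section Integers.
Local Open Scope Z_scope.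
Definition quat1 : quat := (Cyc 3 1 (-2) (-3) (-2) 1 3, Cyc (-5) (-6) (-3) 2 5 4 0).
Definition quat2 : quat := (Cyc (-2) (-2) 0 2 2 1 (-1), Cyc 1 3 2 (-1) (-3) (-3) (-1)).
Definition quat3 : quat := (Cyc 2 3 2 (-1) (-3) (-3) (-1), Cyc 0 (-1) (-2) (-1) 1 2 2).
Definition quat4 : quat := (Cyc (-2) (-2) 0 2 3 2 0, Cyc 1 3 2 0 (-2) (-2) (-1)).
Definition quat5 : quat := (Cyc (-2) (-1) 1 2 2 0 (-2), Cyc 2 3 1 (-2) (-4) (-3) 0).
Definition quat6 : quat := (Cyc (-2) 0 2 2 0 (-2) (-3), Cyc 4 4 1 (-3) (-4) (-2) 2).
End Integers.

Fixpoint qgamma (n : nat) : quat :=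
  match n with
  | 0 => qone
  | 1 => quat1
  | 2 => quat2
  | 3 => quat3
  | 4 => quat4
  | 5 => quat5
  | 6 => quat6
  | m.+4.+2 => qrot (qgamma m)
  end.

Definition thth := cmul theta (cbar theta).
Definition qword (m : quat) : cyc * cyc := let y := cscale (Zpos 2) (cmul m.1 (cbar theta)) in
  (cadd (cmul thth (cadd (cint (Zpos 1)) (cscale (Zpos 2) m.2))) y, y).
(** [qword m] is |1 - zeta|^2 (P, Q), and the unnormalised product of the letters is a further real
    multiple D = s |1 - zeta|^(2 k) of it, hence the same Moebius map. *)
Definition word_quat (w : word) (m : quat) (s : Z) (k : nat) :=
  let D := cscale s (iter k (cmul thth) (cint (Zpos 1))) in
  [&& ~~ odd (size w), ceq (fword w).1 (cmul D (qword m).1),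
      ceq (fword w).2 (cmul D (qword m).2) & ceq D (cbar D)].
Definition norm_one (m : quat) :=
  keq (ksub (cnorm (qnum m)) (kmul (Kub (Zneg 4) (Zpos 4) Z0) (cnorm m.1)))
    (Kub (Zpos 2) (Zneg 1) Z0).

Lemma word_quat1 : word_quat word1 quat1 (Zneg 1) 6 && norm_one quat1.
Proof. by vm_compute. Qed.
Lemma word_quat2 : word_quat word2 quat2 (Zpos 1) 5 && norm_one quat2.
Proof. by vm_compute. Qed.
Lemma word_quat3 : word_quat word3 quat3 (Zpos 1) 6 && norm_one quat3.
Proof. by vm_compute. Qed.
Lemma word_quat4 : word_quat word4 quat4 (Zneg 1) 5 && norm_one quat4.
Proof. by vm_compute. Qed.
Lemma word_quat5 : word_quat word5 quat5 (Zpos 1) 5 && norm_one quat5.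
Proof. by vm_compute. Qed.
Lemma word_quat6 : word_quat word6 quat6 (Zpos 1) 5 && norm_one quat6.
Proof. by vm_compute. Qed.

Lemma Delta_class_cons2 i j w :
  Delta_class [:: i, j & w] = (Delta_class [:: i] * Delta_class (j :: w))%g.
Proof. exact: (Delta_class_cat [:: i]). Qed.

Ltac gamma_word := rewrite /word_of [map _ _]/= !Delta_class_cons2 ?expgS ?expg0 ?mulg1 ?mulgA.

Lemma gamma1E : gamma1 = Delta_class word1.
Proof. by rewrite /gamma1 /word1 /s1 /s2 /s3; gamma_word. Qed.
Lemma gamma2E : gamma2 = Delta_class word2.
Proof. by rewrite /gamma2 /word2 /s1 /s2 /s3; gamma_word. Qed.
Lemma gamma3E : gamma3 = Delta_class word3.
Proof. by rewrite /gamma3 /word3 /s1 /s2 /s3; gamma_word. Qed.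
Lemma gamma4E : gamma4 = Delta_class word4.
Proof. by rewrite /gamma4 /word4 /s1 /s2 /s3; gamma_word. Qed.
Lemma gamma5E : gamma5 = Delta_class word5.
Proof. by rewrite /gamma5 /word5 /s1 /s2 /s3; gamma_word. Qed.
Lemma gamma6E : gamma6 = Delta_class word6.
Proof. by rewrite /gamma6 /word6 /s1 /s2 /s3; gamma_word. Qed.

Section Represents.
Variable R : realType.
Implicit Types (z p q : C R) (x y : R) (m n : quat).

Definition mP m : C R := qP (zeta R) m.
Definition mQ m : C R := omega R * qQ (zeta R) m.
Definition pqmx p q : 'M[C R]_2 := \matrix_(i, j)
  if i == 0 then if j == 0 then p else q^* else if j == 0 then q else p^*.
(** All primitive seventh roots are included, so the norm is 1 at the three real places together. *)
Definition unit_norm m := forall z, root7 z -> nrd z m = 1.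

Lemma qP_conj z m : root7 z -> (qP z m)^* = qP (z ^+ 6) m.
Proof.
move=> z7; rewrite /qP !(rmorphD, rmorphM, rmorphN, rmorph1, fmorphV, rmorph_nat) /=.
by rewrite !ev_conj // root7_conj_id.
Qed.
Lemma qQ_conj z m : root7 z -> (qQ z m)^* = qQ (z ^+ 6) m.
Proof.
move=> z7; rewrite /qQ !(rmorphD, rmorphM, rmorphN, rmorph1, fmorphV, rmorph_nat) /=.
by rewrite !ev_conj // root7_conj_id.
Qed.

Lemma nrd_nsq z m : root7 z ->
  nrd z m = ofR (nsq (qP z m) - (xr z - 1) * nsq (qQ z m)).
Proof.
move=> z7; rewrite /nrd -!qP_conj // -!qQ_conj // !mul_conj root7_xr //.
by rewrite -(ofR1 R) -!ofRB -!ofRM -ofRB.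
Qed.

Lemma unit_norm_nsq m z : unit_norm m -> root7 z ->
  nsq (qP z m) - (xr z - 1) * nsq (qQ z m) = 1.
Proof. by move=> mu z7; apply: ofR_inj; rewrite -nrd_nsq // mu. Qed.

Lemma nsq_mQ m : nsq (mQ m) = beta R * nsq (qQ (zeta R) m).
Proof. by rewrite /mQ nsqM nsq_omega. Qed.

Lemma mPQ_norm m : unit_norm m -> nsq (mP m) - nsq (mQ m) = 1.
Proof. by move=> mu; rewrite nsq_mQ; exact: unit_norm_nsq mu (zeta_root7 R). Qed.

Lemma mPQ_hyp m : unit_norm m -> nsq (mQ m) < nsq (mP m).
Proof. by move=> /mPQ_norm; lra. Qed.

Lemma mP_mul m n : mP (qmul m n) = pmul (mP m) (mQ m) (mP n) (mQ n).
Proof.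
have [z7 z1] := zeta_root7 R; rewrite /mP qP_mul // /pmul /mQ rmorphM /= omega_conj.
rewrite root7_xr // qQ_conj //; congr (_ + _).
have -> : ofR (xr (zeta R)) - 1 = - omega R ^+ 2.
  by rewrite omega_sq opprK /beta ofRB ofR1.
ring.
Qed.
Lemma mQ_mul m n : mQ (qmul m n) = qmulc (mP m) (mQ m) (mP n) (mQ n).
Proof.
have [z7 z1] := zeta_root7 R; rewrite /mQ qQ_mul // /qmulc /mP qP_conj //; ring.
Qed.

Lemma mP_inv m : mP (qinv m) = (mP m)^*.
Proof. by have [z7 z1] := zeta_root7 R; rewrite /mP qP_inv // qP_conj. Qed.
Lemma mQ_inv m : mQ (qinv m) = - mQ m.
Proof. by have [z7 z1] := zeta_root7 R; rewrite /mQ qQ_inv mulrN. Qed.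
Lemma mP_rot m : mP (qrot m) = mP m.
Proof. by have [z7 z1] := zeta_root7 R; rewrite /mP qP_rot. Qed.
Lemma mQ_rot m : mQ (qrot m) = zeta R ^+ 6 * mQ m.
Proof. by have [z7 z1] := zeta_root7 R; rewrite /mQ qQ_rot // mulrCA. Qed.

Lemma unit_norm_mul m n : unit_norm m -> unit_norm n -> unit_norm (qmul m n).
Proof. by move=> mu nu z [z7 z1]; rewrite nrd_mul // mu // nu // mulr1. Qed.
Lemma unit_norm_inv m : unit_norm m -> unit_norm (qinv m).
Proof. by move=> mu z [z7 z1]; rewrite nrd_inv // mu. Qed.
Lemma unit_norm_rot m : unit_norm m -> unit_norm (qrot m).
Proof. by move=> mu z [z7 z1]; rewrite nrd_rot // mu. Qed.
Lemma unit_norm_one : unit_norm qone.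
Proof. by move=> z _; rewrite nrd_one. Qed.

Lemma norm_oneP m : norm_one m -> unit_norm m.
Proof.
move=> /keqP mo z z7; have x3 := cubic_root z7.1 (root7_phi z7).
have : (2 - (z + z ^+ 6)) * nrd z m = 2 - (z + z ^+ 6).
  rewrite nrdE ?z7.1 ?z7.2 //.
  have := congr1 (evk (z + z ^+ 6)) mo; rewrite evkB evkM // => E.
  move: E; set x := z + z ^+ 6.
  have -> : evk x (Kub (Zneg 4) (Zpos 4) Z0) = 4 * (x - 1).
    rewrite [LHS]/= -[zr (Zneg 4)]/(zr (Z.opp (Zpos 4))) zrN zr4 zr0; ring.
  have -> : evk x (Kub (Zpos 2) (Zneg 1) Z0) = 2 - x.
    rewrite [LHS]/= zrm1 zr2 zr0; ring.
  by [].
move=> E; apply: (mulfI (_ : 2 - (z + z ^+ 6) != 0)); last by rewrite E mulr1.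
rewrite subr_eq0; apply/eqP => E2; move: x3; rewrite /cubic -E2.
have -> : 2 ^+ 3 + 2 ^+ 2 - 2 * 2 - 1 = 7%:R :> C R by ring.
by move/eqP; rewrite pnatr_eq0.
Qed.

Lemma mobius_pqmx p q z : mobius (pqmx p q) z = mob p q z.
Proof. by rewrite /mobius /mob !mxE. Qed.

Lemma SU11_pqmx p q : nsq p - nsq q = 1 -> SU11 (pqmx p q).
Proof.
move=> pq; exists p, q; rewrite !normX2 -ofRB pq; split; first exact: ofR1.
by rewrite !mxE.
Qed.

Definition rep m (g : Delta) := unit_norm m /\
  forall z, nsq z < 1 -> mob (mP m) (mQ m) z = act g z.

Lemma rep_represents m g : rep m g -> represents (pqmx (mP m) (mQ m)) g.
Proof.
case=> mu mg; split; first exact/SU11_pqmx/mPQ_norm.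
by move=> z /diskE z1; rewrite mobius_pqmx mg.
Qed.

Lemma rep_mul m n g h : rep m g -> rep n h -> rep (qmul m n) (g * h)%g.
Proof.
case=> mu mg [nu nh]; split; first exact: unit_norm_mul.
move=> z z1; rewrite mP_mul mQ_mul -mob_comp ?mPQ_hyp // nh // mg ?act_mul //.
exact: act_disk.
Qed.

Lemma mob10 z : mob 1 0 z = z.
Proof. by rewrite /mob rmorph0 rmorph1 mul1r mul0r addr0 add0r divr1. Qed.

Lemma rep_one : rep qone 1%g.
Proof.
split; first exact: unit_norm_one.
by move=> z z1; rewrite act1 // /mP /mQ qP_one qQ_one mulr0 mob10.
Qed.

Lemma rep_inv m g : rep m g -> rep (qinv m) g^-1%g.
Proof.
case=> mu mg; split; first exact: unit_norm_inv.
move=> z z1; set w := act g^-1%g z; have w1 : nsq w < 1 by exact: act_disk.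
have zE : z = mob (mP m) (mQ m) w by rewrite mg // /w -act_mul // mulgV act1.
rewrite {1}zE mob_comp ?mPQ_hyp //; last exact: unit_norm_inv.
rewrite mP_inv mQ_inv /pmul /qmulc conjCK.
have -> : (mP m)^* * mP m + (- mQ m)^* * mQ m = 1.
  rewrite rmorphN /= mulNr ![_^* * _]mulrC !mul_conj -ofRB mPQ_norm //; exact: ofR1.
by rewrite mulNr mulrC addNr mob10.
Qed.

(** Here s2 s1 acts as multiplication by zeta and s1 s2 as multiplication by zeta^6. *)
Lemma rep_rot m g : rep m g -> rep (qrot m) (s2 * s1 * g * s1 * s2)%g.
Proof.
case=> mu mg; split; first exact: unit_norm_rot.
have zr7 := zeta_root7 R; have [z7 z1] := zr7.
have zc := root7_conj_id zr7.
have zn : nsq (zeta R) = 1 by apply: ofR_inj; rewrite -mul_conj zc -exprS z7 ofR1.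
have z6n : nsq (zeta R ^+ 6) = 1 by rewrite -zc nsq_conj.
have a1 z : nsq z < 1 -> act s1 z = zeta R ^+ 6 * (- z^*).
  move=> zd; rewrite act_class //= /generator_act /= reflection01 /mob.
  rewrite rmorph0 mul0r addr0 add0r rmorphXn /= zc.
  have z0 : zeta R != 0 by rewrite -nsq_eq0 zn oner_eq0.
  have -> : zeta R ^+ 6 = (zeta R)^-1 by apply: (mulfI z0); rewrite divff // -exprS.
  have E : zeta R ^+ 3 / (zeta R)^-1 ^+ 3 = (zeta R)^-1.
    apply: (mulfI z0); rewrite divff // exprVn invrK -exprD -exprS; exact: z7.
  by rewrite mulrAC E.
have a2 z : nsq z < 1 -> act s2 z = - z^*.
  by move=> zd; rewrite act_class //= /generator_act /= reflection02 mob10.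
move=> z zd; have fd : nsq (- z^*) < 1 by rewrite nsqN nsq_conj.
have zd6 : nsq (zeta R ^+ 6 * z) < 1 by rewrite nsqM z6n mul1r.
have wd' := mob_disk (mPQ_hyp mu) zd6.
rewrite !act_mul ?act_disk // (a2 z) // (a1 (- z^*)) // !rmorphN /= conjCK opprK -mg //.
rewrite a1 // a2; last by rewrite nsqM z6n mul1r nsqN nsq_conj.
rewrite rmorphM rmorphN /= conjCK mulrN opprK.
have z6c : (zeta R ^+ 6)^* = zeta R by rewrite -zc conjCK.
rewrite z6c mP_rot mQ_rot /mob rmorphM /= z6c.
set P := mP m; set Q := mQ m.
have -> : P * (zeta R ^+ 6 * z) + Q^* = zeta R ^+ 6 * (P * z + zeta R * Q^*).
  by rewrite -[X in _ + X]mul1r -z7; ring.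
have -> : Q * (zeta R ^+ 6 * z) = zeta R ^+ 6 * Q * z by ring.
rewrite -[LHS]mul1r -z7; move: (_ + P^*)^-1 => D; ring.
Qed.

Lemma rep_word w m s k : word_quat w m s k && norm_one m -> rep m (Delta_class w).
Proof.
case/andP=> /and4P[evw e1 e2 eD] /norm_oneP mu; split => // z z1.
have zr7 := zeta_root7 R; have [z7 _] := zr7; have phi := root7_phi zr7.
rewrite act_class //; have [_ ->] := word_actE w z1; rewrite iter_flip_even //.
set D := cscale _ _ in e1 e2 eD.
pose d := ev (zeta R) D * ev (zeta R) thth.
have th0 := th_neq0 R.
have thc : ev (zeta R) (cbar theta) = (th R)^* by rewrite ev_bar ev_theta.
have pE : fp R (fword w) = d * mP m.
  rewrite /fp (ev_ceq phi e1) evM // /d -mulrA; congr (_ * _).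
  have -> : (qword m).1 = cadd (cmul thth (cadd (cint (Zpos 1)) (cscale (Zpos 2) m.2)))
    (cscale (Zpos 2) (cmul m.1 (cbar theta))) by [].
  rewrite evD evM // evD ev_int !evZ evM // /thth evM // thc ev_theta.
  by rewrite /mP /qP -/(th R) zr1 zr2; field.
have qE : fq R (fword w) = d * mQ m.
  rewrite /fq (ev_ceq phi e2) evM // /d /mQ [RHS]mulrCA -[in RHS]mulrA; congr (_ * (_ * _)).
  have -> : (qword m).2 = cscale (Zpos 2) (cmul m.1 (cbar theta)) by [].
  rewrite evZ evM // /thth evM // thc ev_theta.
  by rewrite /qQ -/(th R) zr2; field.
have dR : d = ofR (re d).
  have dc : d^* = d.
    rewrite /d rmorphM; congr (_ * _).
      by move: (ev_bar R D); rewrite -(ev_ceq phi eD) => E; apply: esym.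
    have -> : ev (zeta R) thth = ofR (nsq (th R)).
      by rewrite /thth evM // thc ev_theta mul_conj.
    exact: conjR.
  apply: CP; rewrite ?reR // imR; have := congr1 (@im R) dc; rewrite im_conj.
  by move=> /eqP; rewrite -subr_eq0 -opprD oppr_eq0 -mulr2n mulrn_eq0 /= => /eqP.
rewrite pE qE dR mob_real_scale //; apply/eqP => d0.
have := hyp_word R w; rewrite /hyp pE qE dR d0 ofR0 !mul0r ltxx //.
Qed.

Lemma rep_gamma (n : nat) : rep (qgamma n) (gamma n).
Proof.
have [k] := ubnP n; elim: k n => // k IH [|[|[|[|[|[|[|n]]]]]]] nk.
- exact: rep_one.
- by rewrite [gamma _]gamma1E; exact: rep_word word_quat1.
- by rewrite [gamma _]gamma2E; exact: rep_word word_quat2.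
- by rewrite [gamma _]gamma3E; exact: rep_word word_quat3.
- by rewrite [gamma _]gamma4E; exact: rep_word word_quat4.
- by rewrite [gamma _]gamma5E; exact: rep_word word_quat5.
- by rewrite [gamma _]gamma6E; exact: rep_word word_quat6.
have nk' : (n.+1 < k)%N by lia.
exact: (rep_rot (IH _ nk')).
Qed.

End Represents.

Lemma ltb_leb t u : Z.ltb t (Z.succ u) -> Z.leb t u.
Proof. by lia. Qed.

(** * Bounds at the three real places *)

Section Places.
Variable R : realType.
Implicit Types (z p q : C R) (x y : R) (m n : quat).

Let c1 := c1 R.
Let c2 := c1 ^+ 2 - 2.
Let c3 := c2 ^+ 2 - 2.
Let r1 : root7 (zeta R) := zeta_root7 R.
Let r2 : root7 (zeta R ^+ 2). Proof. exact: root7_pow. Qed.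
Let r3 : root7 ((zeta R ^+ 2) ^+ 2). Proof. exact: root7_pow. Qed.
Let x2 : xr (zeta R ^+ 2) = c2. Proof. exact: xr_pow2. Qed.
Let x3 : xr ((zeta R ^+ 2) ^+ 2) = c3. Proof. by rewrite xr_pow2 // x2. Qed.
Let cub := c1_cubic R.
Let c1p := c1_gt0 R.

Lemma places_eq0 k : evk c1 k = 0 -> evk c2 k = 0 -> evk c3 k = 0 -> k = Kub Z0 Z0 Z0.
Proof.
have cub2 : cubic c2 := cubic_gal cub.
have cub3 : cubic c3 := cubic_gal cub2.
have tr0 k' : evk c1 k' = 0 -> evk c2 k' = 0 -> evk c3 k' = 0 -> ktr k' = Z0.
  move=> h1 h2 h3; have := evk_tr k' cub; rewrite -/c2 -/c3 h1 h2 h3 !addr0 => /esym E.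
  have h : Z.leb (ktr k') Z0 by rewrite -(zr_le R) E zr0.
  have h' : Z.leb Z0 (ktr k') by rewrite -(zr_le R) E zr0.
  by move: h h'; move: (ktr k') => t; lia.
move=> h1 h2 h3; apply: kub_eq0; apply: tr0; rewrite // evkM ?h1 ?h2 ?h3 ?mul0r //.
Qed.

Lemma places_inj a b : evk c1 a = evk c1 b -> evk c2 a = evk c2 b ->
  evk c3 a = evk c3 b -> a = b.
Proof.
move=> h1 h2 h3; have : ksub a b = Kub Z0 Z0 Z0.
  by apply: places_eq0; rewrite evkB ?h1 ?h2 ?h3 subrr.
by case: a b {h1 h2 h3} => a0 a1 a2 [b0 b1 b2] [*]; congr Kub; lia.
Qed.

Lemma unit_norm_evk m z : unit_norm R m -> root7 z ->
  evk (xr z) (cnorm (qnum m)) = 2 - xr z + 4 * (xr z - 1) * evk (xr z) (cnorm m.1).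
Proof.
move=> mu z7; apply: ofR_inj; have := @nrdE _ z z7.1 z7.2 m.
rewrite mu // mulr1 root7_xr // !evk_ofR.
move: (evk (xr z) (cnorm (qnum m))) (evk (xr z) (cnorm m.1)) (xr z) => a b x; rewrite !ofRE => E.
by apply/eqP; rewrite -subr_eq eq_sym -E.
Qed.

Lemma nsq_mQE m : 4 * beta R * evk c1 (cnorm m.1) = (2 - c1) * nsq (mQ R m).
Proof.
rewrite nsq_mQ -ev_nsq //= /qQ !nsqM nsqV -/(th R).
have -> : nsq (th R) = 2 - c1.
  apply: ofR_inj; rewrite -mul_conj /th rmorphB rmorph1 /= root7_conj_id //.
  transitivity (1 + zeta R ^+ 7 - (zeta R + zeta R ^+ 6)); first by ring.
  by rewrite r1.1 root7_xr // !ofRE.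
have -> : nsq (2 : C R) = 4 by rewrite -(ofR_nat R 2) nsqR; ring.
rewrite -/c1; field; have /andP[h1 h2] := c1_bounds R; rewrite -/c1 in h1 h2; lra.
Qed.

Lemma nsq_mPE m : evk c1 (cnorm (qnum m)) = (2 - c1) * nsq (mP R m).
Proof.
rewrite -ev_nsq // qnumE ?r1.1 ?r1.2 // nsqM; congr (_ * _).
apply: ofR_inj; rewrite -mul_conj rmorphB rmorph1 /= root7_conj_id //.
transitivity (1 + zeta R ^+ 7 - (zeta R + zeta R ^+ 6)); first by ring.
by rewrite r1.1 root7_xr // !ofRE.
Qed.

Lemma evk_cnorm_ge0 a : [/\ 0 <= evk c1 (cnorm a), 0 <= evk c2 (cnorm a)
  & 0 <= evk c3 (cnorm a)].
Proof.
have h1 := nsq_ge0 (ev (zeta R) a); rewrite (ev_nsq a r1) in h1.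
have h2 := nsq_ge0 (ev (zeta R ^+ 2) a); rewrite (ev_nsq a r2) x2 in h2.
have h3 := nsq_ge0 (ev ((zeta R ^+ 2) ^+ 2) a); rewrite (ev_nsq a r3) x3 in h3.
by split.
Qed.

Lemma c2_bounds : -1 / 2 < c2 < -2 / 5.
Proof.
have /andP[h1 h2] := c1_bounds R; rewrite -/c1 in h1 h2.
by apply/andP; split; rewrite /c2; nra.
Qed.
Lemma c3_bounds : -19 / 10 < c3 < -7 / 4.
Proof. by have /andP[h1 h2] := c2_bounds; apply/andP; split; rewrite /c3; nra. Qed.

Lemma cnorm_place2 m : unit_norm R m ->
  evk c2 (cnorm (qnum m)) <= 2 - c2 /\ 4 * (1 - c2) * evk c2 (cnorm m.1) <= 2 - c2.
Proof.
move=> mu; have := unit_norm_evk mu r2; rewrite x2 => E.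
have [_ h1 _] := evk_cnorm_ge0 (qnum m); have [_ h2 _] := evk_cnorm_ge0 m.1.
have /andP[b1 b2] := c2_bounds; split; nra.
Qed.
Lemma cnorm_place3 m : unit_norm R m ->
  evk c3 (cnorm (qnum m)) <= 2 - c3 /\ 4 * (1 - c3) * evk c3 (cnorm m.1) <= 2 - c3.
Proof.
move=> mu; have := unit_norm_evk mu r3; rewrite x3 => E.
have [_ _ h1] := evk_cnorm_ge0 (qnum m); have [_ _ h2] := evk_cnorm_ge0 m.1.
have /andP[b1 b2] := c3_bounds; split; nra.
Qed.

Lemma kbetaV_place x : cubic x -> (x - 1) * evk x kbetaV = 1.
Proof.
move=> cx; have [E _ _ _ _] := small_checks.
transitivity (evk x (kmul kbeta kbetaV)); last by rewrite E /= zr1 zr0; ring.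
rewrite evkM //; congr (_ * _); rewrite /kbeta /= zrm1 zr1 zr0; ring.
Qed.

Lemma evk_kd x : evk x kd = 2 - x.
Proof. by rewrite /kd /= zr2 zrm1 zr0; ring. Qed.

Lemma ktr_bounds m : unit_norm R m -> nsq (mQ R m) < zr n0 ->
  Z.leb (ktr (cnorm (cmul epsy m.1))) (Zpos 20) /\
  Z.leb (ktr (cnorm (cmul epsx (qnum m)))) (Zpos 88).
Proof.
move=> mu mn; have [_ _ _ chY chX] := small_checks.
have cub2 : cubic c2 := cubic_gal cub.
have cub3 : cubic c3 := cubic_gal cub2.
have cnM z e a : root7 z ->
    evk (xr z) (cnorm (cmul e a)) = evk (xr z) (cnorm e) * evk (xr z) (cnorm a).
  by move=> z7; rewrite -!ev_nsq // evM ?z7.1 // nsqM.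
have trE a : zr (ktr (cnorm a)) = evk c1 (cnorm a) + evk c2 (cnorm a) + evk c3 (cnorm a) :> R.
  by rewrite -(evk_tr _ cub).
have [u2 v2] := cnorm_place2 mu; have [u3 v3] := cnorm_place3 mu.
have /andP[b21 b22] := c2_bounds; have /andP[b31 b32] := c3_bounds.
have /andP[b11 b12] := c1_bounds R; rewrite -/c1 in b11 b12.
have [ey1 ey2 ey3] := evk_cnorm_ge0 epsy; have [ex1 ex2 ex3] := evk_cnorm_ge0 epsx.
split.
- apply: (@ltb_leb _ (Zpos 20)); rewrite -(zr_lt R).
  have -> : zr (Z.succ (Zpos 20)) = 21%:R :> R by rewrite zr.unlock.
  rewrite trE -x2 -x3 !cnM // x2 x3.
  have g1 := kbetaV_place cub; have g2 := kbetaV_place cub2; have g3 := kbetaV_place cub3.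
  have := kposP cub c1p chY; rewrite !(evkB, evkZ).
  have -> : evk c1 (Kub (Zpos 84) Z0 Z0) = 84%:R.
    by rewrite /= !zr0 !mul0r !addr0 zr.unlock.
  have -> : evk c1 (Kub (ktr ybound) Z0 Z0) = zr (ktr ybound).
    by rewrite /= !zr0 !mul0r !addr0.
  rewrite -(evk_tr ybound cub) -/c2 -/c3.
  have yE x : cubic x -> evk x ybound = evk x (cnorm epsy) * ((2 - x) * evk x kbetaV).
    by move=> cx; rewrite -evk_kd -!evkM.
  rewrite !yE // zrD zr1.
  have v1 : 4 * evk c1 (cnorm m.1) <= zr n0 * ((2 - c1) * evk c1 kbetaV).
    have E := nsq_mQE m; rewrite /beta -/c1 in E.
    have -> : 4 * evk c1 (cnorm m.1) = evk c1 kbetaV * ((2 - c1) * nsq (mQ R m)).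
      by rewrite -E !mulrA [evk c1 _ * _]mulrC -!mulrA [evk c1 kbetaV * _]mulrA
        [evk _ _ * (_ - 1)]mulrC g1 mul1r.
    have k0 : 0 < evk c1 kbetaV by rewrite -(pmulr_rgt0 _ (_ : 0 < c1 - 1)) ?g1 ?ltr01 //; lra.
    have -> : zr n0 * ((2 - c1) * evk c1 kbetaV) = evk c1 kbetaV * (2 - c1) * zr n0 by ring.
    by rewrite mulrA ler_wpM2l ?ltW ?mulr_gt0 // subr_gt0 (lt_trans b12); lra.
  have v2' : 4 * evk c2 (cnorm m.1) <= - ((2 - c2) * evk c2 kbetaV) by nra.
  have v3' : 4 * evk c3 (cnorm m.1) <= - ((2 - c3) * evk c3 kbetaV) by nra.
  have := ler_wpM2l ey1 v1; have := ler_wpM2l ey2 v2'; have := ler_wpM2l ey3 v3'.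
  move: (evk c1 (cnorm epsy)) (evk c2 (cnorm epsy)) (evk c3 (cnorm epsy)).
  move: (evk c1 (cnorm m.1)) (evk c2 (cnorm m.1)) (evk c3 (cnorm m.1)).
  move: ((2 - c1) * _) ((2 - c2) * _) ((2 - c3) * _) (zr n0).
  by clear; move=> G1 G2 G3 n N1 N2 N3 A1 A2 A3 *; lra.
apply: (@ltb_leb _ (Zpos 88)); rewrite -(zr_lt R).
have -> : zr (Z.succ (Zpos 88)) = 89%:R :> R by rewrite zr.unlock.
rewrite trE -x2 -x3 !cnM // x2 x3.
have := kposP cub c1p chX; rewrite !(evkB, evkD, evkZ).
have -> : evk c1 (Kub (Zpos 89) Z0 Z0) = 89%:R.
  by rewrite /= !zr0 !mul0r !addr0 zr.unlock.
have -> : evk c1 (Kub (ktr xbound) Z0 Z0) = zr (ktr xbound).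
  by rewrite /= !zr0 !mul0r !addr0.
rewrite -(evk_tr xbound cub) -/c2 -/c3.
have xE x : cubic x -> evk x xbound = evk x (cnorm epsx) * (2 - x).
  by move=> cx; rewrite -evk_kd -!evkM.
rewrite !xE //.
have v1 : evk c1 (cnorm (qnum m)) <= (zr n0 + 1) * (2 - c1).
  by rewrite nsq_mPE; have := mPQ_norm mu; nra.
have := ler_wpM2l ex1 v1; have := ler_wpM2l ex2 u2; have := ler_wpM2l ex3 u3.
move: (evk c1 (cnorm epsx)) (evk c2 (cnorm epsx)) (evk c3 (cnorm epsx)).
move: (evk c1 (cnorm (qnum m))) (evk c2 (cnorm (qnum m))) (evk c3 (cnorm (qnum m))).
move: (2 - c1) (2 - c2) (2 - c3) (zr n0).
by clear; move=> G1 G2 G3 n N1 N2 N3 A1 A2 A3 *; lra.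
Qed.

End Places.

(** * Half-planes containing F *)

Definition halfplane_of (m : quat) := halfplane (cmul epsx (qnum m), cmul epsy m.1).

Section HalfPlane.
Variable R : realType.
Implicit Types (z p q : C R) (x y : R) (m n : quat) (h : kub * cyc).

Definition ex : R := re (ev (zeta R) epsx).
Definition ey : R := re (ev (zeta R) epsy).
(** The factor common to the linear parts of all half-planes; it is kept out of the exact
    computations, which need only its square modulus [k0]. *)
Definition kappa : C R := omega R * ((th R)^* / th R) * ofR (ex * ey).
Definition half_form h z : R :=
  evk (c1 R) h.1 * (1 + nsq z) + re (ev (zeta R) h.2 * (kappa * z)).
Definition ext_form m z : R :=
  nsq (mQ R m) * (1 + nsq z) + 2 * re (mQ R m * mP R m * z).

Lemma reZ x (w : C R) : re (ofR x * w) = x * re w.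
Proof. by rewrite reM reR imR mul0r subr0. Qed.

Lemma sym_real a : a = cbar a -> ev (zeta R) a = ofR (re (ev (zeta R) a)).
Proof.
move=> ac; have := ev_bar R a; rewrite -ac => /(congr1 (@im R)); rewrite im_conj => E.
by apply: CP; rewrite ?reR ?imR //; lra.
Qed.

Lemma exE : ev (zeta R) epsx = ofR ex. Proof. exact: sym_real. Qed.
Lemma eyE : ev (zeta R) epsy = ofR ey. Proof. exact: sym_real. Qed.
Lemma ex2 : evk (c1 R) knX = ex ^+ 2.
Proof. by rewrite -nsqR -exE ev_nsq //; exact: zeta_root7. Qed.
Lemma ey2 : evk (c1 R) knY = ey ^+ 2.
Proof. by rewrite -nsqR -eyE ev_nsq //; exact: zeta_root7. Qed.
Lemma evk_kbeta : evk (c1 R) kbeta = beta R.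
Proof. rewrite /= zrm1 zr1 zr0 /beta; ring. Qed.
Lemma bX2E : evk (c1 R) bX2 = beta R * ex ^+ 2.
Proof. by rewrite -ex2 -evk_kbeta -evkM //; exact: c1_cubic. Qed.
Lemma ex_neq0 : ex != 0.
Proof.
suff : 0 < ex ^+ 2 by case: eqP => // ->; rewrite expr0n ltxx.
rewrite -ex2; apply: kposP; [exact: c1_cubic|exact: c1_gt0|by vm_compute].
Qed.
Lemma ey_neq0 : ey != 0.
Proof.
suff : 0 < ey ^+ 2 by case: eqP => // ->; rewrite expr0n ltxx.
rewrite -ey2; apply: kposP; [exact: c1_cubic|exact: c1_gt0|by vm_compute].
Qed.

Lemma nsq_th : nsq (th R) = 2 - c1 R.
Proof.
apply: ofR_inj; have r1 := zeta_root7 R.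
rewrite -mul_conj /th rmorphB rmorph1 /= root7_conj_id //.
transitivity (1 + zeta R ^+ 7 - (zeta R + zeta R ^+ 6)); first by ring.
by rewrite r1.1 root7_xr // !ofRE.
Qed.

Lemma nsq_kappa : nsq kappa = evk (c1 R) k0.
Proof.
have -> : evk (c1 R) k0 = evk (c1 R) kbeta * (evk (c1 R) knX * evk (c1 R) knY).
  by rewrite -!evkM //; exact: c1_cubic.
rewrite evk_kbeta ex2 ey2 /kappa !nsqM nsqR nsq_omega nsqV nsq_conj.
by rewrite divff ?nsq_eq0 ?th_neq0 //; ring.
Qed.

Lemma half_form_halfplane (a b : cyc) z : half_form (halfplane (a, b)) z =
  evk (c1 R) (kmul bX2 (cnorm b)) * (1 + nsq z)
  + re (ev (zeta R) (cmul a b) * (kappa * z)).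
Proof. by []. Qed.

Lemma halfplane_ofE m z : half_form (halfplane_of m) z = (2 - c1 R) * (ex * ey) ^+ 2 / 4 * ext_form m z.
Proof.
have r1 := zeta_root7 R; have [z7 z1] := r1.
rewrite half_form_halfplane.
have -> : evk (c1 R) (kmul bX2 (cnorm (cmul epsy m.1))) =
    beta R * (ex * ey) ^+ 2 * evk (c1 R) (cnorm m.1).
  rewrite evkM ?bX2E; last exact: c1_cubic.
  by rewrite -!ev_nsq // evM // nsqM eyE nsqR; ring.
have -> : ev (zeta R) (cmul (cmul epsx (qnum m)) (cmul epsy m.1)) * (kappa * z) =
   ofR ((2 - c1 R) * (ex * ey) ^+ 2 / 2) * (mQ R m * mP R m * z).
  have -> : ofR ((2 - c1 R) * (ex * ey) ^+ 2 / 2) =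
      (th R * (th R)^*) * (ofR ex * ofR ey) ^+ 2 / 2.
    by rewrite mul_conj nsq_th 2!ofRM ofRV ofRX [ofR (ex * ey)]ofRM (ofR_nat R 2).
  rewrite !evM // exE eyE qnumE // /kappa ofRM /mQ /qQ /mP -/(th R).
  by field; rewrite th_neq0.
rewrite [re (ofR _ * _)]reM reR imR mul0r subr0 /ext_form.
have E := nsq_mQE R m; move: E.
move: (evk _ _) (nsq (mQ R m)) (re (mQ R m * mP R m * z)) => a b c E.
by transitivity ((ex * ey) ^+ 2 / 4 * (4 * beta R * a) * (1 + nsq z)
   + (2 - c1 R) * (ex * ey) ^+ 2 / 2 * c); [field|rewrite E; field].
Qed.

Lemma scale_gt0 : 0 < (2 - c1 R) * (ex * ey) ^+ 2 / 4.
Proof.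
have /andP[_ h] := c1_bounds R.
rewrite divr_gt0 // mulr_gt0 //; first by lra.
by rewrite lt_def sqr_ge0 sqrf_eq0 mulf_neq0 ?ex_neq0 ?ey_neq0.
Qed.

Lemma halfplane_of_ge0 m z : (0 <= half_form (halfplane_of m) z) = (0 <= ext_form m z).
Proof. by rewrite halfplane_ofE pmulr_rge0 // scale_gt0. Qed.

Lemma ev_turn j a : ev (zeta R) (iter j crot a) = zeta R ^+ j * ev (zeta R) a.
Proof.
have [z7 _] := zeta_root7 R.
by elim: j => [|j IH]; rewrite ?mul1r // iterS ev_rot // IH mulrA -exprS.
Qed.

Lemma nsq_zetaX j z : nsq (zeta R ^+ j * z) = nsq z.
Proof.
have zn : nsq (zeta R) = 1.
  apply: ofR_inj; have r1 := zeta_root7 R.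
  by rewrite -mul_conj root7_conj_id // -exprS r1.1 ofR1.
by elim: j => [|j IH]; rewrite ?mul1r // exprS -mulrA nsqM zn IH mul1r.
Qed.

Lemma half_form_turn j h z : half_form (turn j h) z = half_form h (zeta R ^+ j * z).
Proof.
rewrite /half_form /turn /= ev_turn nsq_zetaX; congr (_ + re _); ring.
Qed.

Lemma halfplane_ext (x y x' y' : cyc) z : ev (zeta R) x = ev (zeta R) x' ->
  ev (zeta R) y = ev (zeta R) y' -> half_form (halfplane (x, y)) z = half_form (halfplane (x', y')) z.
Proof.
have r1 := zeta_root7 R; have [z7 _] := r1 => xE yE.
rewrite !half_form_halfplane !evM // !evkM; try exact: c1_cubic.
by rewrite -!(ev_nsq _ r1) xE yE.
Qed.

Lemma cramer (u v w : C R) :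
  ofR (im (u^* * v)) * w = ofR (im (w^* * v)) * u + ofR (im (u^* * w)) * v.
Proof. by apply: CP; rewrite !riE; ring. Qed.

Definition inK z := forall h j, h \in sector -> 0 <= half_form h (zeta R ^+ j * z).

Lemma sector_edges e : e \in edges6 -> exists h h' j, [/\ h \in sector, h' \in sector,
  e.1 = h & e.2 = turn j h'].
Proof.
have sx i : (i < 6)%N -> sector0 i \in sector by move=> i6; exact: mem_nth.
rewrite !inE => /or4P[/eqP->|/eqP->|/eqP->|/or3P[/eqP->|/eqP->|/eqP->]].
- by exists (sector0 0), (sector0 1), 0%N; rewrite !sx.
- by exists (sector0 1), (sector0 2), 0%N; rewrite !sx.
- by exists (sector0 2), (sector0 3), 0%N; rewrite !sx.
- by exists (sector0 3), (sector0 4), 0%N; rewrite !sx.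
- by exists (sector0 4), (sector0 5), 0%N; rewrite !sx.
by exists (sector0 5), (sector0 0), 1%N; rewrite !sx.
Qed.

Lemma inK_edge z e j : inK z -> e \in edges6 ->
  0 <= half_form e.1 (zeta R ^+ j * z) /\ 0 <= half_form e.2 (zeta R ^+ j * z).
Proof.
move=> zK /sector_edges[h [h' [i [hs hs' -> ->]]]]; split; first exact: zK.
by rewrite half_form_turn mulrA -exprD; exact: zK.
Qed.

Lemma edges6_cross e : e \in edges6 -> 0 < evk (c1 R) (cross e.1.2 e.2.2).
Proof.
move=> /(allP edges6_ok); case: e => a b /and4P[cp _ _ _].
by apply: kposP cp; [exact: c1_cubic|exact: c1_gt0].
Qed.

Lemma dominates_sound h z : inK z ->
  has (dominates h (approx h.2)) (map edge_data edges) -> 0 <= half_form h z.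
Proof.
move=> zK /hasP[_ /mapP[e0 e0E ->]].
have [j [e es ->]] : exists j, exists2 e, e \in edges6 & e0 = turn_edge j e.
  by case/allpairsP: e0E => -[j e] /= [_ es ->]; exists j, e.
have [ha hb] := inK_edge j zK es; have cp := edges6_cross es.
case: e {e0 e0E} es ha hb cp => a b es ha hb cp.
rewrite /dominates /edge_data /turn_edge /=.
case: ifP => // _; case: ifP => // _; case: ifP => // ca; case: ifP => // cb.
rewrite cross_iter => D.
have cub := c1_cubic R; have c0 := c1_gt0 R; have r1 := zeta_root7 R.
move/(knnegP cub c0): ca => ca; move/(knnegP cub c0): cb => cb.
move/(knnegP cub c0): D; rewrite evkB evkD !evkM // => D.
move: ha hb; rewrite -!half_form_turn /half_form /turn /=.
set Va := iter j crot a.2 in ca cb D *; set Vb := iter j crot b.2 in ca cb D *.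
have s0 : 0 <= 1 + nsq z by rewrite addr_ge0 ?nsq_ge0.
have E := congr1 (fun w => re (w * (kappa * z)))
  (cramer (ev (zeta R) Va) (ev (zeta R) Vb) (ev (zeta R) h.2)).
have sz := sin_zeta_gt0 R.
rewrite !ev_cross // -/(c1 R) cross_iter in E.
have {}E : evk (c1 R) (cross a.2 b.2) * re (ev (zeta R) h.2 * (kappa * z)) =
   evk (c1 R) (cross h.2 Vb) * re (ev (zeta R) Va * (kappa * z)) +
   evk (c1 R) (cross Va h.2) * re (ev (zeta R) Vb * (kappa * z)).
  apply: (mulfI (lt0r_neq0 sz)); move: E; rewrite mulrDl -!mulrA reD.
  by rewrite !reZ => E; rewrite [LHS]mulrA E; ring.
move=> ha hb; have := mulr_ge0 ca ha; have := mulr_ge0 cb hb; have := mulr_ge0 s0 D.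
have {}cp : 0 < evk (c1 R) (cross a.2 b.2) := cp.
move=> h1 h2 h3; rewrite -(pmulr_rge0 _ cp) mulrDr E; move: h1 h2 h3.
move: (re _) (re (ev (zeta R) Vb * _)) => ra rb; lra.
Qed.

End HalfPlane.

(** A vector of squared length W, multiplied by c, has nonnegative coordinates a, b on two
    consecutive side normals, of squared lengths u, v and scalar product d; A and B are the
    constants of the sides. Positivity of the form with coefficients [D1], [D2], [h] bounds (a A + b
    B)^2 by a multiple of c^2 W, and the side inequalities give c W <= (a A + b B) s. *)
Lemma radius_real (R : realFieldType) (n k A B u v d a b c W s t : R) :
  0 <= t -> 0 < k -> 0 <= a -> 0 <= b -> 0 < c -> 0 <= W -> 0 <= s -> W = k * t ->
  c * W <= (a * A + b * B) * s -> c ^+ 2 * W = a ^+ 2 * u + b ^+ 2 * v + 2 * (a * b * d) ->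
  0 < n * (k * u) - 4 * (n + 1) * (A * A) ->
  0 < n * (k * v) - 4 * (n + 1) * (B * B) ->
  0 < 4 * ((n * (k * u) - 4 * (n + 1) * (A * A)) * (n * (k * v) - 4 * (n + 1) * (B * B)))
   - (n * (k * (2 * d)) - 4 * (n + 1) * (A * (2 * B)))
     * (n * (k * (2 * d)) - 4 * (n + 1) * (A * (2 * B))) ->
  0 <= n ->
  4 * (n + 1) * t <= n * s ^+ 2.
Proof.
move=> t0 k0 a0 b0 c0 W0 s0 WE cW c2W.
set D1 := n * (k * u) - _; set D2 := n * (k * v) - _; set h := n * (k * (2 * d)) - _.
move=> d1 d2 dd n0.
have Q0 : 0 <= a ^+ 2 * D1 + b ^+ 2 * D2 + a * b * h.
  rewrite -(pmulr_rge0 _ (_ : 0 < 4 * D1)) ?mulr_gt0 //.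
  have -> : 4 * D1 * (a ^+ 2 * D1 + b ^+ 2 * D2 + a * b * h) =
    (2 * a * D1 + b * h) ^+ 2 + b ^+ 2 * (4 * (D1 * D2) - h * h) by ring.
  apply: addr_ge0; first exact: sqr_ge0.
  by apply: mulr_ge0; [exact: sqr_ge0|exact: ltW].
have Q1 : 4 * (n + 1) * (a * A + b * B) ^+ 2 <= n * k * (c ^+ 2 * W).
  rewrite -subr_ge0; suff -> : n * k * (c ^+ 2 * W) - 4 * (n + 1) * (a * A + b * B) ^+ 2 =
     a ^+ 2 * D1 + b ^+ 2 * D2 + a * b * h by [].
  by rewrite c2W /D1 /D2 /h; ring.
have cW2 : (c * W) ^+ 2 <= ((a * A + b * B) * s) ^+ 2.
  have cW0 : 0 <= c * W by rewrite mulr_ge0 // ltW.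
  by rewrite lerXn2r ?nnegrE // (le_trans cW0).
have n1 : 0 <= 4 * (n + 1) by apply: mulr_ge0 => //; apply: addr_ge0.
have h1 := ler_wpM2r (sqr_ge0 s) Q1.
have h2 := ler_wpM2l n1 cW2; rewrite [((_ + _) * s) ^+ 2]exprMn in h2.
have h3 : 4 * (n + 1) * (c * W) ^+ 2 <= n * k * (c ^+ 2 * W) * s ^+ 2.
  by apply: le_trans h2 _; rewrite [X in X <= _]mulrA.
have [W00|Wn] := eqVneq W 0.
  have -> : t = 0 by apply/eqP; move/eqP: W00; rewrite WE mulf_eq0 gt_eqF.
  by rewrite mulr0; apply: mulr_ge0; [exact: n0|exact: sqr_ge0].
have Wp : 0 < W by rewrite lt_def Wn.
have cWp : 0 < c ^+ 2 * W * k by rewrite !mulr_gt0 ?exprn_gt0.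
rewrite -(ler_pM2l cWp).
have -> : c ^+ 2 * W * k * (4 * (n + 1) * t) = 4 * (n + 1) * (c * W) ^+ 2.
  by rewrite [in RHS]exprMn [W ^+ 2]expr2 {3}WE; ring.
by apply: le_trans h3 _; rewrite le_eqVlt; apply/orP; left; apply/eqP; ring.
Qed.

Section Radius.
Variable R : realType.
Implicit Types (z p q : C R) (x y : R) (m n : quat) (h : kub * cyc).
Local Notation Z := (zeta R).

Lemma zeta_sum : \sum_(j < 7) Z ^+ j = 0.
Proof.
by rewrite !big_ord_recr big_ord0 /= add0r expr0 expr1; exact: root7_phi (zeta_root7 R).
Qed.

Lemma zeta_pow7 j k : Z ^+ (j + 7 * k) = Z ^+ j.
Proof. by rewrite exprD exprM (zeta_root7 R).1 expr1n mulr1. Qed.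

Definition side (v : cyc) (w : C R) : R := im ((ev Z v)^* * w).

Lemma side_turn j v w : side (iter j crot v) (Z ^+ j * w) = side v w.
Proof.
rewrite /side ev_turn rmorphM /=; congr im.
have -> : (Z ^+ j)^* * (ev Z v)^* * (Z ^+ j * w) = (Z ^+ j * (Z ^+ j)^*) * ((ev Z v)^* * w) by ring.
rewrite mul_conj; have := nsq_zetaX j (1 : C R); rewrite mulr1 => ->.
by rewrite -(ofR1 R) nsqR expr1n ofR1 mul1r.
Qed.

Lemma imD_sum (I : Type) (s : seq I) (F : I -> C R) :
  im (\sum_(i <- s) F i) = \sum_(i <- s) im (F i).
Proof. by elim/big_ind2: _ => // a b c d <- <-; rewrite imD. Qed.

Lemma side_sum v w : \sum_(j < 7) side v (Z ^+ j * w) = 0.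
Proof.
rewrite /side -imD_sum; under eq_bigr do rewrite mulrCA.
by rewrite -mulr_suml zeta_sum mul0r.
Qed.

(* The values of [side e.1.2] at the rotated copies of w cannot all be of one *)
(* strict sign, so walking along the 42 directions their sign has to change.  *)
Lemma cone w : exists j e, [/\ e \in edges6, 0 <= side e.1.2 (Z ^+ j * w)
  & side e.2.2 (Z ^+ j * w) <= 0].
Proof.
apply: contrapT => nex.
have step j e : e \in edges6 -> 0 <= side e.1.2 (Z ^+ j * w) -> 0 < side e.2.2 (Z ^+ j * w).
  by move=> es h; rewrite ltNge; apply/negP => h'; apply: nex; exists j, e.
pose g j := side (sector0 0).2 (Z ^+ j * w).
(* Six edges lead from the first side to its rotated copy, whose value at zeta^(j+1) w is [g j]. *)
have gstep j : 0 <= g j.+1 -> 0 < g j.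
  have s0 := @step j.+1 (sector0 0, sector0 1).
  have s1 := @step j.+1 (sector0 1, sector0 2).
  have s2 := @step j.+1 (sector0 2, sector0 3).
  have s3 := @step j.+1 (sector0 3, sector0 4).
  have s4 := @step j.+1 (sector0 4, sector0 5).
  have s5 := @step j.+1 (sector0 5, turn 1 (sector0 0)).
  move=> h; have {h}h := ltW (s0 isT h); have {h}h := ltW (s1 isT h).
  have {h}h := ltW (s2 isT h); have {h}h := ltW (s3 isT h).
  have {h}h := ltW (s4 isT h); have {h} := s5 isT h.
  by rewrite -[(_, turn 1 _).2.2]/(iter 1 crot (sector0 0).2) exprS -mulrA -{1}(expr1 Z) side_turn.
have g7 j k : g (j + 7 * k)%N = g j by rewrite /g zeta_pow7.
have [j gj] : exists j, 0 <= g j.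
  apply: contrapT => nj; have neg j : g j < 0.
    by rewrite ltNge; apply/negP => h; apply: nj; exists j.
  have := side_sum (sector0 0).2 w; rewrite !big_ord_recr big_ord0 /=.
  have := (neg 0%N, neg 1%N, neg 2%N, neg 3%N, neg 4%N, neg 5%N, neg 6%N).
  by rewrite /g => -[[[[[[h0 h1] h2] h3] h4] h5] h6]; lra.
have down i k : 0 <= g (i + k)%N -> 0 <= g i.
  by elim: k i => [|k IH] i; rewrite ?addn0 // addnS -addSn => /IH /gstep /ltW.
have pos i : 0 < g i.
  apply: gstep; apply: (down _ (j + 7 * i.+1 - i.+1)%N).
  by rewrite subnKC ?g7 // mulSn addnCA; lia.
have := side_sum (sector0 0).2 w; rewrite !big_ord_recr big_ord0 /=.
have := (pos 0%N, pos 1%N, pos 2%N, pos 3%N, pos 4%N, pos 5%N, pos 6%N).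
by rewrite /g => -[[[[[[h0 h1] h2] h3] h4] h5] h6]; lra.
Qed.

(** In the Klein model the squared norm 4 |z|^2 / (1 + |z|^2)^2 is at most n0 / (n0 + 1). The line
    of an element with |q|^2 >= n0 is at squared distance |q|^2 / |p|^2, which is at least that. *)
Lemma radius z : inK z -> 4 * (zr n0 + 1) * nsq z <= zr n0 * (1 + nsq z) ^+ 2.
Proof.
move=> zK; have r1 := zeta_root7 R; have cub := c1_cubic R; have c0 := c1_gt0 R.
(* Re (v kappa z) is the scalar product of v with (kappa z)^*, so this is the direction in which the
   side inequalities bound z; its cone tells which two sides to use. *)
have [j [e [es ea eb]]] := cone (- (kappa R * z)^*).
pose i := (6 * j)%N; pose z' := Z ^+ i * z.
have zij : Z ^+ j * Z ^+ i = 1.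
  by rewrite -exprD /i -mulSn exprM r1.1 expr1n.
have wE : Z ^+ j * - (kappa R * z)^* = - (kappa R * z')^*.
  have n1 : (Z ^+ i)^* = Z ^+ j.
    rewrite -[LHS]mul1r -zij -mulrA mul_conj.
    have := nsq_zetaX i (1 : C R); rewrite mulr1 => ->.
    by rewrite -(ofR1 R) nsqR expr1n ofR1 mulr1.
  rewrite mulrN; congr (- _).
  have -> : kappa R * z' = Z ^+ i * (kappa R * z) by rewrite /z' mulrCA.
  by rewrite [RHS]rmorphM; congr (_ * _); rewrite -n1.
have nz' : nsq z' = nsq z by rewrite /z' nsq_zetaX.
rewrite wE in ea eb; rewrite -nz'.
have [] := inK_edge i zK es; rewrite -/z'.
have cp := edges6_cross R es.
have := allP edges6_ok _ es.
case: e es ea eb cp => a b es ea eb cp /and4P[_ d1 d2 dd].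
rewrite -[(a, b).1]/a -[(a, b).2]/b in ea eb cp *.
move/(kposP cub c0): d1; move/(kposP cub c0): d2; move/(kposP cub c0): dd.
rewrite !(evkB, evkZ, evkM) // -nsq_kappa -!(ev_nsq _ r1) -(ev_cdot _ _ r1).
have -> : zr (Z.mul (Zpos 4) (Z.add n0 (Zpos 1))) = 4 * (zr n0 + 1) :> R.
  by rewrite zrM zrD zr1 zr4.
rewrite zr4 zr2; move=> dd d2 d1 Ha Hb.
set w := - (kappa R * z')^* in ea eb.
have wc : w^* = - (kappa R * z') by rewrite /w rmorphN /= conjCK.
have crm := cramer (ev Z a.2) (ev Z b.2) w.
have im_anti (u v : C R) : im (u^* * v) = - im (v^* * u) by rewrite !riE; ring.
have ea' : 0 <= - side b.2 w by rewrite oppr_ge0.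
apply: (radius_real (nsq_ge0 _) _ ea' ea (_ : 0 < im ((ev Z a.2)^* * ev Z b.2))
  (nsq_ge0 w) _ (_ : nsq w = nsq (kappa R) * nsq z') _ _ d1 d2 dd _).
- by rewrite nsq_kappa; apply: (kposP cub c0); vm_compute.
- by rewrite ev_cross // mulr_gt0 // sin_zeta_gt0.
- by rewrite addr_ge0 ?nsq_ge0.
- by rewrite -nsqM /w nsqN nsq_conj.
- have := congr1 (fun t => re (t * w^*)) crm.
  rewrite mulrDl -!mulrA reD !reZ mul_conj reR (im_anti w) -/(side b.2 w) -/(side a.2 w) => ->.
  move: Ha Hb; rewrite /half_form; have -> : kappa R * z' = - w^* by rewrite wc opprK.
  rewrite !mulrN !reN !subr_ge0 => Ha Hb.
  by rewrite mulrDl -!mulrA lerD // ler_wpM2l.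
- have := congr1 (@nsq R) crm.
  rewrite nsqM nsqR => ->; rewrite nsqD !nsqM !nsqR (im_anti w) -/(side b.2 w) -/(side a.2 w).
  by rewrite rmorphM /= conjR mulrACA -ofRM reZ; ring.
by rewrite -(zr0 R) zr_le.
Qed.

Lemma inK_rot z j : inK z -> inK (Z ^+ j * z).
Proof. by move=> zK h i hs; rewrite mulrA -exprD; exact: zK. Qed.

Lemma parity_qnum m i : (i < 7)%N -> Z.odd (nth Z0 (seq_of (cmul epsx (qnum m))) i) =
  Z.odd (nth Z0 (seq_of xpar) i).
Proof.
have -> : cmul epsx (qnum m) = cadd xpar
    (cscale (Zpos 2) (cmul epsx (cadd (cmul theta m.2) m.1))).
  by case: m => -[? ? ? ? ? ? ?] [? ? ? ? ? ? ?]; rewrite /qnum /cmul /=; congr Cyc; lia.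
case: (cmul epsx (cadd _ _)) => a0 a1 a2 a3 a4 a5 a6; case: xpar => b0 b1 b2 b3 b4 b5 b6.
by case: i => [|[|[|[|[|[|[|//]]]]]]] _ /=; rewrite Z.odd_add_mul_2.
Qed.

Lemma odd_shift k a i : (i < 7)%N -> Z.odd (nth Z0 (seq_of (shift k a)) i) =
  Z.odd (nth Z0 (seq_of a) i) (+) Z.odd k.
Proof.
case: a => a0 a1 a2 a3 a4 a5 a6.
by case: i => [|[|[|[|[|[|[|//]]]]]]] _ /=; rewrite Z.odd_sub; case: Z.odd; case: Z.odd.
Qed.

Lemma cnorm_shift k a : cnorm (shift k a) = cnorm a.
Proof. by case: a => *; rewrite /cnorm /=; congr Kub; lia. Qed.

Lemma cnorm_target m : unit_norm R m ->
  cnorm (cmul epsx (qnum m)) = target (cmul epsy m.1).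
Proof.
move=> mu; have [_ E1 E2 _ _] := small_checks.
have main (w : C R) : root7 w -> evk (xr w) (cnorm (cmul epsx (qnum m))) =
    evk (xr w) (target (cmul epsy m.1)).
  move=> w7; have cub := xr_cubic w7.
  have -> : target (cmul epsy m.1) = kadd (target (cint Z0)) (kmul (Kub Z0 (Zpos 4) Z0)
      (cnorm (cmul epsy m.1))) by [].
  rewrite E1 evkD !evkM // -!(ev_nsq _ w7) !evM ?w7.1 // !nsqM !(ev_nsq _ w7).
  have E3 : evk (xr w) (Kub Z0 (Zpos 4) Z0) * evk (xr w) knY =
      4 * (xr w - 1) * evk (xr w) knX.
    transitivity (evk (xr w) (kmul (Kub Z0 (Zpos 4) Z0) knY)); first by rewrite evkM.
    rewrite E2 (@evkM _ _ (Kub (Zneg 4) (Zpos 4) Z0) knX) //; congr (_ * _).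
    by rewrite /= -[zr (Zneg 4)]/(zr (Z.opp (Zpos 4))) zrN zr4 zr0; ring.
  rewrite -/knX -/knY [evk _ (Kub _ _ _) * (_ * _)]mulrA E3 evk_kd.
  by rewrite (unit_norm_evk mu w7) -/knX; ring.
have r1 := zeta_root7 R; have r2 : root7 (Z ^+ 2) by exact: root7_pow.
have r3 : root7 ((Z ^+ 2) ^+ 2) by exact: root7_pow.
have x2 := xr_pow2 r1; have x3 := xr_pow2 r2.
apply: (@places_inj R); first exact: main r1.
  by have := main _ r2; rewrite x2.
by have := main _ r3; rewrite x3 x2.
Qed.

Lemma possible_cnorm a : Z.leb (ktr (cnorm a)) (Zpos 88) -> possible (cnorm a).
Proof.
move=> a88; rewrite /possible a88 andTb.
have cub := c1_cubic R; have c0 := c1_gt0 R.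
have [_ h2 h3] := evk_cnorm_ge0 R a.
apply/andP; split; apply/negP => /(knegP cub c0); apply/negP; rewrite -leNgt.
  by rewrite -evk_gal.
by rewrite -evk_gal // -evk_gal //; exact: cubic_gal.
Qed.

Lemma keq_refl t : keq t t.
Proof. by case: t => ? ? ?; rewrite /keq !Z.eqb_refl. Qed.

Lemma has_dedup (p : cyc * kub) (T : seq (cyc * kub)) : p \in T -> has (keq p.2)
  (foldr (fun yt l => if has (keq yt.2) l then l else yt.2 :: l) [::] T).
Proof.
elim: T => //= yt T IH; rewrite inE => /orP[/eqP <-|/IH h] /=.
  by case: ifP => // _; rewrite /= keq_refl.
by case: ifP => //= _; rewrite h orbT.
Qed.

Lemma big_checkP (x y : cyc) : (x, cnorm x) \in xall -> y \in ysmall ->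
  cnorm x = target y -> Z.eqb (Z.modulo (Z.sub (csum x) (csum y)) (Zpos 7)) Z0 ->
  ceq y (cint Z0) = false ->
  has (dominates (halfplane (x, y)) (approx (halfplane (x, y)).2)) (map edge_data edges).
Proof.
move=> xs ys xy md y0.
have := big_checkT; rewrite /big_check.
set T := [seq (b, target b) | b <- ysmall].
have yT : (y, target y) \in T by apply/mapP; exists y.
have KT := has_dedup yT.
set X := [seq xn <- xall | _]; have xX : (x, cnorm x) \in X.
  by rewrite mem_filter [(x, _).2]/= xy -xy xs andbT {1}xy; exact: KT.
move/allP/(_ _ xX)/allP/(_ _ yT).
by rewrite -[(x, _).2]/(cnorm x) -[(y, _).2]/(target y) xy keq_refl
  -[(x, _).1]/x -[(y, _).1]/y md y0.
Qed.

(** The numerators are replaced by normalised representatives, and y is also turned by a power of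
    zeta, so that the pair is one of those examined by [big_check]. *)
Lemma finite_case z m : inK z -> unit_norm R m -> nsq (mQ R m) < zr n0 ->
  ev Z m.1 != 0 -> 0 <= half_form (halfplane_of m) z.
Proof.
move=> zK mu mn Y0; have r1 := zeta_root7 R; have [z7 _] := r1; have phi := root7_phi r1.
have [TY TX] := ktr_bounds mu mn.
have cN := cnorm_target mu; rewrite /halfplane_of; set u := cmul epsx _ in TX cN *.
set v := cmul epsy _ in TY cN *.
have [kx sx] := small_shift u; have [ky sy] := small_shift v.
have [j fj] := first_max_rot (shift ky v).
set x := shift kx u in sx; set y := iter j crot (shift ky v) in fj.
have cx : cnorm x = cnorm u by exact: cnorm_shift.
have cy : cnorm y = cnorm v by rewrite cnorm_iter cnorm_shift.
have xy : cnorm x = target y by rewrite cx cN /target cy.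
have evx : ev Z x = ev Z u by rewrite (ev_ceq phi (ceq_shift kx u)).
have evy : ev Z y = Z ^+ j * ev Z v by rewrite ev_turn (ev_ceq phi (ceq_shift ky v)).
have ys : y \in ysmall.
  apply: ysmall_mem; rewrite ?small_rot // -?xy ?cx ?cy //; last by apply/Z.leb_le.
  exact: possible_cnorm.
have xs : (x, cnorm x) \in xall.
  apply: (@xall_mem x (Z.odd kx)) => //; first by rewrite cx; apply/Z.leb_le.
  by move=> i i7; rewrite odd_shift // parity_qnum.
(* [theta] vanishes modulo 1 - zeta, so with s = [csum m.1] the two sums are -5 * 2 s and 4 s up to
   multiples of 7, and these agree modulo 7. *)
have md : Z.eqb (Z.modulo (Z.sub (csum x) (csum y)) (Zpos 7)) Z0.
  rewrite csum_iter !csum_shift !csumM.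
  have -> : csum (qnum m) = Z.mul (Zpos 2) (csum m.1).
    by case: m {mu mn Y0 TY TX cN u v kx sx ky sy j fj x y cx cy xy evx evy ys xs}
      => -[? ? ? ? ? ? ?] [? ? ? ? ? ? ?]; rewrite /qnum /cmul /=; lia.
  have -> : csum epsx = Zneg 5 by []. have -> : csum epsy = Zpos 4 by [].
  apply/Z.eqb_eq; apply/Z.mod_divide => //.
  exists (Z.sub (Z.sub ky kx) (Z.mul (Zpos 2) (csum m.1))).
  by move: (csum m.1) => s; lia.
have y0 : ceq y (cint Z0) = false.
  apply/negP => /(ev_ceq phi); rewrite evy ev_int zr0 => /eqP.
  rewrite !mulf_eq0 evM // mulf_eq0 (negbTE Y0) orbF eyE.
  rewrite -[Z ^+ j == 0]nsq_eq0 -[Z ^+ j]mulr1 nsq_zetaX -(ofR1 R) nsqR expr1n oner_eq0 /=.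
  by rewrite -(ofR0 R) (inj_eq (@ofR_inj R)) (negbTE (ey_neq0 R)).
(* Turning y by zeta^j is compensated by turning z by zeta^(6 j), the inverse of zeta^j. *)
have := dominates_sound (inK_rot (6 * j) zK) (big_checkP xs ys xy md y0).
rewrite !half_form_halfplane nsq_zetaX cy !evM // evx evy => h.
apply: le_trans h _; rewrite le_eqVlt; apply/orP; left; apply/eqP.
congr (_ + re _).
have e1 : Z ^+ j * Z ^+ (6 * j) = 1 by rewrite -exprD -mulSn exprM z7 expr1n.
rewrite -[RHS]mul1r -e1 /u /v !evM //; move: (Z ^+ j) (Z ^+ (6 * j)) => a b; ring.
Qed.

Lemma infinite_case z m : inK z -> unit_norm R m -> zr n0 <= nsq (mQ R m) -> 0 <= ext_form m z.
Proof.
move=> zK mu nn; have rad := radius zK; have pq := mPQ_norm mu.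
have pE : nsq (mP R m) = nsq (mQ R m) + 1 by lra.
have n0p : 0 < zr n0 :> R by rewrite -(zr0 R) zr_lt.
rewrite /ext_form; set w := mQ R m * mP R m * z; set n := nsq (mQ R m) in nn pq *.
have wE : re w ^+ 2 <= n * (n + 1) * nsq z.
  have -> : n * (n + 1) * nsq z = nsq w.
    by rewrite /w 2!nsqM pE.
  by rewrite /nsq lerDl sqr_ge0.
have np : 0 < n by apply: lt_le_trans nn.
have s0 := nsq_ge0 z; move: (nsq z) s0 rad wE => t t0 rad wE.
have h : (2 * re w) ^+ 2 <= (n * (1 + t)) ^+ 2.
  have h1 : (2 * re w) ^+ 2 <= n * (n + 1) * (4 * t) by rewrite exprMn; lra.
  have h2 : (n + 1) * (4 * t) <= n * (1 + t) ^+ 2.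
    have n01 : 0 < zr n0 + 1 :> R by rewrite addr_gt0.
    rewrite -(ler_pM2l n01).
    have h3 : (n + 1) * (4 * (zr n0 + 1) * t) <= (n + 1) * (zr n0 * (1 + t) ^+ 2).
      by rewrite ler_wpM2l // addr_ge0 // ltW.
    have h4 : (n + 1) * zr n0 * (1 + t) ^+ 2 <= (zr n0 + 1) * n * (1 + t) ^+ 2.
      by rewrite ler_wpM2r ?sqr_ge0 //; lra.
    by lra.
  apply: le_trans h1 _.
  have := ler_wpM2l (ltW np) h2; rewrite exprMn; lra.
have nt : 0 <= n * (1 + t) by apply: mulr_ge0; [exact: ltW|exact: addr_ge0].
have : `|2 * re w| <= n * (1 + t).
  by rewrite -[X in _ <= X]ger0_norm // -ler_sqr ?nnegrE // !real_normK ?num_real.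
by rewrite ler_norml => /andP[h1 _]; lra.
Qed.

Lemma ext_form_ge0 z m : inK z -> unit_norm R m -> 0 <= ext_form m z.
Proof.
move=> zK mu; have [nn|nn] := leP (zr n0) (nsq (mQ R m)); first exact: infinite_case.
have [Y0|Y0] := eqVneq (ev Z m.1) 0; last by rewrite -halfplane_of_ge0; exact: finite_case.
have Q0 : mQ R m = 0 by rewrite /mQ /qQ Y0 mulr0 mul0r mulr0.
have n0 : nsq (0 : C R) = 0 by rewrite -(ofR0 R) nsqR expr0n.
have re0 : re (0 : C R) = 0 by [].
by rewrite /ext_form Q0 !mul0r n0 re0 mulr0 mul0r addr0.
Qed.

End Radius.

Local Open Scope classical_set_scope.

(** * The polygon as an intersection of half-planes *)

Section Polygon.
Variable R : realType.
Implicit Types (z w p q : C R) (t : R) (m n : quat).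
Local Notation Z := (zeta R).
Local Notation F := (@polygonF R).

Lemma ext_form_nsq m z : unit_norm R m -> ext_form m z = nsq (mQ R m * z + (mP R m)^*) - 1.
Proof.
move=> mu; have pE : nsq (mP R m) = 1 + nsq (mQ R m) by have := mPQ_norm mu; lra.
rewrite nsqD nsqM nsq_conj pE conjCK /ext_form [mQ R m * mP R m * z]mulrAC; ring.
Qed.

(** [mob_nsq] recovers |q z + p^*| from z and its image, so the exterior of the isometric circle
    does not depend on the matrix chosen. *)
Lemma nsq_rep_unique p q p' q' z : nsq p - nsq q = 1 -> nsq p' - nsq q' = 1 ->
  nsq z < 1 -> mob p q z = mob p' q' z -> nsq (q * z + p^*) = nsq (q' * z + p'^*).
Proof.
move=> pq pq' z1 E; have h : nsq q < nsq p by lra.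
have h' : nsq q' < nsq p' by lra.
have := mob_nsq h z1; have := mob_nsq h' z1; rewrite E pq pq' => <- /mulIf; apply.
by rewrite subr_eq0 eq_sym lt_eqF // mob_disk.
Qed.

Lemma represents_nsq M m g z : represents M g -> rep R m g -> nsq z < 1 ->
  nsq (M 1 0 * z + M 1 1) = nsq (mQ R m * z + (mP R m)^*).
Proof.
move=> [[p [q [pq [M00 M01 M10 M11]]]] Mg] [mu mg] z1.
rewrite M10 M11; apply: nsq_rep_unique => //; last 1 first.
- have /Mg := (diskE z).2 z1; rewrite mg // => <-.
  by rewrite /mobius M00 M01 M10 M11.
- by apply: ofR_inj; rewrite ofRB -!normX2 pq ofR1.
exact: mPQ_norm.
Qed.

Lemma mQ_gamma i : (1 <= i <= 42)%N -> mQ R (qgamma i) != 0.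
Proof.
have cub := c1_cubic R; have c0 := c1_gt0 R.
have base6 : [/\ kpos (cnorm quat1.1), kpos (cnorm quat2.1), kpos (cnorm quat3.1),
  kpos (cnorm quat4.1) & kpos (cnorm quat5.1) && kpos (cnorm quat6.1)] by split; vm_compute.
have mQn m : kpos (cnorm m.1) -> mQ R m != 0.
  move=> /(kposP cub c0); have := nsq_mQE R m => E k0; apply/eqP => Q0.
  move: E; rewrite Q0 -(ofR0 R) nsqR expr0n mulr0 => /eqP.
  by rewrite mulf_eq0 (gt_eqF k0) orbF mulf_eq0 pnatr_eq0 /= gt_eqF // beta_gt0.
case: base6 => h1 h2 h3 h4 /andP[h5 h6].
have [k] := ubnP i; elim: k i => // k IH [|[|[|[|[|[|[|i]]]]]]] // ik /andP[_ i42].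
- exact: mQn h1.
- exact: mQn h2.
- exact: mQn h3.
- exact: mQn h4.
- exact: mQn h5.
- exact: mQn h6.
rewrite -[qgamma _]/(qrot (qgamma i.+1)) mQ_rot mulf_neq0 //; last first.
  by apply: IH; lia.
rewrite -nsq_eq0 -[Z ^+ 6]mulr1 nsq_zetaX -(ofR1 R) nsqR expr1n oner_eq0 //.
Qed.

Lemma ext_IP i z : (1 <= i <= 42)%N ->
  ext_I (gamma i) z <-> nsq z < 1 /\ 0 < ext_form (qgamma i) z.
Proof.
move=> i42; have rp := rep_gamma R i; rewrite ext_form_nsq ?subr_gt0; last exact: rp.1.
split=> [[M [Mg M0 [/diskE z1 ext]]]|[z1 ext]].
  by split=> //; rewrite -(represents_nsq Mg rp z1) -norm_gt1.
exists (pqmx (mP R (qgamma i)) (mQ R (qgamma i))); split.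
- exact: rep_represents.
- by rewrite mxE; exact: mQ_gamma.
split; first exact/diskE.
by rewrite !mxE norm_gt1.
Qed.

(** Radii of balls in [C R] are complex numbers; positivity for the partial order forces them to be
    real. *)
Lemma posCP (e : C R) : 0 < e -> e = ofR (re e) /\ 0 < re e.
Proof.
by rewrite [0 < e]ltcE => /andP[/eqP e1 e2]; split=> //; apply: CP.
Qed.

Lemma closureP (A : set (C R)) z :
  closure A z <-> forall e : R, 0 < e -> exists2 w, A w & `|z - w| < ofR e.
Proof.
split=> [Az e e0|Az B /nbhs_ballP[e e0 eB]].
  have eC : 0 < ofR e by rewrite -(ofR0 R) ofR_lt.
  by have [w [Aw ew]] := Az _ (nbhsx_ballx z (ofR e) eC); exists w.
have [eE e1] := posCP e0.
have [w Aw zw] := Az (re e) e1; exists w; split=> //; apply: eB.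
by rewrite -ball_normE /= eE.
Qed.

Lemma interiorP (A : set (C R)) z :
  A° z -> exists2 e : R, 0 < e & forall w, `|z - w| < ofR e -> A w.
Proof.
move=> /nbhs_ballP[e e0 eA]; have [eE e1] := posCP e0.
exists (re e) => // w zw; apply: eA; by rewrite -ball_normE /= eE.
Qed.

Lemma polygonF_sub z : F z -> nsq z <= 1 /\
  forall i, (1 <= i <= 42)%N -> 0 <= ext_form (qgamma i) z.
Proof.
move=> /closureP Fz; split.
  rewrite leNgt -norm_gt1; apply/negP => z1.
  have [e0 eE] : 0 < Num.sqrt (nsq z) - 1 /\ ofR (Num.sqrt (nsq z) - 1) = `|z| - 1.
    by move: z1; rewrite normE -(ofR1 R) ofR_lt ofRB ofR1 subr_gt0.
  have [w Fw zw] := Fz _ e0;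
    have [/diskE w1 _] := (ext_IP w (isT : (1 <= 1 <= 42)%N)).1 (Fw 1%N isT).
  rewrite eE in zw; have := ler_normD (z - w) w; rewrite subrK => h.
  have := ltrD zw w1; rewrite subrK => h'.
  by have := le_lt_trans h h'; rewrite ltxx.
move=> i i42; have [mu _] := rep_gamma R i.
rewrite ext_form_nsq // subr_ge0 leNgt -norm_lt1; apply/negP.
move: (mQ_gamma i42); set q := mQ R _; set p := (mP R _)^* => q0 z1.
have [e0 eE] : 0 < (1 - Num.sqrt (nsq (q * z + p))) / Num.sqrt (nsq q) /\
   ofR ((1 - Num.sqrt (nsq (q * z + p))) / Num.sqrt (nsq q)) = (1 - `|q * z + p|) / `|q|.
  split; last by rewrite !normE ofRM ofRB ofR1 ofRV.
  apply: divr_gt0; first by rewrite subr_gt0 -ofR_lt -normE ofR1.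
  by rewrite sqrtr_gt0 lt_def nsq_eq0 q0 nsq_ge0.
have [w Fw zw] := Fz _ e0; have [w1 Fmw] := (ext_IP w i42).1 (Fw i i42).
rewrite ext_form_nsq // subr_gt0 -norm_gt1 -/q -/p in Fmw.
rewrite eE ltr_pdivlMr ?normr_gt0 // in zw.
have E : q * w + p = q * z + p + (w - z) * q by ring.
have := ler_normD (q * z + p) ((w - z) * q); rewrite -E normrM distrC => h.
have := lt_le_trans Fmw (le_trans h (lerD (lexx _) (ltW zw))).
by rewrite addrC subrK ltxx.
Qed.

(** Star-shapedness about 0: for t < 1 and z in the disk the first term is positive when q is not 0,
    so shrinking turns a weak inequality into a strict one. *)
Lemma ext_form_scale m z t : 0 <= t -> 0 <= nsq (mQ R m) -> ext_form m (ofR t * z) =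
   nsq (mQ R m) * (1 - t) * (1 - t * nsq z) + t * ext_form m z.
Proof.
move=> t0 _; rewrite /ext_form nsqM nsqR mulrCA reZ; ring.
Qed.

Lemma polygonF_sup z : nsq z < 1 -> (forall i, (1 <= i <= 42)%N -> 0 <= ext_form (qgamma i) z) -> F z.
Proof.
move=> z1 Fz; apply/closureP => e e0.
have z0 := nsq_ge0 z.
(* A positive number below both 1 and e, so that the point t z with t = 1 - s stays within e of
   z. *)
pose s := e / (1 + e); have e1 : 0 < 1 + e by rewrite addr_gt0.
have s0 : 0 < s by rewrite divr_gt0.
have s1 : s < 1 by rewrite ltr_pdivrMr // mul1r ltrDr.
have se : s < e by rewrite ltr_pdivrMr // ltr_pMr // ltrDl.
pose t := 1 - s; have t1 : 0 < t < 1 by rewrite /t; apply/andP; split; lra.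
have /andP[t0 t1'] := t1.
have tz1 : nsq (ofR t * z) < 1 by rewrite nsqM nsqR; nra.
exists (ofR t * z).
  move=> i i42; apply/ext_IP => //; split=> //; rewrite ext_form_scale ?nsq_ge0 ?ltW //.
  have Qp : 0 < nsq (mQ R (qgamma i)) by rewrite lt_def nsq_eq0 mQ_gamma ?nsq_ge0.
  rewrite ltr_wpDr //; first by rewrite mulr_ge0 ?Fz // ltW.
  by rewrite !mulr_gt0 // subr_gt0 //; nra.
have -> : z - ofR t * z = ofR s * z by rewrite /t ofRB ofR1; ring.
have eE : e = Num.sqrt (e ^+ 2) by rewrite sqrtr_sqr ger0_norm // ltW.
rewrite normE ofR_lt [X in _ < X]eE ltr_sqrt ?exprn_gt0 // nsqM nsqR; nra.
Qed.

Lemma inK_polygon z : (forall i, (1 <= i <= 42)%N -> 0 <= ext_form (qgamma i) z) -> inK z.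
Proof.
have r1 := zeta_root7 R; have [z7 _] := r1; have phi := root7_phi r1.
(* Side by side, [o] is the index of the generator and [r] the power of zeta by which the tabulated
   second entry is turned. *)
have tab : forall h, h \in sector -> exists o r, [/\ (1 <= o <= 6)%N,
    exists x y : cyc, [/\ h = halfplane (x, y), ceq x (cmul epsx (qnum (qgamma o)))
     & ceq y (iter r crot (cmul epsy (qgamma o).1))] & true].
  move=> h; rewrite !inE => /or4P[/eqP->|/eqP->|/eqP->|/or3P[/eqP->|/eqP->|/eqP->]].
  - by exists 4%N, 5%N; split=> //; exists (nth (cint Z0, cint Z0) base 0).1,
      (nth (cint Z0, cint Z0) base 0).2; split; vm_compute.
  - by exists 3%N, 5%N; split=> //; exists (nth (cint Z0, cint Z0) base 1).1,
      (nth (cint Z0, cint Z0) base 1).2; split; vm_compute.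
  - by exists 2%N, 5%N; split=> //; exists (nth (cint Z0, cint Z0) base 2).1,
      (nth (cint Z0, cint Z0) base 2).2; split; vm_compute.
  - by exists 1%N, 5%N; split=> //; exists (nth (cint Z0, cint Z0) base 3).1,
      (nth (cint Z0, cint Z0) base 3).2; split; vm_compute.
  - by exists 6%N, 6%N; split=> //; exists (nth (cint Z0, cint Z0) base 4).1,
      (nth (cint Z0, cint Z0) base 4).2; split; vm_compute.
  by exists 5%N, 6%N; split=> //; exists (nth (cint Z0, cint Z0) base 5).1,
      (nth (cint Z0, cint Z0) base 5).2; split; vm_compute.
have Frot m k w : ext_form (iter k qrot m) w = ext_form m (Z ^+ (6 * k) * w).
  have e : mQ R (iter k qrot m) = Z ^+ (6 * k) * mQ R m /\ mP R (iter k qrot m) = mP R m.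
    elim: k => [|k [IH1 IH2]]; first by rewrite muln0 expr0 mul1r.
    by rewrite iterS mQ_rot mP_rot IH1 IH2 mulrA -exprD mulnS.
  case: e => e1 e2; rewrite /ext_form e1 e2 !nsq_zetaX; congr (_ + 2 * re _).
  by move: (Z ^+ _) => a; ring.
have gk o k : (1 <= o <= 6)%N -> qgamma (o + 6 * k)%N = iter k qrot (qgamma o).
  move=> /andP[og _]; elim: k => [|k IH]; first by rewrite muln0 addn0.
  rewrite iterS -IH mulnS addnCA; case: o og {IH} => [//|o _].
  by rewrite addSn.
move=> Fz h j /tab[ o [r [ o6 [x [y [-> ex ey]]] _]]].
rewrite (halfplane_ext _ (ev_ceq phi ex) (ev_ceq phi ey)).
have -> w : half_form (halfplane (cmul epsx (qnum (qgamma o)), iter r crot (cmul epsy (qgamma o).1))) w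
    = half_form (halfplane_of (qgamma o)) (Z ^+ r * w).
  rewrite /halfplane_of !half_form_halfplane nsq_zetaX cnorm_iter; congr (_ + re _).
  by rewrite (evM _ _ z7) (evM (cmul epsx _) (cmul epsy _) z7) ev_turn; move: (Z ^+ r) => a; ring.
rewrite halfplane_of_ge0 mulrA -exprD.
(* As 36 is 1 modulo 7, zeta^(r + j) = zeta^(6 k); and k <= 6 keeps the index o + 6 k at most 42. *)
pose k := ((6 * (r + j)) %% 7)%N.
have -> : Z ^+ (r + j) = Z ^+ (6 * k).
  rewrite (divn_eq (r + j) 7) (divn_eq (6 * k) 7) ![(_ * 7 + _)%N]addnC
    ![(_ * 7)%N]mulnC !zeta_pow7.
  congr (_ ^+ _); rewrite /k; lia.
rewrite -Frot -gk //; apply: Fz; rewrite /k; lia.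
Qed.
End Polygon.

Section Integers.
Local Open Scope Z_scope.
(** Opposites of squares modulo 7 are 0, 3, 5, 6, and among 0, 2, 4, 6 only 0 and 6 occur. *)
Lemma trace_mod7 (t d s : Z) : 0 <= t <= 3 -> 2 * t = 7 * d - s * s -> t = 0 \/ t = 3.
Proof.
have := @Z.div_mod s 7; have := Z.mod_pos_bound s 7.
move: (s / 7) (s mod 7) => q r r7 sE t3; have {}r7 : 0 <= r < 7 by lia.
have -> : s * s = 7 * (7 * (q * q) + 2 * (q * r)) + r * r by rewrite [s]sE //; ring.
move: (7 * (q * q) + _) => u.
have : r = 0 \/ r = 1 \/ r = 2 \/ r = 3 \/ r = 4 \/ r = 5 \/ r = 6 by lia.
by do ![case=> [->|]] => [||||||->]; lia.
Qed.
End Integers.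

(** * Interior points *)

Section Interior.
Variable R : realType.
Implicit Types (z w p q : C R) (t : R) (m n : quat).
Local Notation Z := (zeta R).
Local Notation F := (@polygonF R).

Lemma sum3_eq0 (a b c : R) : 0 <= a -> 0 <= b -> 0 <= c -> a + b + c = 0 -> a = 0.
Proof. by lra. Qed.
Lemma sum3_eq3 (a b c : R) : a <= 1 -> b <= 1 -> c <= 1 -> a + b + c = 3 -> a = 1.
Proof. by lra. Qed.

(** The closure is taken in the whole plane; the circumradius bound keeps it off the unit circle,
    where [radius] would read 4 (n0 + 1) <= 4 n0. *)
Lemma polygonF_disk z : F z -> nsq z < 1 /\ inK z.
Proof.
move=> /polygonF_sub[z1 /inK_polygon zK]; split=> //.
have := radius zK; have n0p : 0 < zr n0 :> R by rewrite -(zr0 R) zr_lt.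
move: z1; rewrite le_eqVlt => /orP[/eqP ->|//]; rewrite !mulr1 => h; nra.
Qed.

Lemma Gamma_rep g : Gamma g -> exists m, rep R m g.
Proof.
move=> Gg; apply: (Gg [set g | exists m, rep R m g]).
split=> [|_ [i _ <-]]; last by exists (qgamma i); exact: rep_gamma.
split=> [|x y [m mx] [n ny]|x [m mx]].
- by exists qone; exact: rep_one.
- by exists (qmul m n); exact: rep_mul.
- by exists (qinv m); exact: rep_inv.
Qed.

Lemma Gamma_one : Gamma 1%g.
Proof. by move=> A [[A1 _ _] _]. Qed.
Lemma Gamma_mul g h : Gamma g -> Gamma h -> Gamma (g * h)%g.
Proof. by move=> Gg Gh A GA; case: (GA) => -[_ AM _] _; apply: AM; [exact: Gg|exact: Gh]. Qed.
Lemma Gamma_gamma i : (1 <= i <= 42)%N -> Gamma (gamma i).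
Proof. by move=> i42 A [_]; apply; exists i. Qed.

(** A slightly longer multiple of z is still in F; shrinking it back to z makes its weak inequality
    strict. *)
Lemma interior_ext_form z m : F° z -> unit_norm R m -> mQ R m != 0 -> 0 < ext_form m z.
Proof.
move=> /interiorP[e e0 Fe] mu Q0; have [zF zK] : nsq z < 1 /\ inK z.
  by apply/polygonF_disk/Fe; rewrite subrr normr0 -(ofR0 R) ofR_lt.
pose t := 1 + e / 2; have t1 : 1 < t by rewrite ltrDl divr_gt0.
have t0 : 0 < t by exact: lt_trans t1.
have [w1 wK] : nsq (ofR t * z) < 1 /\ inK (ofR t * z).
  apply/polygonF_disk/Fe.
  have -> : z - ofR t * z = - (ofR (e / 2) * z) by rewrite /t ofRD ofR1; ring.
  have eE : e = Num.sqrt (e ^+ 2) by rewrite sqrtr_sqr ger0_norm // ltW.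
  rewrite normE ofR_lt [X in _ < X]eE ltr_sqrt ?exprn_gt0 // nsqN nsqM nsqR.
  have := nsq_ge0 z; have := exprn_gt0 2 e0 => h1 h2.
  by rewrite exprMn; nra.
have := ext_form_ge0 wK mu; set w := ofR t * z in w1 wK * => Fw.
have a0 : 0 < t^-1 by rewrite invr_gt0.
have a1 : t^-1 < 1 by rewrite invf_lt1.
have -> : z = ofR t^-1 * w by rewrite /w mulrA -ofRM mulVf ?gt_eqF // ofR1 mul1r.
have Qp : 0 < nsq (mQ R m) by rewrite lt_def nsq_eq0 Q0 nsq_ge0.
rewrite ext_form_scale ?nsq_ge0 ?ltW //; have w0 := nsq_ge0 w.
rewrite ltr_wpDr //; first by rewrite mulr_ge0 // ltW.
by rewrite !mulr_gt0 // subr_gt0 //; nra.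
Qed.

(** Such an element is 1 or -1. Once y = 0, |1 + 2 e| = 1 at every place, so each |e|^2 is at most 1
    and their integral trace is between 0 and 3. By [trace_mod7] it is 0 or 3, that is e = 0 or e =
    -1. *)
Lemma mob_mQ_eq0 m z : unit_norm R m -> mQ R m = 0 -> mob (mP R m) (mQ R m) z = z.
Proof.
move=> mu Q0; have r1 := zeta_root7 R; have r2 : root7 (Z ^+ 2) by exact: root7_pow.
have r3 : root7 ((Z ^+ 2) ^+ 2) by exact: root7_pow.
have x2 := xr_pow2 r1; have x3 := xr_pow2 r2; rewrite x2 in x3.
have cub := c1_cubic R.
have y0 : cnorm m.1 = Kub Z0 Z0 Z0.
  have [h1 h2 h3] := evk_cnorm_ge0 R m.1.
  have e1 : evk (c1 R) (cnorm m.1) = 0.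
    have := nsq_mQE R m; rewrite Q0 -(ofR0 R) nsqR expr0n mulr0 => /eqP.
    by rewrite mulf_eq0 mulf_eq0 pnatr_eq0 /= gt_eqF ?beta_gt0 //= => /eqP.
  have [_ p2] := cnorm_place2 mu; have [_ p3] := cnorm_place3 mu.
  have /andP[b21 b22] := c2_bounds R; have /andP[b31 b32] := c3_bounds R.
  have tr := evk_tr (cnorm m.1) cub; rewrite e1 add0r in tr.
  (* At each of the two other places |y|^2 is at most (2 - c) / (4 (1 - c)) < 1/2, since c < 0; so
     the integral trace is below 1. *)
  have T0 : Z.leb (ktr (cnorm m.1)) Z0.
    have : zr (ktr (cnorm m.1)) < zr (Zpos 1) :> R.
      rewrite -tr zr1; move: h2 h3 p2 p3 b21 b22 b31 b32.
      move: (evk (c1 R ^+ 2 - 2) _) (evk ((c1 R ^+ 2 - 2) ^+ 2 - 2) _).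
      move: (c1 R ^+ 2 - 2) => c2; move: (c2 ^+ 2 - 2) => c3 n2 n3; nra.
    by rewrite zr_lt; move: (ktr _) => T; lia.
  rewrite -(zr_le R) -tr zr0 in T0.
  by apply: (@places_eq0 R) => //; lra.
have half (v : C R) : root7 v -> nsq (ev v m.2) + re (ev v m.2) = 0 /\ qP v m = 1 + 2 * ev v m.2.
  move=> v7; have Y0 : ev v m.1 = 0.
    by apply/eqP; rewrite -nsq_eq0 ev_nsq // y0 /= !zr0 !mul0r !addr0.
  have PE : qP v m = 1 + 2 * ev v m.2 by rewrite /qP Y0 mulr0 mul0r addr0.
  split=> //; have := unit_norm_nsq mu v7.
  rewrite PE /qQ Y0 mulr0 mul0r -(ofR0 R) nsqR expr0n mulr0 subr0.
  rewrite -(ofR1 R) -(ofR_nat R 2) /nsq !riE => h; lra.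
have le1 (v : C R) : root7 v -> nsq (ev v m.2) <= 1.
  move=> /half[+ _]; rewrite /nsq; move: (re _) (im _) => a b h; nra.
have [h1 PE] := half _ r1.
have T3 := evk_tr (cnorm m.2) cub; rewrite -x3 -x2 -/(xr Z) -!ev_nsq // in T3.
have l1 := le1 _ r1; have l2 := le1 _ r2; have l3 := le1 _ r3.
have g1 := nsq_ge0 (ev Z m.2); have g2 := nsq_ge0 (ev (Z ^+ 2) m.2).
have g3 := nsq_ge0 (ev ((Z ^+ 2) ^+ 2) m.2).
have [T|T] : ktr (cnorm m.2) = Z0 \/ ktr (cnorm m.2) = Zpos 3.
- apply: (trace_mod7 _ (ktr_cnorm m.2)).
  have t0 : Z.leb Z0 (ktr (cnorm m.2)).
    by rewrite -(zr_le R) -T3 (zr0 R); exact: addr_ge0 (addr_ge0 g1 g2) g3.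
  have t3 : Z.leb (ktr (cnorm m.2)) (Zpos 3).
    rewrite -(zr_le R) -T3 (zr3 R); have -> : 3 = 1 + 1 + 1 :> R by ring.
    exact: lerD (lerD l1 l2) l3.
  by move: t0 t3; move: (ktr _) => t; clear; lia.
- have E0 : ev Z m.2 = 0.
    apply/eqP; rewrite -nsq_eq0; apply/eqP; rewrite T (zr0 R) in T3; exact: sum3_eq0 T3.
  by rewrite Q0 /mP PE E0 mulr0 addr0 mob10.
have Em : ev Z m.2 = -1.
  rewrite T (zr3 R) in T3; have n1 := sum3_eq3 l1 l2 l3 T3.
  have e1 : re (ev Z m.2) = -1 by apply/eqP; rewrite -addr_eq0 addrC -n1 h1.
  have i0 : im (ev Z m.2) ^+ 2 = 0 by move: n1; rewrite /nsq e1 sqrrN expr1n -[RHS]addr0 => /addrI.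
  move/eqP: i0; rewrite sqrf_eq0 => /eqP i0.
  by rewrite -(ofR1 R) -ofRN; apply: CP; rewrite ?riE.
rewrite Q0 /mP PE Em /mob rmorph0 mul0r addr0 add0r.
have -> : 1 + 2 * -1 = -1 :> C R by ring.
by rewrite rmorphN rmorph1 mulN1r divrNN divr1.
Qed.

Lemma interior_moves_out z m : F° z -> unit_norm R m -> mQ R m != 0 ->
  nsq z < nsq (mob (mP R m) (mQ R m) z).
Proof.
move=> zF mu Q0; have := interior_ext_form zF mu Q0; rewrite ext_form_nsq // subr_gt0 => h.
have z1 : nsq z < 1 by have [] := polygonF_disk (interior_subset zF).
have := mob_nsq (mPQ_hyp mu) z1; rewrite mPQ_norm // mul1r.
have := mob_disk (mPQ_hyp mu) z1; move: h; move: (nsq _) (nsq (mob _ _ _)) => a b; nra.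
Qed.

Lemma interior_inequivalent z w : F° z -> F° w -> z <> w -> ~ equivalent (@Gamma_PSU R) z w.
Proof.
move=> zF wF zw [M [g Gg Mg] Mz]; apply: zw; have [m mg] := Gamma_rep Gg.
have z1 : nsq z < 1 by have [] := polygonF_disk (interior_subset zF).
have w1 : nsq w < 1 by have [] := polygonF_disk (interior_subset wF).
have wE : w = mob (mP R m) (mQ R m) z by rewrite mg.2 // -Mz (Mg.2 z) //; exact/diskE.
have [Q0|Q0] := eqVneq (mQ R m) 0; first by rewrite wE mob_mQ_eq0 //; exact: mg.1.
have h1 := interior_moves_out zF mg.1 Q0; rewrite -wE in h1.
have [imu im] := rep_inv mg.
have := interior_moves_out wF imu; rewrite mQ_inv oppr_eq0 => /(_ Q0).
rewrite -mQ_inv im // wE mg.2 // -act_mul // mulVg act1 // -mg.2 // -wE => h2.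
by have := lt_trans h1 h2; rewrite ltxx.
Qed.

End Interior.

(** * Covering *)

Section Box.
Local Open Scope Z_scope.

(** A trace at most K and |csum| at most 3 bound the sum of squares by (2 K + 9) / 7 <= |K| + 2, and
    so each entry. *)
Definition box K := let r := [seq Z.of_nat i | i <- iota 0 (Z.to_nat (Z.abs K + 2)).+1] in
  map cyc_of (enumv (nseq 7 (r ++ map Z.opp r)) (Z.abs K + 2)).

Lemma box_mem a K : ktr (cnorm a) <= K -> exists2 b, ceq a b & b \in box K.
Proof.
move=> aK; have [k sk] := small_shift a; exists (shift k a); first exact: ceq_shift.
rewrite -(cnorm_shift k) in aK; move: (shift k a) sk aK => {}a sa aK.
have aa : dot a a <= Z.abs K + 2.
  by have := ktr_cnorm a; move: sa; rewrite /small => sa; nia.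
apply: mem_enum7 => // i i7; have := @coord_bound _ _ i aa.
move: (nth 0 _ _) => v vv; rewrite nth_nseq i7 mem_cat.
have vle : Z.abs v <= Z.abs K + 2 by nia.
have [v0|v0] := Z.le_ge_cases 0 v; apply/orP; [left|right; apply/mapP; exists (- v); last lia].
  by apply/mapP; exists (Z.to_nat v); [rewrite mem_iota|]; lia.
by apply/mapP; exists (Z.to_nat (- v)); [rewrite mem_iota|]; lia.
Qed.
End Box.

Lemma argmin_seq (d : Order.disp_t) (T : eqType) (V : orderType d) (f : T -> V)
    (P : T -> Prop) (s : seq T) :
  (exists2 a, a \in s & P a) ->
  exists2 a, P a & forall b, b \in s -> P b -> (f a <= f b)%O.
Proof.
elim: s => [[]//|c s IH] [a]; rewrite inE => /orP[/eqP ->|sa] Pa.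
  have [/IH[b Pb Hb]|ns] := pselect (exists2 a, a \in s & P a); last first.
    by exists c => // b; rewrite inE => /orP[/eqP ->//|sb Pb]; case: ns; exists b.
  have [bc|cb] := leP (f b) (f c).
    by exists b => // e; rewrite inE => /orP[/eqP ->//|]; exact: Hb.
  exists c => // e; rewrite inE => /orP[/eqP ->//|se Pe].
  exact: le_trans (ltW cb) (Hb _ se Pe).
have [|b Pb Hb] := IH; first by exists a.
have [Pc|nPc] := pselect (P c); last first.
  by exists b => // e; rewrite inE => /orP[/eqP ->//|]; exact: Hb.
have [bc|cb] := leP (f b) (f c).
  by exists b => // e; rewrite inE => /orP[/eqP ->//|]; exact: Hb.
exists c => // e; rewrite inE => /orP[/eqP ->//|se Pe].
exact: le_trans (ltW cb) (Hb _ se Pe).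
Qed.

Section Covering.
Variable R : realType.
Implicit Types (z w p q : C R) (t : R) (m n : quat).
Local Notation Z := (zeta R).
Local Notation F := (@polygonF R).

Lemma zr_archi (b : R) : exists K, b <= zr K.
Proof.
exists (Z.of_nat (Num.bound `|b|)).
have -> : zr (Z.of_nat (Num.bound `|b|)) = (Num.bound `|b|)%:R :> R.
  rewrite zr.unlock; exact: (congr1 (fun i : int => i%:~R : R) (Z_of_intK (Posz (Num.bound `|b|)))).
by rewrite ltW // (le_lt_trans (ler_norm b)) // archi_boundP.
Qed.

(** With n = |q|^2 and t = |z|^2, the hypothesis gives n (1 + t)^2 <= 4 (n + 1) t when n is not 0,
    that is n (1 - t)^2 <= 4 t < 4. *)
Lemma mQ_bound m z : nsq z < 1 -> unit_norm R m ->
  nsq (mQ R m * z + (mP R m)^*) <= 1 -> nsq (mQ R m) <= 4 / (1 - nsq z) ^+ 2.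
Proof.
move=> z1 mu; rewrite -subr_le0 -ext_form_nsq // /ext_form.
have z0 := nsq_ge0 z; have q0 := nsq_ge0 (mQ R m).
have w2 : re (mQ R m * mP R m * z) ^+ 2 <= nsq (mQ R m) * (nsq (mQ R m) + 1) * nsq z.
  have <- : nsq (mQ R m * mP R m * z) = nsq (mQ R m) * (nsq (mQ R m) + 1) * nsq z.
    rewrite 2!nsqM; have := mPQ_norm mu; move: (nsq (mP R m)) (nsq (mQ R m)) => p q E.
    by congr (_ * _ * _); lra.
  by rewrite lerDl sqr_ge0.
rewrite ler_pdivlMr ?exprn_gt0 ?subr_gt0 //.
move: w2; move: (re _) (nsq (mQ R m)) (nsq z) z0 z1 q0 => r n t t0 t1 n0 r2 h.
have {h} h : n * (1 + t) <= 2 * - r by lra.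
have nt : 0 <= n * (1 + t) by rewrite mulr_ge0 // addr_ge0.
have h2 : (n * (1 + t)) ^+ 2 <= 4 * (n * (n + 1) * t).
  apply: (@le_trans _ _ ((2 * - r) ^+ 2)); last by rewrite exprMn sqrrN; lra.
  by rewrite lerXn2r ?nnegrE // (le_trans nt).
have [->|n1] := eqVneq n 0; first by rewrite mul0r.
have np : 0 < n by rewrite lt_def n1.
rewrite -(ler_pM2l np); nra.
Qed.

(** Discreteness: [mQ_bound] controls the numerators at the place of zeta and the definite norm at
    the two others, so their traces are bounded and they lie in a finite box. *)
Lemma finite_transforms z : nsq z < 1 -> exists L : seq (C R * C R), forall m, unit_norm R m ->
  nsq (mQ R m * z + (mP R m)^*) <= 1 -> (mP R m, mQ R m) \in L.
Proof.
move=> z1; have r1 := zeta_root7 R; have [z7 zn1] := r1; have phi := root7_phi r1.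
pose N := 4 / (1 - nsq z) ^+ 2.
have [K1 HK1] := zr_archi ((2 - c1 R) * N / (4 * beta R) + 2).
have [K2 HK2] := zr_archi ((2 - c1 R) * (N + 1) + 8).
pose K := Z.max K1 K2.
exists [seq (ev Z a / (1 - Z), omega R * (2 * ev Z b / (1 - Z))) | a <- box K, b <- box K].
move=> m mu /(mQ_bound z1 mu) mN; rewrite -/N in mN.
have cub := c1_cubic R.
have trE a : zr (ktr (cnorm a)) = evk (c1 R) (cnorm a) + evk (c1 R ^+ 2 - 2) (cnorm a)
   + evk ((c1 R ^+ 2 - 2) ^+ 2 - 2) (cnorm a) :> R.
  by rewrite -(evk_tr _ cub).
have [u2 v2] := cnorm_place2 mu; have [u3 v3] := cnorm_place3 mu.
have /andP[b21 b22] := c2_bounds R; have /andP[b31 b32] := c3_bounds R.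
have /andP[b11 b12] := c1_bounds R; have bp := beta_gt0 R.
have [_ h2 h3] := evk_cnorm_ge0 R m.1.
have E1 := nsq_mQE R m; have E2 := nsq_mPE R m; have E3 := mPQ_norm mu.
have n2 : evk (c1 R ^+ 2 - 2) (cnorm m.1) <= 1.
  by move: v2 h2 b21 b22; move: (evk (c1 R ^+ 2 - 2) (cnorm m.1)) (c1 R ^+ 2 - 2) => n c; nra.
have n3 : evk ((c1 R ^+ 2 - 2) ^+ 2 - 2) (cnorm m.1) <= 1.
  move: v3 h3 b31 b32; move: (c1 R ^+ 2 - 2) => c2.
  by move: (evk (c2 ^+ 2 - 2) (cnorm m.1)) (c2 ^+ 2 - 2) => n c; nra.
have n1 : evk (c1 R) (cnorm m.1) <= (2 - c1 R) * N / (4 * beta R).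
  rewrite ler_pdivlMr ?mulr_gt0 // mulrC E1 ler_wpM2l //.
  by rewrite subr_ge0 ltW // (lt_trans b12) //; lra.
have m1 : evk (c1 R) (cnorm (qnum m)) <= (2 - c1 R) * (N + 1).
  rewrite E2 ler_wpM2l //; last by lra.
  by rewrite subr_ge0 ltW // (lt_trans b12) //; lra.
have [a ea aK] : exists2 a, ceq (qnum m) a & a \in box K.
  apply: box_mem; apply: (@Z.le_trans _ K2); last exact: Z.le_max_r.
  apply/Z.leb_le; rewrite -(zr_le R) trE; apply: le_trans HK2.
  have -> : 8 = 4 + 4 :> R by ring.
  have u2' : evk (c1 R ^+ 2 - 2) (cnorm (qnum m)) <= 4.
    by apply: le_trans u2 _; move: b21; move: (c1 R ^+ 2 - 2) => c; lra.
  have u3' : evk ((c1 R ^+ 2 - 2) ^+ 2 - 2) (cnorm (qnum m)) <= 4.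
    by apply: le_trans u3 _; move: b31; move: ((c1 R ^+ 2 - 2) ^+ 2 - 2) => c; lra.
  by rewrite (addrA _ 4 4); exact: lerD (lerD m1 u2') u3'.
have [b eb bK] : exists2 b, ceq m.1 b & b \in box K.
  apply: box_mem; apply: (@Z.le_trans _ K1); last exact: Z.le_max_l.
  apply/Z.leb_le; rewrite -(zr_le R) trE; apply: le_trans HK1.
  have -> : 2 = 1 + 1 :> R by ring.
  by rewrite (addrA _ 1 1); exact: lerD (lerD n1 n2) n3.
apply/allpairsP; exists (a, b); split=> //=.
rewrite -(ev_ceq phi ea) -(ev_ceq phi eb) qnumE // /mP /mQ /qQ [in RHS]mulrAC divff ?mul1r //.
by rewrite subr_eq0 eq_sym.
Qed.

Lemma covering z : nsq z < 1 -> exists2 w, F w & equivalent (@Gamma_PSU R) z w.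
Proof.
move=> z1; have [L HL] := finite_transforms z1.
pose cost (a : C R * C R) := nsq (a.2 * z + a.1^*).
pose P (a : C R * C R) := exists m g, [/\ Gamma g, rep R m g, a = (mP R m, mQ R m) & cost a <= 1].
have c1 : cost (mP R qone, mQ R qone) <= 1.
  by rewrite /cost /mP /mQ /= qP_one qQ_one mulr0 mul0r add0r rmorph1 -(ofR1 R) nsqR expr1n.
have [|_ [m0 [g0 [Gg0 mg0 -> le1]]] min0] := @argmin_seq _ _ _ cost P L.
  exists (mP R qone, mQ R qone); first exact: HL _ (@unit_norm_one R) c1.
  by exists qone, 1%g; split=> //; [exact: Gamma_one|exact: rep_one].
(* The identity has cost 1, so elements of larger cost, which may be missing from L, cannot beat the
   minimum. *)
have {}min0 m g : Gamma g -> rep R m g -> cost (mP R m0, mQ R m0) <= cost (mP R m, mQ R m).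
  move=> Gg mg; have [c|/ltW c] := leP (cost (mP R m, mQ R m)) 1; last exact: le_trans c.
  by apply: min0; [exact: HL _ mg.1 c|exists m, g].
have hyp := mPQ_hyp mg0.1; pose w := mob (mP R m0) (mQ R m0) z.
exists w; last first.
  exists (pqmx (mP R m0) (mQ R m0)); last exact: mobius_pqmx.
  by exists g0 => //; exact: rep_represents.
apply: polygonF_sup => [|i i42]; first exact: mob_disk.
have ri := rep_gamma R i; rewrite ext_form_nsq; last exact: ri.1.
have := min0 _ _ (Gamma_mul (Gamma_gamma i42) Gg0) (rep_mul ri mg0).
rewrite /cost /= mP_mul mQ_mul -mob_cocycle // -/w nsqM -[X in X <= _]mul1r.
by rewrite ler_pM2r ?subr_ge0 // lt_def nsq_eq0 mob_den ?nsq_ge0.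
Qed.

End Covering.

Theorem theorem3p5 (R : realType) : fundamental_domain (@Gamma_PSU R) (@polygonF R).
Proof.
split=> [z /polygonF_disk[z1 _]|z [Fz _]|z w|z /diskE z1].
- exact/diskE.
- by rewrite /polygonF -(closure_id _).1 in Fz; last exact: closed_closure.
- exact: interior_inequivalent.
exact: covering.
Qed.
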